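(* Let $H$ be a graph with at least one edge. There is some (explicit) $\alpha_H>0$, depending only on $H$, so that for $p=p_n\to0$ with $p\ge n^{-\alpha_H}$ the following large deviation results hold. (i) There exists $\overline{r}_H<1$ (depending only on $H$) so that for all $r\in(\overline{r}_H,1)$, $$\lim_{n\to\infty}\frac{2}{n^2p}\log\mathbb{P}\big(t(H,\mathcal{G}(n,p))\le(rp)^{e(H)}\big)=-h(r).$$ (ii) If $H$ is non-bipartite, then there exists $\underline{r}_H>0$ (depending only on $H$) so that for all $r\in(0,\underline{r}_H)$, $$\liminf_{n\to\infty}\frac{2}{n^2p}\log\mathbb{P}\big(t(H,\mathcal{G}(n,p))\le(rp)^{e(H)}\big)>-h(r).$$ (iii) For $H=K_3$, we may take $\overline{r}_{K_3}=0.466\dots$, the unique $r\in(0,1)$ satisfying $\tfrac32r\log r-r+1=0$, and $\underline{r}_{K_3}=0.209\dots$, the maximum value of $r<1$ such that the function $f_r$ (defined in the context) has a zero in the open interval $(0,r)$.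
   Context: Graphs are finite and simple; $v(\cdot)$ and $e(\cdot)$ denote numbers of vertices and edges. For graphs $H,G$, $\hom(H,G)$ is the number of graph homomorphisms from $H$ to $G$ and $t(H,G):=\hom(H,G)/v(G)^{v(H)}$. $\mathcal{G}(n,p)$ is the Erdős–Rényi random graph on $n$ vertices with edge probability $p$. $K_3$ is the triangle. Let $h(x):=x\log x-x+1$ for $x\in[0,1]$ (with $h(0)=1$). For $0<r<1$, define $f_r(x):=\tfrac12h(x)+\tfrac12h\Big(\sqrt{\tfrac{4r^3-x^3}{3x}}\Big)-h(r)$ for those $x\in(0,r]$ with $\sqrt{(4r^3-x^3)/(3x)}\le1$. *)

(* Defs.v *)
From HB Require Import structures.
From mathcomp Require Import all_boot all_order all_algebra.
From mathcomp Require Import all_classical all_reals all_analysis.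

Set Implicit Arguments.
Unset Strict Implicit.
Unset Printing Implicit Defensive.

Import Order.TTheory GRing.Theory Num.Theory.
Import numFieldNormedType.Exports.

Local Open Scope ring_scope.

Record sgraph := SGraph {
  vertex :> finType;
  edge : rel vertex;
  edge_sym : symmetric edge;
  edge_irr : irreflexive edge }.

Definition vcount (G : sgraph) : nat := #|G|.

(* Unordered edges, as two-element sets of vertices. *)
Definition edges (G : sgraph) : {set {set G}} :=
  [set [set u.1; u.2] | u : G * G & edge u.1 u.2].

Definition ecount (G : sgraph) : nat := #|edges G|.

Definition bipartite (G : sgraph) : Prop :=
  exists c : G -> bool, forall x y : G, edge x y -> c x != c y.

Definition isomorphic (G1 G2 : sgraph) : Prop :=
  exists2 f : G1 -> G2, bijective f & forall x y, edge (f x) (f y) = edge x y.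

Lemma neq_sym (T : eqType) : symmetric (fun x y : T => x != y).
Proof. by move=> x y; rewrite eq_sym. Qed.

Lemma neq_irr (T : eqType) : irreflexive (fun x y : T => x != y).
Proof. by move=> x; rewrite eqxx. Qed.

Definition complete_graph (n : nat) : sgraph :=
  SGraph (@neq_sym 'I_n) (@neq_irr 'I_n).

Definition is_hom (H G : sgraph) (f : {ffun H -> G}) : bool :=
  [forall x, forall y, edge x y ==> edge (f x) (f y)].

Definition hom_count (H G : sgraph) : nat := #|[set f : {ffun H -> G} | is_hom f]|.

Definition hom_density (R : realType) (H G : sgraph) : R :=
  (hom_count H G)%:R / (vcount G)%:R ^+ vcount H.

Section RandomGraph.
Variable n : nat.

Definition pair_edge (w : {set {set 'I_n}}) : rel 'I_n :=
  fun x y => (x != y) && ([set x; y] \in w).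

Lemma pair_edge_sym w : symmetric (pair_edge w).
Proof. by move=> x y; rewrite /pair_edge eq_sym finset.setUC. Qed.

Lemma pair_edge_irr w : irreflexive (pair_edge w).
Proof. by move=> x; rewrite /pair_edge eqxx. Qed.

Definition graph_of_edges (w : {set {set 'I_n}}) : sgraph :=
  SGraph (pair_edge_sym w) (pair_edge_irr w).

(* Probability that G(n,p) satisfies A: a sum over the possible edge sets w
   of the graph on 'I_n, each pair lying in w independently with probability
   p. *)
Definition gnp_prob (R : realType) (p : R) (A : pred sgraph) : R :=
  \sum_(w in powerset (edges (complete_graph n)) | A (graph_of_edges w))
    \prod_(e in edges (complete_graph n)) (if e \in w then p else 1 - p).

End RandomGraph.

(* As ln 0 = 0 in the library, h 0 = 1. *)
Definition h (R : realType) (x : R) : R := x * ln x - x + 1.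

Definition partner (R : realType) (r x : R) : R :=
  Num.sqrt ((4 * r ^+ 3 - x ^+ 3) / (3 * x)).

Definition f_tri_dom (R : realType) (r x : R) : Prop :=
  0 < x <= r /\ partner r x <= 1.

Definition f_tri (R : realType) (r x : R) : R :=
  2^-1 * h x + 2^-1 * h (partner r x) - h r.

Definition f_tri_has_zero (R : realType) (r : R) : Prop :=
  exists x : R, [/\ 0 < x < r, f_tri_dom r x & f_tri r x = 0].

Definition edge_prob_seq (R : realType) (alpha : R) (p : nat -> R) : Prop :=
  [/\ forall n, 0 <= p n <= 1,
      (p @ \oo --> (0 : R))%classic &
      (\forall n \near \oo, (n%:R `^ (- alpha) <= p n)%R)%classic].

(* The logarithm lne is extended-real valued, with lne 0 = -oo. *)
Definition lower_tail_rate (R : realType) (H : sgraph) (p : nat -> R) (r : R)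
    (n : nat) : \bar R :=
  ((2 / (n%:R ^+ 2 * p n))%R%:E *
   lne (gnp_prob n (p n)
          (fun G => hom_density R H G <= (r * p n) ^+ ecount H)%R)%:E)%E.

Definition tight_above (R : realType) (H : sgraph) (alpha rbar : R) : Prop :=
  forall r : R, rbar < r < 1 ->
  forall p : nat -> R, edge_prob_seq alpha p ->
    (lower_tail_rate H p r @ \oo --> (- h r)%:E)%classic.

Definition not_tight_below (R : realType) (H : sgraph) (alpha rlow : R) : Prop :=
  forall r : R, 0 < r < rlow ->
  forall p : nat -> R, edge_prob_seq alpha p ->
    ((- h r)%:E < limn_einf (lower_tail_rate H p r))%E.

(* Main.v *)
From HB Require Import structures.
Require Import Defs.
From mathcomp Require Import all_boot all_order all_algebra.
From mathcomp Require Import all_classical all_reals all_analysis.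
From mathcomp Require Import ring lra zify.
From mathcomp Require Import fintype finset.

(** The probability of the lower tail is governed by a variational problem: among
    symmetric weights [u] in the unit interval whose homomorphism density is at
    most [r^e(H)], minimise the average of [h u].  The normalised logarithm of
    the probability tends to minus the minimum, so it tends to [- h r] if the
    constant [r] is a minimiser ([replica_symmetric]), and stays above [- h r]
    if some other weight does better.

    Upper bound ([lower_tail_upper]).  By weak regularity every graph is within
    cut distance [eps n^2] of one of [exp (O (n / eps^2))] step matrices, which
    cuts the event into few pieces.  The Chernoff bound, with Jensen's
    inequality inside a piece ([prob_le_exp_mean]), bounds its probability in
    terms of the entropy of its conditional mean.  That mean is close in cut
    norm to the graphs of the piece, so by the counting lemma ([hom_wt_cut]) its
    density is essentially that of the event.  The error [eps] must be of order
    [p^e(H)]; the number of pieces is negligible against [exp (n^2 p)] once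
    [n p^(2 e(H) + 1)] tends to infinity, which is how the exponent is chosen.

    Lower bound ([lower_tail_lower]).  Tilt the edge probabilities from [p] to
    [p u]: the tilted graph is in the event with a fixed probability by Markov's
    inequality, and the likelihood ratio concentrates.

    Optimality of the constant.  An inequality between [h] and the product of
    the weights on the edges of [H], averaged over all maps, shows optimality
    ([replica_symmetric_pointwise]); it propagates to larger [r] by scaling
    ([replica_symmetric_mono]).  For general [H] it holds near 1.  For the
    triangle it holds at 0.466, which lies below the root of
    [3/2 r ln r - r + 1], by tangents to the entropy in logarithmic coordinates.

    Failure of optimality.  The competitors have two blocks, the parity classes
    of the vertices.  If [H] is not bipartite, weight 0 inside the blocks kills
    all homomorphisms at the rate [- 1/2], whatever [r] is.  For the triangle,
    weights [x] inside and [y] across give the density [(x^3 + 3 x y^2) / 4], so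
    that [y = partner r x] keeps it at [r^3], and the comparison of the entropies
    is the sign of [f_tri r x].  With [x = r a] this sign changes at an explicit
    density that depends on the shape [a] only.  Maximising that density, capped
    by the condition [y <= 1], over [a] therefore yields the largest [r] at
    which [f_tri r] has a zero, below which a competitor is strictly better.  The
    decimal places of this threshold come from tangent bounds at 0.21, the shape
    3/38 at 0.209, and truncations of the series of [ln] ([ln_bounds]). *)

Set Implicit Arguments.
Unset Strict Implicit.
Unset Printing Implicit Defensive.

Import Order.TTheory GRing.Theory Num.Theory.
Import numFieldNormedType.Exports.

Local Open Scope ring_scope.

(** * Product measures on the subsets of a finite set *)

Section ProductMeasure.
Variables (R : realType) (T : finType).
Implicit Types (q p a u : T -> R) (F G : {set T} -> R) (A B C : pred {set T}).
Implicit Types (w : {set T}).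

Definition bern q w : R := \prod_e (if e \in w then q e else 1 - q e).

Definition expect q F : R := \sum_w bern q w * F w.

Definition prob q A : R := \sum_(w | A w) bern q w.

Definition is_param q := forall e, 0 <= q e <= 1.

Lemma bern_ge0 q w : is_param q -> 0 <= bern q w.
Proof.
move=> hq; apply: prodr_ge0 => e _; case: ifP => _; have /andP[h0 h1] := hq e => //.
by rewrite subr_ge0.
Qed.

Lemma expect_prod q (g : T -> bool -> R) :
  expect q (fun w => \prod_e g e (e \in w)) =
  \prod_e (q e * g e true + (1 - q e) * g e false).
Proof.
rewrite bigA_distr; apply: eq_bigr => w _.
by rewrite /bern -big_split; apply: eq_bigr => e _; case: (e \in w).
Qed.

Lemma expect_sum q (I : finType) (P : pred I) (F : I -> {set T} -> R) :
  expect q (fun w => \sum_(i | P i) F i w) = \sum_(i | P i) expect q (F i).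
Proof.
rewrite /expect exchange_big /=; apply: eq_bigr => w _.
by rewrite mulr_sumr.
Qed.

Lemma expectZ q c F : expect q (fun w => c * F w) = c * expect q F.
Proof. by rewrite /expect mulr_sumr; apply: eq_bigr => w _; rewrite mulrCA. Qed.

Lemma eq_expect q F G : F =1 G -> expect q F = expect q G.
Proof. by move=> e; apply: eq_bigr => w _; rewrite e. Qed.

Lemma le_expect q F G : is_param q -> (forall w, F w <= G w) ->
  expect q F <= expect q G.
Proof. by move=> hq h; apply: ler_sum => w _; rewrite ler_wpM2l ?bern_ge0. Qed.

Lemma expect_subset q (S : {set T}) :
  expect q (fun w => \prod_(e in S) (e \in w)%:R) = \prod_(e in S) q e.
Proof.
under eq_expect => w do rewrite big_mkcond /=.
rewrite (expect_prod q (fun e b => if e \in S then b%:R else 1)).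
rewrite [RHS]big_mkcond /=; apply: eq_bigr => e _.
by case: ifP => _; rewrite ?mulr1 ?mulr0 ?addr0 // subrKC.
Qed.

Lemma expect_cst q c : expect q (fun=> c) = c.
Proof.
have := expect_subset q set0.
under eq_expect => w do rewrite big_set0.
rewrite big_set0 => h1.
have := expectZ q c (fun=> 1); by rewrite h1 mulr1.
Qed.

Lemma probE q A : prob q A = expect q (fun w => (A w)%:R).
Proof.
rewrite /prob big_mkcond; apply: eq_bigr => w _.
by case: (A w); rewrite ?mulr1 ?mulr0.
Qed.

Lemma prob_ge0 q A : is_param q -> 0 <= prob q A.
Proof. by move=> hq; apply: sumr_ge0 => w _; apply: bern_ge0. Qed.

Lemma le_prob q A B : is_param q -> (forall w, A w -> B w) ->
  prob q A <= prob q B.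
Proof.
move=> hq AB; rewrite !probE; apply: le_expect => // w.
by case hA: (A w) => //=; rewrite (AB _ hA).
Qed.

Lemma prob_le_add q A B C : is_param q -> (forall w, A w -> B w || C w) ->
  prob q A <= prob q B + prob q C.
Proof.
move=> hq h; rewrite !probE -big_split /= /expect; apply: ler_sum => w _.
rewrite -mulrDr ler_wpM2l ?bern_ge0 // -natrD ler_nat.
by have := h w; case: (A w) => // /(_ isT); case: (B w); case: (C w).
Qed.

Lemma prob_le_sum q A (I : finType) (B : I -> pred {set T}) : is_param q ->
  (forall w, A w -> exists i, B i w) -> prob q A <= \sum_i prob q (B i).
Proof.
move=> hq h; under eq_bigr do rewrite probE.
rewrite probE -expect_sum; apply: le_expect => // w.
case hA: (A w); last by apply: sumr_ge0 => i _; rewrite ler0n.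
have [i Bi] := h w hA; rewrite (bigD1 i) //= Bi lerDl.
by apply: sumr_ge0 => j _; rewrite ler0n.
Qed.

Lemma markov_prob q A F c : is_param q -> (forall w, 0 <= F w) ->
  (forall w, A w -> c <= F w) -> c * prob q A <= expect q F.
Proof.
move=> hq F0 h; rewrite probE -expectZ; apply: le_expect => // w.
by case hA: (A w); rewrite ?mulr1 ?mulr0 // h.
Qed.

(** Centred coordinates are orthogonal, so the variance of a linear statistic
    is the sum of the variances of its terms. *)
Lemma expect_centered q e f :
  expect q (fun w => ((e \in w)%:R - q e) * ((f \in w)%:R - q f)) =
  if e == f then q e * (1 - q e) else 0.
Proof.
pose g (e' : T) (b : bool) : R :=
  (if e' == e then b%:R - q e else 1) * (if e' == f then b%:R - q f else 1).
have -> : expect q (fun w => ((e \in w)%:R - q e) * ((f \in w)%:R - q f)) =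
          expect q (fun w => \prod_e' g e' (e' \in w)).
  apply: eq_expect => w; rewrite big_split /=; congr (_ * _).
    rewrite (bigD1 e) //= eqxx big1 ?mulr1 // => i /negbTE -> //.
  by rewrite (bigD1 f) //= eqxx big1 ?mulr1 // => i /negbTE ->.
rewrite expect_prod (bigD1 e) //= /g eqxx; case: eqP => [<-|/eqP nef].
  rewrite big1 => [|i /negbTE -> ]; first by rewrite /=; ring.
  by rewrite !mulr1 subrKC.
by rewrite [X in X * _](_ : _ = 0) ?mul0r //=; ring.
Qed.

Lemma expect_linear_sqr q a :
  expect q (fun w => (\sum_e a e * ((e \in w)%:R - q e)) ^+ 2) =
  \sum_e a e ^+ 2 * (q e * (1 - q e)).
Proof.
under eq_expect => w do rewrite expr2 mulr_suml.
rewrite (expect_sum q xpredT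
  (fun e w => a e * ((e \in w)%:R - q e) * \sum_f a f * ((f \in w)%:R - q f))).
apply: eq_bigr => e _.
under eq_expect => w do rewrite mulr_sumr.
rewrite (expect_sum q xpredT
  (fun f w => a e * ((e \in w)%:R - q e) * (a f * ((f \in w)%:R - q f)))).
rewrite (bigD1 e) //= big1 => [|f nfe].
  under eq_expect => w do rewrite mulrACA.
  by rewrite expectZ expect_centered eqxx addr0 expr2.
under eq_expect => w do rewrite mulrACA.
by rewrite expectZ expect_centered eq_sym (negbTE nfe) mulr0.
Qed.

Lemma chebyshev q a s : is_param q -> 0 < s ->
  prob q (fun w => s <= \sum_e a e * ((e \in w)%:R - q e)) <=
  (\sum_e a e ^+ 2 * (q e * (1 - q e))) / s ^+ 2.
Proof.
move=> hq s0; rewrite ler_pdivlMr ?exprn_gt0 // mulrC -expect_linear_sqr.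
apply: markov_prob => // [w|w hw]; first exact: sqr_ge0.
by rewrite lerXn2r // nnegrE ?ltW // (lt_le_trans s0).
Qed.

(** The Chernoff bound with Jensen's inequality inside the event: the tilted
    mass of [A] is at least its mass times the tilt at the conditional mean
    [M], and the total tilted mass is a product.  Optimising over [u] would
    give the relative entropy of the product measure with mean [M]. *)
Lemma prob_le_exp_mean q A (M u : T -> R) : is_param q ->
  (forall e, 0 < u e) ->
  (forall e, prob q A * M e = \sum_(w | A w) bern q w * (e \in w)%:R) ->
  prob q A <= expR (- \sum_e (M e * ln (u e) + q e * (1 - u e))).
Proof.
move=> hq u0 hM.
pose th e := ln (u e); pose m := \sum_e M e * th e.
pose X w := \sum_e (e \in w)%:R * th e.
have XE w : expR (X w) = \prod_e (if e \in w then u e else 1).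
  rewrite expR_sum; apply: eq_bigr => e _.
  by case: (e \in w); rewrite ?mul1r ?mul0r ?expR0 // lnK // posrE.
have h1 : expR m * prob q A <= \sum_(w | A w) bern q w * expR (X w).
  have -> : expR m * prob q A =
      \sum_(w | A w) bern q w * (expR m * (1 + (X w - m))).
    transitivity (expR m * (prob q A + (\sum_e prob q A * M e * th e
        - prob q A * m))).
      congr (_ * _); rewrite /m mulr_sumr.
      under [X in X - _]eq_bigr do rewrite -mulrA.
      by rewrite subrr addr0.
    under [X in _ + (X - _)]eq_bigr do rewrite hM mulr_suml.
    rewrite exchange_big /= /prob [X in _ - X]mulr_suml -sumrB -big_split /=.
    rewrite mulr_sumr; apply: eq_bigr => w _.
    rewrite mulrCA; congr (_ * _); rewrite /X mulrDr mulr1 mulrBr mulr_sumr.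
    rewrite [in RHS]mulr_sumr; congr (_ + (_ - _)).
    by apply: eq_bigr => e _; rewrite mulrA.
  apply: ler_sum => w _; rewrite ler_wpM2l ?bern_ge0 //.
  have -> : expR (X w) = expR m * expR (X w - m) by rewrite -expRD subrKC.
  by rewrite ler_pM2l ?expR_gt0 // expR_ge1Dx.
have h2 : \sum_(w | A w) bern q w * expR (X w) <=
          expR (\sum_e q e * (u e - 1)).
  apply: (@le_trans _ _ (expect q (fun w => expR (X w)))).
    rewrite /expect [X in _ <= X](bigID A) /= lerDl; apply: sumr_ge0 => w _.
    by rewrite mulr_ge0 ?expR_ge0 ?bern_ge0.
  under eq_expect => w do rewrite XE.
  rewrite (expect_prod q (fun e b => if b then u e else 1)) /= expR_sum.
  apply: ler_prod => e _; apply/andP; split.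
    have /andP[q0 q1] := hq e.
    by rewrite addr_ge0 ?mulr_ge0 ?subr_ge0 // ltW.
  by rewrite (_ : _ + _ = 1 + q e * (u e - 1)) ?expR_ge1Dx //; ring.
have := le_trans h1 h2; rewrite mulrC -ler_pdivlMr ?expR_gt0 //.
rewrite -expRN -expRD => h3; apply: (le_trans h3); rewrite ler_expR /m.
rewrite -sumrN -big_split /= -sumrN; apply: ler_sum => e _; rewrite /th; lra.
Qed.

(** The log-likelihood ratio of [q] to [p] at a present, resp. an absent,
    coordinate. *)
Definition llr1 p q e := ln (q e / p e).
Definition llr0 p q e := ln ((1 - q e) / (1 - p e)).

(** Change of measure: on the part of [A] where the log-likelihood ratio of
    [q] to [p] exceeds its mean [D] by at most [s], the measure of [p] is at
    least [exp (- (D + s))] times that of [q]; the rest of [A] is controlled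
    by the variance. *)
Lemma prob_tilt p q A (s : R) : is_param q -> (forall e, 0 <= p e < 1) ->
  (forall e, q e < 1) -> (forall e, p e = 0 -> q e = 0) ->
  (forall e, q e = 0 -> p e = 0) -> 0 < s ->
  expR (- (\sum_e (q e * llr1 p q e + (1 - q e) * llr0 p q e) + s)) *
  (prob q A - (\sum_e (llr1 p q e - llr0 p q e) ^+ 2 * (q e * (1 - q e)))
              / s ^+ 2) <=
  prob p A.
Proof.
move=> hq p01 q1 pq qp s0; set l1 := llr1 p q; set l0 := llr0 p q.
have hp : is_param p by move=> e; have /andP[-> /ltW ->] := p01 e.
set D := \sum_e (_ + _).
pose Y w := \sum_e (l1 e - l0 e) * ((e \in w)%:R - q e).
have lik w : bern q w = bern p w * expR (D + Y w).
  rewrite /D /Y -big_split /= expR_sum /bern -big_split /=.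
  apply: eq_bigr => e _; case: (e \in w) => /=.
    rewrite [X in expR X](_ : _ = l1 e); last by rewrite /=; ring.
    have [pe0|pe0] := eqVneq (p e) 0; first by rewrite pe0 pq // mul0r.
    rewrite /l1 /llr1.
    have q0 : 0 < q e.
      have /andP[q0 _] := hq e; rewrite lt_neqAle q0 andbT eq_sym.
      by apply/eqP => /qp /eqP; rewrite (negbTE pe0).
    have p0 : 0 < p e by rewrite lt_neqAle eq_sym pe0; have /andP[->] := p01 e.
    by rewrite lnK ?posrE ?divr_gt0 // mulrC divfK.
  rewrite [X in expR X](_ : _ = l0 e); last by rewrite /=; ring.
  have /andP[_ p1] := p01 e; rewrite /l0 /llr0.
  rewrite lnK ?posrE ?divr_gt0 ?subr_gt0 // mulrC divfK //.
  by rewrite subr_eq0 gt_eqF.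
pose B w := A w && (Y w < s).
apply: (@le_trans _ _ (prob p B)); last first.
  by apply: le_prob => // w /andP[].
apply: (@le_trans _ _ (expR (- (D + s)) * prob q B)).
  rewrite ler_pM2l ?expR_gt0 // lerBlDr.
  apply: (@le_trans _ _ (prob q B + prob q (fun w => s <= Y w))).
    apply: prob_le_add => // w Aw; rewrite /B Aw /=.
    by have [] := ltP (Y w) s.
  by rewrite lerD2l; apply: chebyshev.
rewrite /prob mulr_sumr; apply: ler_sum => w /andP[_ Yw].
rewrite lik mulrCA -expRD -[X in _ <= X]mulr1 ler_wpM2l ?bern_ge0 //.
rewrite -[X in _ <= X]expR0 ler_expR; lra.
Qed.

End ProductMeasure.

(** * Homomorphism sums over weighted pairs *)

Section EdgeSets.
Variable H : sgraph.
Implicit Types (e : {set H}).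

Lemma edgesP e :
  reflect (exists a b : H, [/\ edge a b, a != b & e = [set a; b]]) (e \in edges H).
Proof.
apply: (iffP imsetP) => [[[a b] /= ab ->]|[a [b [ab _ ->]]]].
  move: ab; rewrite inE /= => ab; exists a, b; split=> //.
  by apply: contraTneq ab => ->; rewrite edge_irr.
by exists (a, b) => //; rewrite inE.
Qed.

Lemma card_edge e : e \in edges H -> #|e| = 2%N.
Proof. by case/edgesP=> a [b [_ ab ->]]; rewrite cards2 ab. Qed.

Lemma edge_both e a b : e \in edges H -> a != b -> a \in e -> b \in e ->
  e = [set a; b].
Proof.
move=> he ab ae be; apply/eqP; rewrite eq_sym eqEcard card_edge // cards2 ab.
by rewrite leqnn andbT subUset !sub1set ae.
Qed.

Lemma mem_edges a b : (a != b) -> ([set a; b] \in edges H) = edge a b.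
Proof.
move=> ab; apply/edgesP/idP => [[c [d [cd _ e]]]|eab]; last by exists a, b.
have ha : a \in [set c; d] by rewrite -e !inE eqxx.
have hb : b \in [set c; d] by rewrite -e !inE eqxx orbT.
move: ha hb ab; rewrite !inE => /orP[]/eqP-> /orP[]/eqP->; rewrite ?eqxx // => _.
by rewrite edge_sym.
Qed.

End EdgeSets.

Lemma prodr_01 (R : realType) (I : finType) (P : pred I) (F : I -> R) :
  (forall i, P i -> 0 <= F i <= 1) -> 0 <= \prod_(i | P i) F i <= 1.
Proof.
move=> h; apply/andP; split.
  by apply: prodr_ge0 => i /h /andP[].
by apply: (@le_trans _ _ (\prod_(i | P i) 1)); [exact: ler_prod|rewrite big1_eq].
Qed.

Section CutNorm.
Variables (R : realType) (n : nat).
Implicit Types (Z : 'I_n -> 'I_n -> R) (f g a : 'I_n -> R) (c : R).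

(** The cut norm of [Z], unnormalised, is at most [c]. *)
Definition cut_le Z c :=
  forall S S' : {set 'I_n}, `|\sum_(x in S) \sum_(y in S') Z x y| <= c.

Lemma sum_le_pos_part a f : (forall x, 0 <= f x <= 1) ->
  \sum_x f x * a x <= \sum_(x in [set x | 0 <= a x]) a x.
Proof.
move=> hf; rewrite [X in _ <= X]big_mkcond /=; apply: ler_sum => x _.
have /andP[f0 f1] := hf x; rewrite inE; case: ifPn => [a0|]; first nra.
by rewrite -ltNge => a0; nra.
Qed.

(** A bilinear form on the cube is maximal at a vertex, so testing on sets
    controls testing on functions with values in the unit interval. *)
Lemma cut_le_fun Z c f g : cut_le Z c -> (forall x, 0 <= f x <= 1) ->
  (forall y, 0 <= g y <= 1) -> `|\sum_x \sum_y f x * g y * Z x y| <= c.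
Proof.
move=> hZ hf hg.
have up (Z' : 'I_n -> 'I_n -> R) : cut_le Z' c ->
    \sum_x \sum_y f x * g y * Z' x y <= c.
  move=> hZ'; pose a x := \sum_y g y * Z' x y.
  have -> : \sum_x \sum_y f x * g y * Z' x y = \sum_x f x * a x.
    apply: eq_bigr => x _; rewrite mulr_sumr.
    by apply: eq_bigr => y _; rewrite mulrA.
  apply: (le_trans (sum_le_pos_part a hf)).
  set S := [set x | _]; rewrite exchange_big /=.
  under eq_bigr do rewrite -mulr_sumr.
  apply: (le_trans (sum_le_pos_part (fun y => \sum_(x in S) Z' x y) hg)).
  rewrite exchange_big /=; apply: (le_trans _ (hZ' S _)); exact: ler_norm.
rewrite ler_norml up // andbT lerNl.
have -> : - (\sum_x \sum_y f x * g y * Z x y) =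
          \sum_x \sum_y f x * g y * - Z x y.
  rewrite -sumrN; apply: eq_bigr => x _; rewrite -sumrN.
  by apply: eq_bigr => y _; rewrite mulrN.
apply: up => S S'.
under eq_bigr do rewrite sumrN.
by rewrite sumrN normrN.
Qed.

End CutNorm.

Section HomWeight.
Variables (R : realType) (H : sgraph) (n : nat).
Implicit Types (f : {ffun H -> 'I_n}) (u v : {set 'I_n} -> R).

(** Weights live on sets of vertices, so that an edge collapsed by [f] reads the
    weight of a singleton. *)
Definition hom_wt u : R := \sum_(f : {ffun H -> 'I_n}) \prod_(e in edges H) u (f @: e).

Definition upd f a x : {ffun H -> 'I_n} :=
  [ffun z => if z == a then x else f z].

(** The map [(f, x) |-> (f[a := x], f a)] is an involution. *)
Lemma sum_resample a (F : {ffun H -> 'I_n} -> R) :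
  \sum_f \sum_x F (upd f a x) = n%:R * \sum_f F f.
Proof.
rewrite (pair_bigA _ (fun f x => F (upd f a x))) /=.
pose inv (t : {ffun H -> 'I_n} * 'I_n) := (upd t.1 a t.2, t.1 a).
have invK : involutive inv.
  move=> [f x]; rewrite /inv /= ffunE eqxx; congr (_, _).
  by apply/ffunP => z; rewrite !ffunE; case: eqP => [->|].
rewrite (reindex_inj (inv_inj invK)) /=.
under eq_bigr => t _.
  rewrite (_ : upd (upd t.1 a t.2) a (t.1 a) = t.1); last first.
    by have := invK t; rewrite /inv /= => /(congr1 fst) /=; case: t => ? ?.
  over.
rewrite -(pair_bigA _ (fun f (x : 'I_n) => F f)) /= mulr_sumr.
by apply: eq_bigr => f _; rewrite sumr_const card_ord mulr_natl.
Qed.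

Lemma upd_other f a x (e : {set H}) : a \notin e -> (upd f a x) @: e = f @: e.
Proof.
move=> ae; apply: eq_in_imset => z ze; rewrite ffunE.
by case: eqP ze ae => // -> ->.
Qed.

Lemma sum_resample2 a b (F : {ffun H -> 'I_n} -> R) :
  \sum_f \sum_x \sum_y F (upd (upd f a x) b y) = n%:R ^+ 2 * \sum_f F f.
Proof.
rewrite (sum_resample a (fun f => \sum_y F (upd f b y))) sum_resample.
by rewrite mulrA.
Qed.

Lemma card_maps : (\sum_(f : {ffun H -> 'I_n}) 1 = n%:R ^+ vcount H :> R).
Proof. by rewrite sumr_const -natrX card_ffun card_ord. Qed.

Lemma upd2_pair f a b x y : a != b ->
  upd (upd f a x) b y @: [set a; b] = [set x; y].
Proof.
by move=> ab; rewrite imsetU1 imset_set1 !ffunE !eqxx (negbTE ab).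
Qed.

(** Replacing the weight of one edge [e0] by [z] and fixing the images of all
    vertices outside [e0], no other edge sees both ends of [e0]; what remains
    is a bilinear test of [z]. *)
Lemma hom_wt_cut_edge (z : {set 'I_n} -> R) (c : {set H} -> {set 'I_n} -> R)
    (eps : R) (e0 : {set H}) :
  (forall e s, 0 <= c e s <= 1) -> e0 \in edges H ->
  cut_le (fun x y => z [set x; y]) (eps * n%:R ^+ 2) -> (0 < n)%N ->
  `|\sum_(f : {ffun H -> 'I_n}) z (f @: e0) * \prod_(e in edges H | e != e0) c e (f @: e)| <=
  eps * n%:R ^+ vcount H.
Proof.
move=> hc he0 hz n0; have [a [b [_ ab e0E]]] := edgesP _ he0.
have nn0 : 0 < (n%:R : R) ^+ 2 by rewrite exprn_gt0 // ltr0n.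
rewrite -(ler_pM2l nn0) -{1}(gtr0_norm nn0) -normrM -(sum_resample2 a b).
have -> : n%:R ^+ 2 * (eps * n%:R ^+ vcount H) =
    \sum_(f : {ffun H -> 'I_n}) (eps * n%:R ^+ 2).
  by under eq_bigr do rewrite -[_ * _]mulr1; rewrite -mulr_sumr card_maps; ring.
apply: (le_trans (ler_norm_sum _ _ _)); apply: ler_sum => f _.
pose F x := \prod_(e in edges H | (e != e0) && (a \in e)) c e (upd f a x @: e).
pose G y := \prod_(e in edges H | (e != e0) && (a \notin e)) c e (upd f b y @: e).
rewrite (_ : \sum_x _ = \sum_x \sum_y F x * G y * z [set x; y]).
  by apply: cut_le_fun => // x; apply: prodr_01.
apply: eq_bigr => x _; apply: eq_bigr => y _.
rewrite {1}e0E upd2_pair // mulrC; congr (_ * _).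
rewrite (bigID (fun e : {set H} => a \in e)) /=; congr (_ * _).
  under eq_bigl do rewrite -andbA.
  apply: eq_bigr => e /and3P[he ne ae]; rewrite upd_other //.
  by apply: contraNN ne => be; rewrite (edge_both he ab) // e0E.
under eq_bigl do rewrite -andbA.
apply: eq_bigr => e /and3P[he ne ae]; congr (c e _).
apply: eq_in_imset => t te; rewrite !ffunE; case: eqP => // _.
by case: eqP te ae => // -> ->.
Qed.

(** The counting lemma: the weights are exchanged one edge at a time. *)
Lemma hom_wt_cut u v (eps : R) : (forall s, 0 <= u s <= 1) ->
  (forall s, 0 <= v s <= 1) -> (0 < n)%N ->
  cut_le (fun x y => u [set x; y] - v [set x; y]) (eps * n%:R ^+ 2) ->
  `|hom_wt u - hom_wt v| <= (ecount H)%:R * (eps * n%:R ^+ vcount H).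
Proof.
move=> hu hv n0 hz.
pose D (J : {set {set H}}) : R :=
  \sum_(f : {ffun H -> 'I_n}) \prod_(e in edges H) (if e \in J then u else v) (f @: e).
suff main (J : {set {set H}}) : J \subset edges H ->
    `|D J - D set0| <= #|J|%:R * (eps * n%:R ^+ vcount H).
  have := main _ (subxx (edges H)); rewrite /D /hom_wt /ecount.
  under eq_bigr => f _ do under eq_bigr => e he do rewrite he.
  by under [X in _ - X]eq_bigr => f _ do under eq_bigr => e he do rewrite inE.
elim: {J}#|J| {-2}J (erefl #|J|) => [|m IH] J cJ JE.
  by rewrite cJ mul0r; move/eqP: cJ; rewrite cards_eq0 => /eqP->; rewrite subrr normr0.
have [e0 e0J] : exists e0, e0 \in J.
  by apply/set0Pn; rewrite -cards_eq0 cJ.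
have he0 : e0 \in edges H by apply: (subsetP JE).
have cJ' : #|J :\ e0| = m by move: cJ; rewrite (cardsD1 e0) e0J => -[].
have {}IH := IH _ cJ' (subset_trans (subD1set _ _) JE).
set A := D (J :\ e0); set B := D set0.
have h2 : `|D J - A| <= eps * n%:R ^+ vcount H.
  have -> : D J - A = \sum_(f : {ffun H -> 'I_n}) (u (f @: e0) - v (f @: e0)) *
     \prod_(e in edges H | e != e0) (if e \in J then u else v) (f @: e).
    rewrite /A /D -sumrB; apply: eq_bigr => f _.
    rewrite (bigD1 e0) //= [X in _ - X](bigD1 e0) //= e0J !inE eqxx /=.
    rewrite mulrBl; congr (_ - _ * _); apply: eq_bigr => e /andP[_ ne].
    by rewrite !inE ne.
  apply: (hom_wt_cut_edge (z := fun s => u s - v s)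
    (c := fun e => if e \in J then u else v)) => // e s.
  by case: ifP.
have := IH; rewrite cJ' -/A -/B => h; rewrite cJ.
rewrite (_ : D J - B = (D J - A) + (A - B)); last by ring.
apply: (le_trans (ler_normD _ _)); rewrite -natr1; lra.
Qed.

End HomWeight.

(** * Weak regularity and the upper bound for the lower tail *)

Definition rect n := (bool * {set 'I_n} * {set 'I_n})%type.

Lemma card_rect n : #|{: rect n}| = (2 ^ (2 * n).+1)%N.
Proof.
have cs : #|{: {set 'I_n}}| = (2 ^ n)%N.
  by rewrite -cardsT -powersetT card_powerset cardsT card_ord.
rewrite !card_prod card_bool cs.
by rewrite -mulnA -expnD addnn -mul2n -expnS.
Qed.

Section WeakRegularity.
Variables (R : realType) (n : nat) (eps : R).
Implicit Types (Z : 'I_n -> 'I_n -> R).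

Definition rect_mx (t : rect n) (x y : 'I_n) : R :=
  (if t.1.1 then eps else - eps) * ((x \in t.1.2) && (y \in t.2))%:R.

Definition step_mx (s : seq (rect n)) (x y : 'I_n) : R :=
  \sum_(t <- s) rect_mx t x y.

Lemma sum_rect (S S' : {set 'I_n}) Z :
  \sum_x \sum_y ((x \in S) && (y \in S'))%:R * Z x y =
  \sum_(x in S) \sum_(y in S') Z x y.
Proof.
rewrite [RHS]big_mkcond /=; apply: eq_bigr => x _.
case: (x \in S) => /=; last by rewrite big1 // => y _; rewrite mul0r.
rewrite [RHS]big_mkcond /=; apply: eq_bigr => y _.
by case: (y \in S'); rewrite ?mul1r ?mul0r.
Qed.

(** Frieze-Kannan: as long as some rectangle sees a discrepancy above
    [eps * n^2], subtracting a step of the fixed height [eps] lowers the energy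
    by [eps^2 * n^2].  Fixing the height keeps the number of possible
    approximants finite: [2^(2n+1)] for each step. *)
Lemma weak_regularity k Z : 0 < eps ->
  \sum_x \sum_y Z x y ^+ 2 <= k%:R * (eps ^+ 2 * n%:R ^+ 2) ->
  exists s : k.-tuple (rect n),
    cut_le (fun x y => Z x y - step_mx s x y) (eps * n%:R ^+ 2).
Proof.
move=> eps0; elim: k Z => [|k IH] Z hZ.
  exists [tuple] => S S'; rewrite /step_mx.
  rewrite big1 => [|x _].
    by rewrite normr0 mulr_ge0 ?exprn_ge0 ?(ltW eps0).
  rewrite big1 // => y _; rewrite big_nil subr0; apply/eqP.
  rewrite -sqrf_eq0; apply/eqP/le_anti; rewrite sqr_ge0 andbT.
  rewrite mul0r in hZ; apply: (le_trans _ hZ).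
  rewrite (bigD1 x) //= (bigD1 y) //= -addrA lerDl addr_ge0 //.
    by apply: sumr_ge0 => j _; exact: sqr_ge0.
  by apply: sumr_ge0 => i _; apply: sumr_ge0 => j _; exact: sqr_ge0.
have [hc|hc] := pselect (cut_le Z (eps * n%:R ^+ 2)).
  exists (nseq_tuple k.+1 (true, set0, set0)) => S S'; rewrite /step_mx.
  rewrite (eq_bigr (fun x => \sum_(y in S') Z x y)) // => x _.
  apply: eq_bigr => y _; rewrite big1_seq ?subr0 // => t /andP[_] /nseqP[-> _].
  by rewrite /rect_mx /= inE mulr0.
have [S [S' hS]] : exists S S' : {set 'I_n},
    eps * n%:R ^+ 2 < `|\sum_(x in S) \sum_(y in S') Z x y|.
  move/existsNP: hc => [S /existsNP[S' /negP]]; rewrite -ltNge => h.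
  by exists S, S'.
set D := \sum_(x in S) _ in hS.
pose t : rect n := (0 < D, S, S').
have [|s hs] := IH (fun x y => Z x y - rect_mx t x y); last first.
  exists (cons_tuple t s) => A B; rewrite /step_mx /=.
  under eq_bigr do under eq_bigr do rewrite big_cons opprD addrA.
  exact: hs.
pose sg : R := if 0 < D then eps else - eps.
have sgD : eps ^+ 2 * n%:R ^+ 2 <= sg * D.
  rewrite expr2 -mulrA /sg; move: hS; have [D0|D0] := ltrP 0 D.
    by rewrite gtr0_norm // => hS; rewrite ler_pM2l // ltW.
  by rewrite ler0_norm // => hS; rewrite mulNr -mulrN ler_pM2l // ltW.
have -> : \sum_x \sum_y (Z x y - rect_mx t x y) ^+ 2 =
    \sum_x \sum_y Z x y ^+ 2 - 2 * (sg * D) +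
    eps ^+ 2 * (\sum_(x in S) \sum_(y in S') 1).
  rewrite /D -!sum_rect !mulr_sumr -sumrB -big_split /=.
  apply: eq_bigr => x _; rewrite !mulr_sumr -sumrB -big_split /=.
  apply: eq_bigr => y _; rewrite /rect_mx /= -/sg.
  have -> : eps ^+ 2 = sg ^+ 2 by rewrite /sg; case: ifP; rewrite ?sqrrN.
  by case: (_ && _); rewrite /=; ring.
have h1 : \sum_(x in S) \sum_(y in S') 1 <= n%:R ^+ 2 :> R.
  rewrite sumr_const sumr_const -mulrnA -natrX ler_nat -mulnn mulnC.
  by rewrite leq_mul // -[X in (_ <= X)%N]card_ord max_card.
have h2 : eps ^+ 2 * \sum_(x in S) \sum_(y in S') 1 <= eps ^+ 2 * n%:R ^+ 2.
  by rewrite ler_pM2l // exprn_gt0.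
move: hZ; rewrite -natr1; move: (_ * n%:R ^+ 2) sgD h2 => a; lra.
Qed.

End WeakRegularity.

Section Gnp.
Variables (R : realType) (n : nat).
Implicit Types (w : {set {set 'I_n}}) (p : R).

Definition pairs : {set {set 'I_n}} := edges (complete_graph n).

Definition gnp_param p (e : {set 'I_n}) : R := if e \in pairs then p else 0.

Lemma gnp_param01 p : 0 <= p <= 1 -> is_param (gnp_param p).
Proof. by move=> hp e; rewrite /gnp_param; case: ifP; rewrite // lexx ler01. Qed.

Lemma gnp_probE p (A : pred sgraph) :
  gnp_prob n p A =
  prob (gnp_param p) (fun w => (w \subset pairs) && A (graph_of_edges w)).
Proof.
rewrite /gnp_prob /prob /=; apply: eq_big => [w|w].
  by rewrite powersetE.
rewrite powersetE => /andP[wE _]; rewrite /bern [RHS](bigID (mem pairs)) /=.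
rewrite [X in _ * X]big1 ?mulr1 => [|e ne]; last first.
  by rewrite (contraNF (subsetP wE e) ne) /gnp_param (negbTE ne) subr0.
by apply: eq_bigr => e he; rewrite /gnp_param he.
Qed.

Lemma mem_pairs (x y : 'I_n) : ([set x; y] \in pairs) = (x != y).
Proof.
have [->|xy] := eqVneq x y; last by rewrite /pairs (@mem_edges (complete_graph n) x y xy).
apply/negP => /(@card_edge (complete_graph n)).
by rewrite setUid cards1.
Qed.

Definition ind w (s : {set 'I_n}) : R := (s \in w)%:R.

Lemma is_homE (H : sgraph) w (f : {ffun H -> 'I_n}) : w \subset pairs ->
  (@is_hom H (graph_of_edges w) f)%:R = \prod_(e in edges H) ind w (f @: e).
Proof.
move=> wE; have [hf|hf] := boolP (@is_hom H (graph_of_edges w) f).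
  rewrite big1 // => e /edgesP[a [b [ab _ ->]]].
  move/forallP: hf => /(_ a)/forallP/(_ b)/implyP/(_ ab) /andP[_ h].
  by rewrite imsetU1 imset_set1 /ind h.
apply/esym/eqP; rewrite prodf_seq_eq0; move: hf.
rewrite negb_forall => /existsP[a]; rewrite negb_forall => /existsP[b].
rewrite negb_imply => /andP[ab hw].
have nab : a != b by apply: contraTneq ab => ->; rewrite edge_irr.
apply/hasP; exists [set a; b]; rewrite ?mem_index_enum // mem_edges // ab /=.
rewrite /ind imsetU1 imset_set1 pnatr_eq0 eqb0; apply: contra hw => hw.
by rewrite /edge /= /pair_edge hw andbT -mem_pairs (subsetP wE).
Qed.

Lemma hom_countE (H : sgraph) w : w \subset pairs ->
  (hom_count H (graph_of_edges w))%:R = hom_wt H (ind w).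
Proof.
move=> wE; rewrite /hom_count -sum1_card natr_sum big_mkcond /=.
under eq_bigr do rewrite inE.
by apply: eq_bigr => f _; rewrite -is_homE //; case: is_hom.
Qed.

Lemma hom_densityE (H : sgraph) w : w \subset pairs ->
  hom_density R H (graph_of_edges w) = hom_wt H (ind w) / n%:R ^+ vcount H.
Proof.
by move=> wE; rewrite /hom_density hom_countE // /vcount /= card_ord.
Qed.

End Gnp.

Section UpperBound.
Variable R : realType.
Implicit Types (p eps delta tau m : R).

Lemma prod_max_le (I : finType) (P : pred I) (a : I -> R) delta :
  (forall i, 0 <= a i <= 1) -> 0 <= delta <= 1 ->
  \prod_(i | P i) Num.max delta (a i) <= \prod_(i | P i) a i + #|P|%:R * delta.
Proof.
move=> ha /andP[d0 d1].
rewrite (_ : #|P|%:R * delta = \sum_(i | P i) delta); last first.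
  by rewrite sumr_const mulr_natl.
suff [] : [/\ 0 <= \prod_(i | P i) Num.max delta (a i) <= 1,
  0 <= \prod_(i | P i) a i, 0 <= \sum_(i | P i) delta &
  \prod_(i | P i) Num.max delta (a i) <=
    \prod_(i | P i) a i + \sum_(i | P i) delta] by [].
elim/big_rec3: _ => [|i s y x Pi [/andP[x0 x1] y0 s0 xys]].
  by rewrite ler01 lexx addr0.
have /andP[a0 a1] := ha i.
have : Num.max delta (a i) <= 1 by rewrite ge_max d1.
have : 0 <= Num.max delta (a i) by rewrite le_max d0.
have : Num.max delta (a i) <= delta + a i.
  by rewrite ge_max lerDl a0 lerDr.
move: (Num.max _ _) => M h1 h2 h3; split; nra.
Qed.

Definition cond_mean (T : finType) (q : T -> R) (A : pred {set T}) (e : T) : R :=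
  (\sum_(w | A w) bern q w * (e \in w)%:R) / prob q A.

Lemma h_ge_tangent (x y : R) : 0 < y -> 0 <= x -> h y + (x - y) * ln y <= h x.
Proof.
move=> y0; rewrite le_eqVlt => /predU1P[<-|x0].
  by rewrite /h; lra.
suff : x * (ln y - ln x) <= y - x by rewrite /h; lra.
rewrite -ln_div ?posrE //.
have := le_ln1Dx (x := y / x - 1); rewrite subrKC.
rewrite ltrBrDl subrr divr_gt0 // => /(_ isT) h1.
apply: (le_trans (ler_wpM2l (ltW x0) h1)).
by rewrite mulrBr mulr1 mulrCA divff ?gt_eqF // mulr1.
Qed.

Lemma h1 : h (1 : R) = 0. Proof. by rewrite /h ln1; lra. Qed.
Lemma h0 : h (0 : R) = 1. Proof. by rewrite /h; lra. Qed.

Lemma h_ge0 (x : R) : 0 <= x -> 0 <= h x.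
Proof. by move=> x0; have := h_ge_tangent ltr01 x0; rewrite h1 ln1; lra. Qed.

Lemma h_le1 (x : R) : 0 <= x <= 1 -> h x <= 1.
Proof.
move=> /andP[x0 x1]; rewrite /h.
by have := ln_le0 x1; nra.
Qed.

(** The optimal tilt [M / p] is clipped to the range from [delta] to 1:
    where the clipping acts, the discarded term has the right sign. *)
Lemma exponent_ge p M delta (u := Num.max delta (Num.min 1 (M / p))) :
  0 < p -> 0 <= M -> 0 < delta <= 1 ->
  p * h u <= M * ln u + p * (1 - u).
Proof.
move=> p0 M0 /andP[d0 d1].
suff : 0 <= (M - p * u) * ln u by rewrite /h; lra.
have [Mp|Mp] := leP 1 (M / p).
  by rewrite /u (min_idPl _) // (max_idPr _) // ln1 mulr0.
rewrite /u (min_idPr (ltW Mp)).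
have [dM|dM] := leP delta (M / p).
  by rewrite mulrCA divff ?gt_eqF // mulr1 subrr mul0r.
have := ln_le0 d1; rewrite ltr_pdivrMr // in dM; nra.
Qed.

(** The lower tail event is covered by few pieces, each close in cut
    norm to one approximant; the conditional mean of a piece inherits, by the
    counting lemma, the density bound of its members. *)
Lemma lower_tail_upper (H : sgraph) n k p eps delta tau m :
  (0 < n)%N -> 0 < p <= 1 -> 0 < eps -> 0 < delta <= 1 -> 1 <= k%:R * eps ^+ 2 ->
  (forall u : {set 'I_n} -> R, (forall s, 0 <= u s <= 1) ->
     hom_wt H u <= n%:R ^+ vcount H * ((tau + (ecount H)%:R * (2 * eps)) /
        p ^+ ecount H + (ecount H)%:R * delta) ->
     m <= \sum_(e in pairs n) h (u e)) ->
  gnp_prob n p (fun G => hom_density R H G <= tau) <=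
  (2 ^+ (2 * n).+1) ^+ k * expR (- (p * m)).
Proof.
move=> n0 /andP[p0 p1] eps0 hd hk hm; rewrite gnp_probE.
set q := gnp_param p; have hq : is_param q.
  by apply: gnp_param01; rewrite p1 ltW.
pose B (s : k.-tuple (rect n)) (w : {set {set 'I_n}}) :=
  [&& w \subset pairs n, hom_density R H (graph_of_edges w) <= tau &
      `[< cut_le (fun x y => ind R w [set x; y] - step_mx eps s x y)
             (eps * n%:R ^+ 2) >]].
apply: (@le_trans _ _ (\sum_s prob q (B s))).
  apply: prob_le_sum => // w /andP[wE wd].
  have [|s hs] := weak_regularity (k := k) (Z := fun x y => ind R w [set x; y]) eps0.
    rewrite mulrA; apply: (@le_trans _ _ (1 * n%:R ^+ 2)); last first.
      by rewrite ler_wpM2r // exprn_ge0.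
    have -> : 1 * n%:R ^+ 2 = \sum_(x < n) \sum_(y < n) (1 : R).
      under eq_bigr do rewrite sumr_const card_ord.
      by rewrite sumr_const card_ord mul1r -[RHS]mulr_natr expr2.
    apply: ler_sum => x _; apply: ler_sum => y _; rewrite /ind.
    by case: (_ \in _); rewrite ?expr1n // expr0n.
  by exists s; rewrite /B wE wd /=; apply/asboolP.
apply: (@le_trans _ _ (\sum_(s : k.-tuple (rect n)) expR (- (p * m)))); last first.
  by rewrite sumr_const card_tuple card_rect -[X in X <= _]mulr_natl !natrX.
apply: ler_sum => s _.
have [->|P0] := eqVneq (prob q (B s)) 0; first exact: expR_ge0.
have {}P0 : 0 < prob q (B s) by rewrite lt_neqAle eq_sym P0 prob_ge0.
have [w0 /and3P[w0E w0d /asboolP w0c]] : exists w0, B s w0.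
  apply/existsP; rewrite -[X in is_true X]negbK; apply/negP => /existsPn hn.
  by move: P0; rewrite /prob big_pred0 ?ltxx // => w; apply: negbTE.
pose M := cond_mean q (B s).
have MP e : prob q (B s) * M e = \sum_(w | B s w) bern q w * (e \in w)%:R.
  by rewrite /M /cond_mean mulrC divfK ?gt_eqF.
have M01 e : 0 <= M e <= 1.
  rewrite -(ler_pM2l P0) -[X in _ && X](ler_pM2l P0) mulr0 mulr1 MP; apply/andP; split.
    by apply: sumr_ge0 => w _; rewrite mulr_ge0 ?bern_ge0.
  by apply: ler_sum => w _; rewrite ler_piMr ?bern_ge0 // lern1; case: (_ \in _).
have Moff e : e \notin pairs n -> M e = 0.
  move=> ne; have := MP e; rewrite big1 => [/eqP|w /and3P[wE _ _]].
    by rewrite mulf_eq0 gt_eqF //= => /eqP.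
  by rewrite (contraNF (subsetP wE e) ne) mulr0.
have cM : cut_le (fun x y => M [set x; y] - ind R w0 [set x; y])
                 (2 * eps * n%:R ^+ 2).
  move=> S S'.
  pose X (v : {set 'I_n} -> R) :=
    \sum_(x in S) \sum_(y in S') (v [set x; y] - step_mx eps s x y).
  have -> : \sum_(x in S) \sum_(y in S') (M [set x; y] - ind R w0 [set x; y])
      = X M - X (ind R w0).
    rewrite /X -sumrB; apply: eq_bigr => x _; rewrite -sumrB.
    by apply: eq_bigr => y _; ring.
  have XM : prob q (B s) * X M = \sum_(w | B s w) bern q w * X (ind R w).
    rewrite /X mulr_sumr; under [RHS]eq_bigr do rewrite mulr_sumr.
    rewrite exchange_big /=; apply: eq_bigr => x _; rewrite mulr_sumr.
    under [RHS]eq_bigr do rewrite mulr_sumr.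
    rewrite exchange_big /=; apply: eq_bigr => y _.
    rewrite mulrBr MP [in X in _ - X]/prob mulr_suml -sumrB.
    by apply: eq_bigr => w _; rewrite mulrBr.
  have h1 : `|X M| <= eps * n%:R ^+ 2.
    rewrite -(ler_pM2l P0) -{1}(gtr0_norm P0) -normrM XM.
    apply: (le_trans (ler_norm_sum _ _ _)); rewrite /prob mulr_suml.
    apply: ler_sum => w /and3P[_ _ /asboolP wc].
    by rewrite normrM ger0_norm ?bern_ge0 // ler_wpM2l ?bern_ge0 // wc.
  apply: (le_trans (ler_normB _ _)); have := w0c S S'; rewrite -/(X (ind R w0)).
  lra.
have hM : hom_wt H M <=
    n%:R ^+ vcount H * (tau + (ecount H)%:R * (2 * eps)).
  have i01 e : 0 <= ind R w0 e <= 1 by rewrite /ind ler0n lern1; case: (_ \in _).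
  have := hom_wt_cut H M01 i01 n0 cM; rewrite ler_norml => /andP[_].
  move: w0d; rewrite hom_densityE // ler_pdivrMr ?exprn_gt0 ?ltr0n //.
  rewrite mulrDr; lra.
pose u e := Num.max delta (Num.min 1 (M e / p)).
have Mp0 e : 0 <= M e / p by have /andP[M0 _] := M01 e; rewrite divr_ge0 // ltW.
have /andP[d0 d1] := hd.
have m01 e : 0 <= Num.min 1 (M e / p) <= 1.
  by rewrite le_min ler01 Mp0 ge_min lexx.
have u01 e : 0 <= u e <= 1.
  by have /andP[a b] := m01 e; rewrite /u le_max (ltW d0) ge_max d1.
have hu : hom_wt H u <= n%:R ^+ vcount H *
    ((tau + (ecount H)%:R * (2 * eps)) / p ^+ ecount H + (ecount H)%:R * delta).
  apply: (@le_trans _ _ (\sum_(f : {ffun H -> 'I_n})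
     ((\prod_(e in edges H) M (f @: e)) / p ^+ ecount H +
      (ecount H)%:R * delta))).
    apply: ler_sum => f _; apply: (le_trans (prod_max_le _ _ _)) => //.
      by rewrite (ltW d0) d1.
    have -> : p ^+ ecount H = \prod_(e in edges H) p by rewrite prodr_const.
    rewrite -prodf_div lerD //; apply: ler_prod => e _.
    by have /andP[-> _] := m01 (f @: e); rewrite ge_min lexx orbT.
  rewrite big_split /= -mulr_suml mulrDr mulrA lerD //.
    by rewrite ler_pM2r ?invr_gt0 ?exprn_gt0.
  by rewrite -(card_maps R H n) mulr_suml; apply: ler_sum => f _; rewrite mul1r.
apply: (le_trans (prob_le_exp_mean (u := u) hq _ MP)) => [e|].
  by rewrite /u lt_max d0.
rewrite ler_expR lerN2; apply: (@le_trans _ _ (p * \sum_(e in pairs n) h (u e))).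
  by rewrite ler_pM2l //; apply: hm.
rewrite mulr_sumr big_mkcond /=; apply: ler_sum => e _.
rewrite /q /gnp_param; case: ifPn => [he|ne].
  by apply: exponent_ge => //; have /andP[] := M01 e.
by rewrite Moff // !mul0r addr0.
Qed.

End UpperBound.

(** * The tilted lower bound *)

Section PairSums.
Variables (R : realType) (n : nat).
Implicit Types (F u : {set 'I_n} -> R).

Lemma pairsP (e : {set 'I_n}) :
  reflect (exists a b, a != b /\ e = [set a; b]) (e \in pairs n).
Proof.
apply: (iffP (@edgesP (complete_graph n) e)) => [[a [b [_ ab ->]]]|[a [b [ab ->]]]].
  by exists a, b.
by exists a, b.
Qed.

Lemma set2_inj (x y a b : 'I_n) : [set x; y] = [set a; b] ->
  (x, y) = (a, b) \/ (x, y) = (b, a).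
Proof.
move=> h; have hx : x \in [set a; b] by rewrite -h set21.
have hy : y \in [set a; b] by rewrite -h set22.
have ha : a \in [set x; y] by rewrite h set21.
have hb : b \in [set x; y] by rewrite h set22.
move: hx hy ha hb; rewrite !inE.
case/orP=> /eqP ->; case/orP=> /eqP ->; rewrite ?eqxx ?orbb; auto.
  by move=> _ /eqP ->; auto.
by move=> /eqP ->; auto.
Qed.

Lemma sum_pairs F :
  \sum_x \sum_y F [set x; y] = 2 * \sum_(e in pairs n) F e + \sum_x F [set x].
Proof.
have -> : \sum_x \sum_y F [set x; y] =
    \sum_x \sum_(y | x != y) F [set x; y] + \sum_x F [set x].
  rewrite -big_split /=; apply: eq_bigr => x _; rewrite (bigD1 x) //= setUid.
  by rewrite addrC; congr (_ + _); apply: eq_bigl => y; rewrite eq_sym.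
congr (_ + _); rewrite pair_big_dep /=.
rewrite (partition_big (fun t => [set t.1; t.2]) (mem (pairs n))) /=; last first.
  by move=> t; rewrite mem_pairs.
rewrite mulr_sumr; apply: eq_bigr => e /pairsP[a [b [ab ->]]].
rewrite (bigD1 (a, b)) /= ?ab ?eqxx // (bigD1 (b, a)) /=; last first.
  rewrite eq_sym ab setUC eqxx /=; apply: contra ab => /eqP[-> _].
  by rewrite eqxx.
rewrite big1 => [|[x y] /= /andP[/andP[/andP[_ /eqP/set2_inj]]]]; last first.
  by case=> ->; rewrite eqxx.
by rewrite addr0 [[set b; a]]setUC mulr2n mulrDl mul1r.
Qed.

Lemma card_pairs_le : 2 * (#|pairs n|)%:R <= n%:R ^+ 2 :> R.
Proof.
have := sum_pairs (fun=> 1); rewrite !sumr_const !card_ord => h.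
have : 0 <= n%:R :> R by rewrite ler0n.
by move: h; rewrite -[LHS]mulr_natr -expr2 => ->; rewrite lerDl.
Qed.

End PairSums.

Section ExpectHom.
Variables (R : realType) (H : sgraph) (n : nat).

Lemma count_collapse (a b : H) : a != b ->
  n%:R * \sum_(f : {ffun H -> 'I_n}) (f a == f b)%:R = n%:R ^+ vcount H :> R.
Proof.
move=> ab; rewrite -(sum_resample (R := R) a) -(card_maps R H n).
have ba : (b == a) = false by rewrite eq_sym (negbTE ab).
apply: eq_bigr => f _; rewrite (bigD1 (f b)) //= !ffunE eqxx ba eqxx.
by rewrite big1 ?addr0 // => x; rewrite !ffunE eqxx ba => /negbTE ->.
Qed.

(** An injective map uses distinct edges, which are independent; the other maps
    number at most [v(H)^2 n^(v(H) - 1)]. *)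
Lemma expect_hom (q : {set 'I_n} -> R) : is_param q -> (0 < n)%N ->
  expect q (fun w => hom_wt H (ind R w)) <=
  hom_wt H q + (vcount H)%:R ^+ 2 / n%:R * n%:R ^+ vcount H.
Proof.
move=> hq n0; have nn0 : 0 < n%:R :> R by rewrite ltr0n.
rewrite (expect_sum q xpredT
  (fun (f : {ffun H -> 'I_n}) w => \prod_(e in edges H) ind R w (f @: e))).
apply: (@le_trans _ _ (\sum_(f : {ffun H -> 'I_n})
  (\prod_(e in edges H) q (f @: e) +
   \sum_(a : H) \sum_(b | a != b) (f a == f b)%:R))); last first.
  rewrite big_split /= lerD2l exchange_big /=.
  under eq_bigr => a _ do rewrite exchange_big /=.
  rewrite -(ler_pM2l nn0) mulrA [n%:R * (_ / _)]mulrC divfK ?gt_eqF //.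
  rewrite mulr_sumr.
  under eq_bigr => a _.
    rewrite mulr_sumr; under eq_bigr => b ab do rewrite count_collapse //.
    over.
  rewrite expr2 -mulrA mulr_natl -[X in _ <= _ *+ X]/#|H| -sumr_const.
  apply: ler_sum => a _.
  by rewrite sumr_const -[X in X <= _]mulr_natl ler_wpM2r ?exprn_ge0 // ler_nat max_card.
apply: ler_sum => f _.
have S0 : 0 <= \sum_(a : H) \sum_(b | a != b) (f a == f b)%:R :> R.
  by apply: sumr_ge0 => a _; apply: sumr_ge0 => b _.
have [inj|ninj] := boolP (injectiveb f).
  have ii : {in edges H &, injective (fun e : {set H} => f @: e)}.
    by move=> e1 e2 _ _; apply/imset_inj/injectiveP.
  under eq_expect => w do rewrite -(big_imset _ ii) /=.
  by rewrite expect_subset big_imset //= lerDl.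
apply: (@le_trans _ _ 1).
  rewrite -[X in _ <= X](expect_cst q); apply: le_expect => // w.
  have i01 (e : {set H}) : 0 <= ind R w (f @: e) <= 1.
    by rewrite /ind ler0n lern1; case: (_ \in _).
  by have /andP[] := prodr_01 (fun e (_ : e \in edges H) => i01 e).
have [a [b [ab fab]]] : exists a b, a != b /\ f a = f b.
  by move/injectivePn: ninj => [a [b ab fab]]; exists a, b.
rewrite ler_wpDl //.
  apply: prodr_ge0 => e _; by have /andP[] := hq (f @: e).
rewrite (bigD1 a) //= (bigD1 b) //= fab eqxx -addrA lerDl addr_ge0 //.
  by apply: sumr_ge0 => i _; rewrite ler0n.
by apply: sumr_ge0 => i _; apply: sumr_ge0 => j _; rewrite ler0n.
Qed.

End ExpectHom.

Section LowerBound.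
Variable R : realType.
Implicit Types (p rho theta s tau delta : R).

Lemma ln_ge1V (x : R) : 0 < x -> 1 - x^-1 <= ln x.
Proof.
move=> x0; have := le_ln1Dx (x := x^-1 - 1); rewrite subrKC lnV ?posrE //.
by rewrite ltrBrDl subrr invr_gt0 => /(_ x0); lra.
Qed.

Lemma ln_le_sub1 (x : R) : 0 < x -> ln x <= x - 1.
Proof.
move=> x0; have := le_ln1Dx (x := x - 1); rewrite subrKC.
by rewrite ltrBrDl subrr => /(_ x0).
Qed.

(** The left-hand side is the relative entropy of Bernoulli([p u]) with respect
    to Bernoulli([p]). *)
Lemma bernoulli_entropy_le p (u : R) : 0 < p <= 1 / 2 -> 0 < u <= 1 ->
  p * u * ln u + (1 - p * u) * ln ((1 - p * u) / (1 - p)) <= p * h u + 2 * p ^+ 2.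
Proof.
move=> /andP[p0 p2] /andP[u0 u1].
have pu : p * u <= p by nra.
have q0 : 0 < 1 - p by lra.
have x0 : 0 < (1 - p * u) / (1 - p) by rewrite divr_gt0 //; lra.
have h1 := ln_le_sub1 x0.
have e1 : (1 - p * u) / (1 - p) - 1 = p * (1 - u) / (1 - p).
  by field; rewrite gt_eqF.
have i1 : (1 - p)^-1 <= 1 + 2 * p.
  rewrite -[X in X <= _]mul1r ler_pdivrMr //; nra.
have i0 : 0 < (1 - p)^-1 by rewrite invr_gt0.
rewrite e1 in h1; rewrite /h.
have a0 : 0 <= p * (1 - u) by nra.
have b0 : 0 <= 1 - p * u by lra.
have b1 : 1 - p * u <= 1 by nra.
have h2 : (1 - p * u) * ln ((1 - p * u) / (1 - p)) <= p * (1 - u) * (1 + 2 * p).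
  apply: (le_trans (ler_wpM2l b0 h1)).
  apply: (@le_trans _ _ (p * (1 - u) / (1 - p))).
    by rewrite ler_piMl // mulr_ge0 // ltW.
  by rewrite ler_wpM2l.
apply: (@le_trans _ _ (p * u * ln u + p * (1 - u) * (1 + 2 * p))); first lra.
by nra.
Qed.

(** Tilting the edge probability from [p] to [p u]: by Markov's inequality the
    tilted graph lies in the lower tail with probability at least [2 theta], and
    all but [theta] of that has a typical likelihood ratio. *)
Lemma lower_tail_lower (H : sgraph) n p (u : {set 'I_n} -> R)
    (delta theta s tau sigma : R) :
  (0 < n)%N -> 0 < p <= 1 / 2 -> 0 < delta -> (forall e, delta <= u e <= 1) ->
  0 < theta -> 0 < s -> 0 < tau -> hom_wt H u <= n%:R ^+ vcount H * sigma ->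
  p ^+ ecount H * sigma + (vcount H)%:R ^+ 2 / n%:R <= (1 - 2 * theta) * tau ->
  (1 - ln delta) ^+ 2 * (p * n%:R ^+ 2) <= theta * s ^+ 2 ->
  theta * expR (- (p * \sum_(e in pairs n) h (u e) + p ^+ 2 * n%:R ^+ 2 + s)) <=
  gnp_prob n p (fun G => hom_density R H G <= tau).
Proof.
move=> n0 /andP[p0 p2] d0 hu t0 s0 tau0 hom hm hs.
have u0 e : 0 < u e by have /andP[h1 _] := hu e; apply: lt_le_trans h1.
have u1 e : u e <= 1 by have /andP[] := hu e.
pose q e := gnp_param p e * u e.
have pE e : e \in pairs n -> gnp_param p e = p by rewrite /gnp_param => ->.
have pN e : e \notin pairs n -> gnp_param p e = 0.
  by rewrite /gnp_param => /negbTE ->.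
have pge (e : {set 'I_n}) : 0 <= gnp_param p e <= 1 / 2.
  by rewrite /gnp_param; case: ifP => _; clear -p0 p2; lra.
have qp e : 0 <= q e <= gnp_param p e.
  by have /andP[a b] := pge e; rewrite /q mulr_ge0 ?(ltW (u0 e)) //= ler_piMr.
have hq : is_param q.
  by move=> e; move: (qp e) (pge e); clear; lra.
set A := fun w : {set {set 'I_n}} => (w \subset pairs n) && (hom_density R H (graph_of_edges w) <= tau).
have nv0 : 0 < n%:R ^+ vcount H :> R by rewrite exprn_gt0 // ltr0n.
have hA : 2 * theta <= prob q A.
  have hh : prob q (fun w => (w \subset pairs n) &&
      (tau < hom_density R H (graph_of_edges w))) <= 1 - 2 * theta.
    rewrite -(ler_pM2l tau0) -(ler_pM2l nv0) mulrA.
    apply: (@le_trans _ _ (expect q (fun w => hom_wt H (ind R w)))).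
      apply: markov_prob => // w.
        apply: sumr_ge0 => f _; apply: prodr_ge0 => e _.
        by rewrite /ind ler0n.
      move=> /andP[wE]; rewrite hom_densityE // ltr_pdivlMr // mulrC.
      exact: ltW.
    apply: (le_trans (expect_hom H hq n0)).
    apply: (@le_trans _ _
       (p ^+ ecount H * hom_wt H u +
        n%:R ^+ vcount H * ((vcount H)%:R ^+ 2 / n%:R))).
      rewrite [_ * n%:R ^+ _]mulrC lerD // /hom_wt mulr_sumr; apply: ler_sum => f _.
      have -> : p ^+ ecount H = \prod_(e in edges H) p by rewrite prodr_const.
      rewrite -big_split /=; apply: ler_prod => e _.
      have := qp (f @: e); rewrite /q => /andP[-> _] /=.
      by rewrite ler_pM2r // /gnp_param; case: ifP => // _; exact: ltW.
    have : p ^+ ecount H * hom_wt H u <=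
        p ^+ ecount H * (n%:R ^+ vcount H * sigma).
      by rewrite ler_pM2l // exprn_gt0.
    move: hm; rewrite -(ler_pM2l nv0).
    move: (p ^+ ecount H) (hom_wt H u) (_ / n%:R) (n%:R ^+ vcount H).
    by clear => P X V N; nra.
  have : 1 <= prob q A + prob q (fun w => (w \subset pairs n) &&
      (tau < hom_density R H (graph_of_edges w))).
    rewrite -[X in X <= _](expect_cst q) /expect.
    have -> : \sum_w bern q w * 1 = prob q (fun w => w \subset pairs n).
      rewrite [LHS](bigID (fun w : {set {set 'I_n}} => w \subset pairs n)) /= [X in _ + X]big1.
        by rewrite addr0; apply: eq_bigr => w _; rewrite mulr1.
      move=> w /subsetPn[e ew ne]; rewrite mulr1 /bern (bigD1 e) //= ew.
      by rewrite /q pN // !mul0r.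
    apply: prob_le_add => // w wE; rewrite /A wE /=.
    by case: leP.
  move: hh; clear; lra.
have hT := @prob_tilt R _ (gnp_param p) q A s hq.
rewrite gnp_probE -/A; apply: le_trans (hT _ _ _ _ s0); last 4 first.
- by move=> e; move: (pge e); clear; lra.
- by move=> e; move: (qp e) (pge e); clear; lra.
- by move=> e h; rewrite /q h mul0r.
- by move=> e /eqP; rewrite mulf_eq0 (gt_eqF (u0 e)) orbF => /eqP.
have V : \sum_e (llr1 (gnp_param p) q e - llr0 (gnp_param p) q e) ^+ 2 *
    (q e * (1 - q e)) <= theta * s ^+ 2.
  apply: (le_trans _ hs).
  apply: (@le_trans _ _ (\sum_(e in pairs n) (1 - ln delta) ^+ 2 * p)).
    rewrite [X in _ <= X]big_mkcond /=; apply: ler_sum => e _.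
    case: ifPn => he; last by rewrite /q pN // !mul0r mulr0.
    have /andP[q0 q1] := qp e.
    have qq : 0 <= q e * (1 - q e) <= p.
      by move: q1 q0; rewrite pE // => q1 q0; clear -p0 p2 q1 q0; apply/andP; split; nra.
    have hl1 : llr1 (gnp_param p) q e = ln (u e).
      by rewrite /llr1 /q pE // mulrAC divff ?gt_eqF // mul1r.
    have hd : ln delta <= ln (u e).
      by rewrite ler_ln ?posrE //; have /andP[] := hu e.
    have hu1 : ln (u e) <= 0 by apply: ln_le0.
    have hl0 : 0 <= llr0 (gnp_param p) q e <= 1.
      rewrite /llr0 pE //; have h3 : q e <= p by rewrite -(pE e he).
      apply/andP; split.
        by rewrite ln_ge0 // ler_pdivlMr; clear -h3 p0 p2; lra.
      have x0 : 0 < (1 - q e) / (1 - p) by rewrite divr_gt0 //; clear -h3 p0 p2; lra.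
      apply: (le_trans (ln_le_sub1 x0)).
      rewrite lerBlDr ler_pdivrMr; move: q0; clear -h3 p0 p2; lra.
    have sq : (llr1 (gnp_param p) q e - llr0 (gnp_param p) q e) ^+ 2 <=
        (1 - ln delta) ^+ 2.
      rewrite hl1 -sqrrN lerXn2r ?nnegrE; clear -hl0 hu1 hd; lra.
    have /andP[qq0 qq1] := qq.
    by apply: ler_pM => //; exact: sqr_ge0.
  rewrite sumr_const -[X in X <= _]mulr_natr -mulrA.
  rewrite ler_wpM2l ?sqr_ge0 // ler_wpM2l ?(ltW p0) //.
  have := card_pairs_le R n; have : 0 <= #|pairs n|%:R :> R by rewrite ler0n.
  clear; lra.
have -> : theta * expR (- (p * \sum_(e in pairs n) h (u e) +
    p ^+ 2 * n%:R ^+ 2 + s)) = expR (- (p * \sum_(e in pairs n) h (u e) +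
    p ^+ 2 * n%:R ^+ 2 + s)) * theta by rewrite mulrC.
apply: ler_pM; rewrite ?expR_ge0 ?(ltW t0) //.
  rewrite ler_expR lerN2 lerD2r.
  apply: (@le_trans _ _ (\sum_(e in pairs n) (p * h (u e) + 2 * p ^+ 2))).
    rewrite [X in _ <= X]big_mkcond /=; apply: ler_sum => e _.
    case: ifPn => he.
      have -> : llr1 (gnp_param p) q e = ln (u e).
        by rewrite /llr1 /q pE // mulrAC divff ?gt_eqF // mul1r.
      rewrite /llr0 /q pE //; apply: bernoulli_entropy_le.
        by rewrite p0 p2.
      by rewrite u0 u1.
    by rewrite /q /llr0 /q pN // !mul0r add0r !subr0 divr1 ln1 mulr0.
  rewrite big_split /= -mulr_sumr lerD2l sumr_const -[X in X <= _]mulr_natr -mulrA mulrCA.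
  by rewrite ler_wpM2l ?sqr_ge0 // card_pairs_le.
rewrite lerBrDr; apply: (@le_trans _ _ (2 * theta)) => //.
have -> : 2 * theta = theta + theta by ring.
by rewrite lerD2l ler_pdivrMr ?exprn_gt0.
Qed.

End LowerBound.

(** * Entropy inequalities *)

Section Entropy.
Variable R : realType.
Implicit Types (x y a b c t m r : R).

Lemma mvt_pos (f df : R -> R) a b : 0 < a -> a <= b ->
  (forall x, 0 < x -> is_derive x 1 f (df x)) ->
  exists2 z, a <= z <= b & f b - f a = df z * (b - a).
Proof.
move=> a0 ab hf; have [x|z|z] := @MVT_segment R f df a b ab.
- by rewrite in_itv /= => /andP[ax _]; apply: hf; apply: lt_trans ax.
- apply: derivable_within_continuous => x; rewrite in_itv /= => /andP[ax _].
  by apply: ex_derive; apply: hf; apply: lt_le_trans ax.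
- by rewrite in_itv /= => h e; exists z.
Qed.

Definition xlnx x := x * ln x.

Lemma xlnx_tangent x y : 0 < y -> 0 <= x ->
  xlnx y + (x - y) * (1 + ln y) <= xlnx x.
Proof.
by move=> y0 x0; have := h_ge_tangent y0 x0; rewrite /h /xlnx; lra.
Qed.

Lemma xlnx_incr x y : 0 < y -> y <= x -> -1 <= ln y -> xlnx y <= xlnx x.
Proof.
move=> y0 yx ly; have := xlnx_tangent y0 (ltW (lt_le_trans y0 yx)); nra.
Qed.

Lemma xlnx_decr x y : 0 < x -> x <= y -> ln y <= -1 -> xlnx y <= xlnx x.
Proof.
move=> x0 yx ly; have := xlnx_tangent (lt_le_trans x0 yx) (ltW x0); nra.
Qed.

Lemma xlnx_le_max a b x : 0 < a -> a <= x <= b ->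
  xlnx x <= Num.max (xlnx a) (xlnx b).
Proof.
move=> a0 /andP[ax xb]; rewrite le_max; have x0 := lt_le_trans a0 ax.
have [l1|l1] := leP (-1) (ln x); first by rewrite [X in _ || X]xlnx_incr ?orbT.
by rewrite xlnx_decr // ltW.
Qed.

(** [h] relative to a multiple of the logarithm.  Its derivative
    [(xlnx x - c) / x] changes sign where the convex function [xlnx] crosses
    the level [c], so it decreases between two crossings and is otherwise
    increasing. *)
Definition hl c x := h x - c * ln x.

Lemma is_derive_hl c x : 0 < x -> is_derive x 1 (hl c) ((xlnx x - c) / x).
Proof.
move=> x0; have dl := is_derive1_ln x0.
rewrite /hl /h /xlnx; apply: is_derive_eq.
rewrite /GRing.scale /= !mulr1 ?add0r ?addr0 ?subr0.
by field; rewrite gt_eqF.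
Qed.

Lemma hl_incr c a b : 0 < a -> a <= b ->
  (forall z, a <= z <= b -> c <= xlnx z) -> hl c a <= hl c b.
Proof.
move=> a0 ab hz; have [z zab] := mvt_pos a0 ab (@is_derive_hl c).
have /andP[az _] := zab; have z0 := lt_le_trans a0 az.
rewrite -subr_ge0 => ->; rewrite mulr_ge0 ?subr_ge0 //.
by rewrite divr_ge0 ?(ltW z0) // subr_ge0 hz.
Qed.

Lemma hl_decr c a b : 0 < a -> a <= b ->
  (forall z, a <= z <= b -> xlnx z <= c) -> hl c b <= hl c a.
Proof.
move=> a0 ab hz; have [z zab] := mvt_pos a0 ab (@is_derive_hl c).
have /andP[az _] := zab; have z0 := lt_le_trans a0 az.
rewrite -subr_le0 => ->; rewrite mulr_le0_ge0 ?subr_ge0 //.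
by rewrite mulr_le0_ge0 ?subr_le0 ?hz // invr_ge0 ltW.
Qed.

(** Left of the second crossing of [xlnx] with the level [c], [hl c] first
    increases and then decreases.  Either alternative puts [b] there. *)
Lemma hl_quasiconcave c a b x m : 0 < a -> a <= x <= b ->
  xlnx b <= c \/ ln b <= -1 -> m <= hl c a -> m <= hl c b -> m <= hl c x.
Proof.
move=> a0 /andP[ax xb] hb ma mb; have x0 := lt_le_trans a0 ax.
have [xc|cx] := leP (xlnx x) c.
  apply: (le_trans mb); apply: hl_decr => // z /andP[xz zb].
  case: hb => [hb|hb].
    by have := xlnx_le_max x0 (introT andP (conj xz zb)); rewrite le_max; lra.
  apply: le_trans xc; apply: xlnx_decr => //.
  by apply: le_trans hb; rewrite ler_ln ?posrE // (lt_le_trans x0) // (le_trans xz).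
apply: (le_trans ma); apply: hl_incr => // z /andP[az zx].
have z0 := lt_le_trans a0 az; case: hb => [hb|hb].
  have := xlnx_le_max z0 (introT andP (conj zx xb)).
  by rewrite le_max => /orP[]; lra.
apply: (le_trans (ltW cx)); apply: xlnx_decr => //.
by apply: le_trans hb; rewrite ler_ln ?posrE // (lt_le_trans x0).
Qed.

Lemma hl_ge_above t x : 0 < t -> -1 <= ln t -> t <= x -> hl (xlnx t) t <= hl (xlnx t) x.
Proof.
by move=> t0 lt tx; apply: hl_incr => // z /andP[tz _]; apply: xlnx_incr.
Qed.

Lemma hl_ge_tangent t y : 0 < t -> -1 <= ln t -> 0 < y -> -1 <= ln y ->
  hl (xlnx t) t <= hl (xlnx t) y.
Proof.
move=> t0 lt y0 ly; have [ty|yt] := leP t y; first exact: hl_ge_above.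
apply: hl_decr => //; first exact: ltW.
move=> z /andP[yz zt]; apply: xlnx_incr => //; first exact: lt_le_trans yz.
by apply: (le_trans ly); rewrite ler_ln ?posrE // (lt_le_trans y0).
Qed.

(** The conclusion is the tangent line bound for [h] at [t] in logarithmic
    coordinates.  By quasi-concavity left of [t] the left end decides. *)
Lemma hl_ge t b x : 0 < t -> -1 <= ln t -> 0 < b -> b <= x -> b <= t ->
  hl (xlnx t) t <= hl (xlnx t) b -> hl (xlnx t) t <= hl (xlnx t) x.
Proof.
move=> t0 lt b0 bx bt hb; have [tx|xt] := leP t x; first exact: hl_ge_above.
apply: (hl_quasiconcave (a := b) (b := t)) => //; last by left.
by rewrite bx ltW.
Qed.

(** Tangent bound for a sum of entropies penalised by the product: [psi] is the
    common value of [- a ln a] and [P0] the product at the point of tangency. *)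
Lemma sum_h_prod_ge (I : finType) (S : {set I}) (a : I -> R) kap psi P0 :
  (forall i, i \in S -> 0 < a i) -> 0 < P0 -> 0 <= psi <= kap * P0 ->
  \sum_(i in S) hl (- psi) (a i) + psi * (1 - ln P0) <=
  \sum_(i in S) h (a i) + kap * \prod_(i in S) a i.
Proof.
move=> ha P00 /andP[psi0 hk]; set P := \prod_(i in S) _.
have Pgt0 : 0 < P by apply: prodr_gt0.
have lnP : ln P = \sum_(i in S) ln (a i).
  rewrite /P; apply: (@proj1 _ (0 < \prod_(i in S) a i)).
  elim/big_rec2: _ => [|i y x Si [e y0]]; first by rewrite ln1.
  by have ai := ha i Si; rewrite lnM ?posrE // e mulr_gt0.
rewrite /hl sumrB -mulr_sumr -lnP.
have := ln_le_sub1 (divr_gt0 Pgt0 P00); rewrite ln_div ?posrE // => h1.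
have h2 : psi * (P / P0) <= kap * P.
  by rewrite mulrCA mulrC ler_pM2r // ler_pdivrMr.
nra.
Qed.

Lemma h_scale c x : 0 < c -> 0 <= x ->
  h (c * x) = c * h x + c * ln c * x + (1 - c).
Proof.
move=> c0; rewrite le_eqVlt => /predU1P[<-|x0].
  by rewrite mulr0 !h0; ring.
by rewrite /h lnM ?posrE //; ring.
Qed.

Lemma h_decr x y : 0 <= x -> x <= y -> y <= 1 -> h y <= h x.
Proof.
rewrite le_eqVlt => /predU1P[<-|x0] xy y1; first by rewrite h0 h_le1 // xy.
have y0 := lt_le_trans x0 xy.
by have := h_ge_tangent y0 (ltW x0); have := ln_le0 y1; nra.
Qed.

End Entropy.

(** * The variational problem *)

Section Variational.
Variables (R : realType) (H : sgraph).
Implicit Types (r kap : R).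

(** The variational problem is posed on [n] points for every [n], so that no limit
    object is needed. *)
Definition replica_symmetric r :=
  forall n (u : {set 'I_n} -> R), (0 < n)%N -> (forall s, 0 <= u s <= 1) ->
  hom_wt H u <= n%:R ^+ vcount H * r ^+ ecount H ->
  n%:R ^+ 2 * h r <= \sum_x \sum_y h (u [set x; y]).

(** Averaging the inequality for [a e = u (f @: e)] over all maps [f]: each edge
    of [H] is mapped to every pair equally often, and the products average to
    the density.  The parameter [kap] is the Lagrange multiplier. *)
Lemma replica_symmetric_pointwise r kap : (0 < ecount H)%N -> 0 <= kap ->
  (forall a : {set H} -> R, (forall e, 0 <= a e <= 1) ->
     (ecount H)%:R * h r + kap * r ^+ ecount H <=
     \sum_(e in edges H) h (a e) + kap * \prod_(e in edges H) a e) ->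
  replica_symmetric r.
Proof.
move=> e0 kap0 hpw n u n0 hu hom.
have nn0 : 0 < n%:R :> R by rewrite ltr0n.
have em0 : 0 < (ecount H)%:R :> R by rewrite ltr0n.
have nv0 : 0 < n%:R ^+ vcount H :> R by rewrite exprn_gt0.
set S := \sum_x _.
have avg e : e \in edges H ->
    n%:R ^+ 2 * \sum_(f : {ffun H -> 'I_n}) h (u (f @: e)) =
    n%:R ^+ vcount H * S.
  move=> /edgesP[a [b [_ ab ->]]]; rewrite -(sum_resample2 a b).
  under eq_bigr do under eq_bigr do under eq_bigr do rewrite upd2_pair //.
  by rewrite -(card_maps R H n) mulr_suml; apply: eq_bigr => f _; rewrite mul1r.
have h1 : n%:R ^+ vcount H * ((ecount H)%:R * h r + kap * r ^+ ecount H) <=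
    \sum_(f : {ffun H -> 'I_n}) \sum_(e in edges H) h (u (f @: e)) +
    kap * hom_wt H u.
  rewrite -(card_maps R H n) mulr_suml mulr_sumr -big_split /=.
  apply: ler_sum => f _; rewrite mul1r.
  by apply: (hpw (fun e => u (f @: e))) => e.
have h2 : n%:R ^+ 2 * (\sum_(f : {ffun H -> 'I_n}) \sum_(e in edges H) h (u (f @: e)))
   = (ecount H)%:R * (n%:R ^+ vcount H * S).
  rewrite exchange_big /= mulr_sumr.
  under eq_bigr => e he do rewrite avg //.
  by rewrite sumr_const mulr_natl.
have h3 : n%:R ^+ vcount H * ((ecount H)%:R * h r) <=
    \sum_(f : {ffun H -> 'I_n}) \sum_(e in edges H) h (u (f @: e)).
  move: h1 (ler_wpM2l kap0 hom); set Q := \sum_(f : _) _.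
  move: (r ^+ ecount H) (n%:R ^+ vcount H) (hom_wt H u) (ecount H)%:R (h r) Q.
  by clear => a b c d e f; lra.
have h4 := ler_wpM2l (exprn_ge0 2 (ltW nn0)) h3; rewrite h2 in h4.
rewrite -(ler_pM2l em0) -(ler_pM2l nv0).
move: h4; move: (n%:R ^+ 2) (n%:R ^+ vcount H) (ecount H)%:R => a b c.
by clear; lra.
Qed.

(** Scaling: weights at level [r] multiplied by [r0 / r] are weights at level
    [r0], and [h] is affine under scaling up to a term linear in the weight;
    that term has the right sign unless the average weight is below [r], when
    convexity alone suffices. *)
Lemma replica_symmetric_mono (r0 r : R) : 0 < r0 -> r0 <= r -> r <= 1 ->
  replica_symmetric r0 -> replica_symmetric r.
Proof.
move=> r00 r0r r1 hr0 n u n0 hu.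
have r_gt0 : 0 < r := lt_le_trans r00 r0r.
have [c [c0 c1 cr]] : exists c : R, [/\ 0 < c, c <= 1 & c * r = r0].
  exists (r0 / r); rewrite divr_gt0 // ler_pdivrMr // mul1r.
  by rewrite divfK // gt_eqF.
move=> hom.
set S := \sum_x _; pose U := \sum_x \sum_y u [set x; y].
have nn (z : R) : \sum_(x < n) \sum_(y < n) z = n%:R ^+ 2 * z.
  by under eq_bigr do rewrite sumr_const card_ord;
     rewrite sumr_const card_ord -mulrnA -[LHS]mulr_natl natrM expr2.
have [Ur|rU] := leP U (n%:R ^+ 2 * r).
  have : n%:R ^+ 2 * (h r - r * ln r) + ln r * U <= S.
    rewrite -nn /U mulr_sumr -big_split /=; apply: ler_sum => x _.
    rewrite mulr_sumr -big_split /=; apply: ler_sum => y _.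
    have /andP[u0 _] := hu [set x; y].
    by move: (h_ge_tangent r_gt0 u0); clear; lra.
  have := ln_le0 r1; move: Ur; move: (n%:R ^+ 2) => a.
  by clear; nra.
have hu' s : 0 <= c * u s <= 1.
  have /andP[u0 u1] := hu s; rewrite mulr_ge0 ?(ltW c0) //=.
  by apply: mulr_ile1 => //; exact: ltW.
have hom' : hom_wt H (fun s => c * u s) <= n%:R ^+ vcount H * r0 ^+ ecount H.
  rewrite /hom_wt (eq_bigr (fun f : {ffun H -> 'I_n} =>
     c ^+ ecount H * \prod_(e in edges H) u (f @: e))); last first.
    move=> f _; have -> : c ^+ ecount H = \prod_(e in edges H) c.
      by rewrite prodr_const.
    by rewrite -big_split.
  by rewrite -mulr_sumr -cr exprMn mulrCA ler_pM2l ?exprn_gt0.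
have := hr0 n _ n0 hu' hom'.
have -> : \sum_x \sum_y h (c * u [set x; y]) =
    c * S + c * ln c * U + n%:R ^+ 2 * (1 - c).
  rewrite -nn /S /U !mulr_sumr -!big_split /=; apply: eq_bigr => x _.
  rewrite !mulr_sumr -!big_split /=; apply: eq_bigr => y _.
  by rewrite h_scale //; have /andP[] := hu [set x; y].
rewrite -cr h_scale ?(ltW r_gt0) // => hh.
rewrite -(ler_pM2l c0).
have := ln_le0 c1; move: hh rU; move: (n%:R ^+ 2) (ln c) (h r) c0.
clear; move=> a l hr c0 hh rU l0.
have : 0 <= c * (- l * (U - a * r)).
  by rewrite !mulr_ge0 ?(ltW c0) ?subr_ge0 ?oppr_ge0 // ltW.
by lra.
Qed.

(** Near density one all competitors with a small edge weight already cost too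
    much, and elsewhere the logarithmic tangent bound applies. *)
Lemma replica_symmetric_near1 : (0 < ecount H)%N ->
  exists2 r0 : R, 0 < r0 < 1 & replica_symmetric r0.
Proof.
have aux (m d r : R) : 1 <= m -> 0 < d -> d * (m + 1) = 1 / 9 -> 1 - d <= r ->
    r < 1 -> d <= 1 -> m * (r * - d - r + 1) + r * d <= 1 / 9.
  clear => m1 d0 dm rd r1 d1.
  have a : r * - d - r + 1 <= d by nra.
  have b : m * (r * - d - r + 1) <= m * d by rewrite ler_wpM2l //; lra.
  by nra.
move=> e0; pose m : R := (ecount H)%:R; pose d := (9 * (m + 1))^-1.
have m1 : 1 <= m by rewrite /m ler1n.
have m0 : 0 < 9 * (m + 1) by rewrite mulr_gt0 // ltr_wpDl // (le_trans ler01).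
have d0 : 0 < d by rewrite invr_gt0.
have dm : d * (m + 1) = 1 / 9 by move: m0; rewrite /d; move: (m); clear => x x0; field; rewrite gt_eqF //; lra.
have d1 : d <= 1 by move: d0 m1 dm; move: (d) (m); clear => x y; nra.
pose r : R := expR (- d).
have r0 : 0 < r by apply: expR_gt0.
have r1 : r < 1 by rewrite expR_lt1 oppr_lt0.
have lr : ln r = - d by rewrite expRK.
have rd : 1 - d <= r by have := expR_ge1Dx (- d); rewrite -/r.
exists r; first by rewrite r0.
(* The multiplier makes the constant [r] a critical point: both terms of the
   pointwise inequality then have derivative [ln r] in absolute value there. *)
pose kap := (r * d) / r ^+ ecount H.
have rm0 : 0 < r ^+ ecount H by rewrite exprn_gt0.
have kap0 : 0 <= kap by rewrite divr_ge0 ?mulr_ge0 // ltW.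
apply: (replica_symmetric_pointwise e0 kap0) => a ha.
have kr : kap * r ^+ ecount H = r * d by rewrite divfK // gt_eqF.
have small : m * h r + r * d <= 1 / 9.
  by rewrite /h lr; apply: aux.
have [hall|/existsNP[e /not_implyP[he hne]]] :=
  pselect (forall e, e \in edges H -> 0 < a e /\ -1 <= ln (a e)).
  apply: le_trans (sum_h_prod_ge (psi := r * d) (P0 := r ^+ ecount H) _ _ _) => //.
  - rewrite kr lnXn // lr.
    apply: (@le_trans _ _ (\sum_(e in edges H) hl (- (r * d)) r
       + r * d * (1 - (- d) *+ ecount H))); last first.
      rewrite lerD2r; apply: ler_sum => e he; have [a0 la] := hall e he.
      have -> : - (r * d) = xlnx r by rewrite /xlnx lr mulrN.
      by apply: hl_ge_tangent => //; rewrite lr lerN2.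
    rewrite sumr_const -/(ecount H) -[X in _ <= X + _]mulr_natl.
    rewrite -[(- d) *+ _]mulr_natl /hl lr -/m; move: (h r) (d) (m) (r).
    by clear => a d m r; lra.
  - by move=> e /hall[].
  - by rewrite kr mulr_ge0 ?lexx // ltW.
have he9 : 1 / 9 <= h (a e).
  have /andP[a0 _] := ha e; move: a0; rewrite le_eqVlt => /predU1P[<-|a0].
    by rewrite h0; clear; lra.
  have la : ln (a e) < -1.
    by rewrite ltNge; apply/negP => la; apply: hne.
  have e1 := h_ge_tangent (expR_gt0 (-1 : R)) (ltW a0).
  rewrite /h expRK in e1; move: e1 la a0; clear => e1 la a0.
  have ae : a e < expR (-1) by rewrite -ltr_ln ?posrE ?expR_gt0 // expRK.
  have : expR (-1) <= 4 / 9 :> R.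
    have : 3 / 2 <= expR (1 / 2 : R) by have := expR_ge1Dx (1 / 2 : R); lra.
    have -> : expR (-1) = (expR (1 / 2) * expR (1 / 2))^-1 :> R.
      by rewrite -expRD -expRN; congr expR; lra.
    move=> x; rewrite -[X in X <= _]mul1r ler_pdivrMr; nra.
  by rewrite /h; lra.
rewrite kr; apply: (le_trans small); apply: (le_trans he9).
rewrite (bigD1 e) //= -addrA lerDl addr_ge0 //.
  by apply: sumr_ge0 => i _; apply: h_ge0; have /andP[] := ha i.
by rewrite mulr_ge0 // prodr_ge0 // => i _; have /andP[] := ha i.
Qed.

End Variational.

(** * The two parity classes *)

Section Parity.
Variables (R : realType) (n : nat).
Implicit Types (A B : R).

(** Stated for a set, since weights are functions of sets; singletons are
    monochromatic. *)
Definition same_parity (s : {set 'I_n}) : bool :=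
  [forall x in s, forall y in s, odd x == odd y].

Definition parity_wt A B (s : {set 'I_n}) : R := if same_parity s then A else B.

Lemma same_parity2 (x y : 'I_n) : same_parity [set x; y] = (odd x == odd y).
Proof.
apply/forall_inP/idP => [h|/eqP xy a].
  by move/forall_inP: (h x (set21 _ _)) => /(_ y (set22 _ _)).
by rewrite !inE => /orP[]/eqP->; apply/forall_inP => b;
   rewrite !inE => /orP[]/eqP->; rewrite ?xy.
Qed.

Lemma parity_wt2 A B (x y : 'I_n) :
  parity_wt A B [set x; y] = (A + B) / 2 + (A - B) / 2 * ((-1) ^+ x * (-1) ^+ y).
Proof.
rewrite /parity_wt same_parity2 -(signr_odd R x) -(signr_odd R y).
by case: (odd x); case: (odd y); rewrite ?expr0 ?expr1 /=; field.
Qed.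

Lemma parity_wt_comp (f : R -> R) A B s :
  f (parity_wt A B s) = parity_wt (f A) (f B) s.
Proof. by rewrite /parity_wt; case: ifP. Qed.

Lemma sum_signs : \sum_(x < n) (-1) ^+ x = (odd n)%:R :> R.
Proof.
elim: n => [|k IH]; first by rewrite big_ord0.
rewrite big_ord_recr /= IH -signr_odd /=.
by case: (odd k); rewrite ?expr0 ?expr1 /= ?addr0 ?add0r ?subrr.
Qed.

Lemma sum_parity_wt A B : \sum_x \sum_y parity_wt A B [set x; y] =
  n%:R ^+ 2 * ((A + B) / 2) + (odd n)%:R * ((A - B) / 2).
Proof.
under eq_bigr do under eq_bigr do rewrite parity_wt2.
under eq_bigr do rewrite big_split /= -!mulr_sumr sum_signs sumr_const card_ord.
rewrite big_split /= sumr_const card_ord -mulr_sumr -mulr_suml sum_signs.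
rewrite -[X in X + _]mulr_natl -[2^-1 *+ n]mulr_natl -natrM mulnb andbb.
by move: (n%:R) ((odd n)%:R) => a b; ring.
Qed.

Lemma sum_parity_wt_le A B : `|A - B| <= 2 ->
  \sum_x \sum_y parity_wt A B [set x; y] <= n%:R ^+ 2 * ((A + B) / 2) + 1.
Proof.
rewrite ler_norml => /andP[a b]; rewrite sum_parity_wt lerD2l.
by case: (odd n); rewrite /= ?mul1r ?mul0r; lra.
Qed.

End Parity.

Section NonBipartite.
Variables (R : realType) (H : sgraph) (n : nat).

Lemma bern_off (q : {set 'I_n} -> R) (w : {set {set 'I_n}}) :
  (forall e, e \notin pairs n -> q e = 0) -> ~~ (w \subset pairs n) ->
  bern q w = 0.
Proof.
by move=> h /subsetPn[e ew ne]; rewrite /bern (bigD1 e) //= ew h // mul0r.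
Qed.

(** If no edge joins two vertices of the same parity, the graph is bipartite, so
    [H] has no homomorphism into it.  Deleting these edges concerns about
    [n^2 / 4] pairs. *)
Lemma nonbipartite_lower (p tau : R) : ~ bipartite H -> 0 < p <= 1 / 2 -> 0 <= tau ->
  expR (- ((p + 2 * p ^+ 2) * ((n%:R ^+ 2 + 2) / 4))) <=
  gnp_prob n p (fun G => hom_density R H G <= tau).
Proof.
move=> nb /andP[p0 p2] tau0.
pose M : {set {set 'I_n}} := [set e in pairs n | same_parity e].
have cM : #|M|%:R <= (n%:R ^+ 2 + 2) / 4 :> R.
  have := @sum_parity_wt_le R n 1 0; rewrite subr0 normr1 => /(_ (ler1n _ _)).
  rewrite sum_pairs; have -> : \sum_(e in pairs n) parity_wt 1 0 e = #|M|%:R :> R.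
    rewrite -sum1_card natr_sum [RHS]big_mkcond [LHS]big_mkcond /=.
    by apply: eq_bigr => e _; rewrite inE /parity_wt; case: (e \in pairs n).
  have : 0 <= \sum_(x < n) parity_wt 1 0 [set x] :> R.
    by apply: sumr_ge0 => x _; rewrite /parity_wt; case: ifP.
  by move: (\sum_x _) (#|M|%:R) (n%:R ^+ 2) => a b c; clear; lra.
have hp : 0 <= p <= 1 by clear -p0 p2; lra.
rewrite gnp_probE; set q := gnp_param p; have hq : is_param q := gnp_param01 hp.
have qE e : e \in M -> q e = p by rewrite inE /q /gnp_param => /andP[->].
pose g (e : {set 'I_n}) (b : bool) : R := if e \in M then (~~ b)%:R else 1.
apply: (@le_trans _ _ (expect q (fun w => \prod_e g e (e \in w)))).
  rewrite expect_prod (bigID (mem M)) /= [X in _ <= _ * X]big1 ?mulr1; last first.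
    by move=> e /negbTE ne; rewrite /g ne; ring.
  have -> : \prod_(e in M) (q e * g e true + (1 - q e) * g e false) =
            \prod_(e in M) (1 - p).
    by apply: eq_bigr => e he; rewrite qE // /g he /=; ring.
  rewrite prodr_const.
  have h1 : expR (- (p + 2 * p ^+ 2)) <= 1 - p.
    rewrite expRN -[X in X <= _]mul1r ler_pdivrMr ?expR_gt0 //.
    have := expR_ge1Dx (p + 2 * p ^+ 2); move: (expR _) => x hx.
    by clear -p0 p2 hx; nra.
  apply: (@le_trans _ _ (expR (- (p + 2 * p ^+ 2)) ^+ #|M|)).
    rewrite -expRM_natr ler_expR mulNr lerN2 ler_wpM2l //.
    by clear -p0; nra.
  by rewrite lerXn2r ?nnegrE ?expR_ge0 //; clear -p2; lra.
rewrite probE /expect; apply: ler_sum => w _.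
have g01 e b : 0 <= g e b <= 1.
  by rewrite /g; case: ifP => _; case: b; rewrite /= ?lexx ?ler01.
have [wE|wE] := boolP (w \subset pairs n); last first.
  by rewrite bern_off ?mul0r // => e /negbTE ne; rewrite /q /gnp_param ne.
rewrite ler_wpM2l ?bern_ge0 //=.
have [/existsP[e /andP[eM ew]]|/existsPn hw] := boolP [exists e, (e \in M) && (e \in w)].
  by rewrite (bigD1 e) //= /g eM ew /= mul0r ler0n.
have -> : hom_density R H (graph_of_edges w) <= tau.
  rewrite hom_densityE // (_ : hom_wt H (ind R w) = 0) ?mul0r //.
  rewrite -hom_countE // /hom_count eq_card0 // => f; rewrite inE.
  apply/negP => /forallP hf; apply: nb; exists (fun x => odd (f x)) => x y xy.
  move/forallP: (hf x) => /(_ y)/implyP/(_ xy)/andP[_ fw].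
  apply/negP => fxy; have := hw [set f x; f y].
  by rewrite fw andbT inE same_parity2 fxy (subsetP wE _ fw).
rewrite (@big1 _ _ _ _ _ xpredT) // => e _; rewrite /g.
by have := hw e; case: (e \in M) => //= /negbTE ->.
Qed.

End NonBipartite.

(** * Asymptotics *)

Section Asymptotics.
Variable R : realType.
Implicit Types (p : nat -> R) (alpha r eta : R).

(** The approximation error has to be of order [p^e(H)], so weak regularity takes
    about [p^(- 2 e(H))] steps and there are [exp (O (n p^(- 2 e(H))))] possible
    approximants; this must be negligible against [exp (n^2 p)]. *)
Definition sparse_exponent (H : sgraph) : R := (2 * (ecount H)%:R + 2)^-1.

Lemma near_le_nat (K : R) : (\forall n \near \oo, K <= n%:R)%classic.
Proof. exact: nbhs_infty_ger. Qed.

Lemma near_p_gt0 alpha p : edge_prob_seq alpha p -> (\forall n \near \oo, 0 < p n)%classic.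
Proof.
move=> [_ _ hp]; near=> n.
have hn : n%:R `^ (- alpha) <= p n by near: n.
by apply: lt_le_trans hn; rewrite powR_gt0 // ltr0n; near: n; exact: nbhs_infty_gt.
Unshelve. all: by end_near. Qed.

Lemma near_p_small alpha p eta : 0 < eta -> edge_prob_seq alpha p ->
  (\forall n \near \oo, p n <= eta)%classic.
Proof.
move=> e0 [p01 p0 _]; move/cvgrPdist_le: p0 => /(_ _ e0) hp; near=> n.
have : `|0 - p n| <= eta by near: n.
by rewrite sub0r normrN ger0_norm //; have /andP[] := p01 n.
Unshelve. all: by end_near. Qed.

(** The exponent is chosen so that [n p^(2 e(H) + 1)], which is at least
    [n^(1 / (2 e(H) + 2))], tends to infinity. *)
Lemma near_sparse (H : sgraph) p (K : R) : edge_prob_seq (sparse_exponent H) p ->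
  (\forall n \near \oo, K <= n%:R * p n ^+ (2 * ecount H).+1)%classic.
Proof.
move=> [_ _ hp]; set a := sparse_exponent H.
have a0 : 0 < a by rewrite invr_gt0 ltr_wpDl // mulr_ge0.
near=> n.
have hn : n%:R `^ (- a) <= p n by near: n.
have n0 : 0 < n%:R :> R by rewrite ltr0n; near: n; exact: nbhs_infty_gt.
have hK : Num.max 1 K `^ a^-1 <= n%:R by near: n; exact: near_le_nat.
have K1 : 0 <= Num.max 1 K by rewrite le_max ler01.
apply: (@le_trans _ _ (n%:R `^ a)).
  apply: (@le_trans _ _ (Num.max 1 K)); first by rewrite le_max lexx orbT.
  have := ge0_ler_powR (ltW a0) _ _ hK; rewrite !nnegrE powR_ge0 (ltW n0).
  by move=> /(_ isT isT); rewrite -powRrM mulVf ?gt_eqF // powRr1.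
have -> : n%:R `^ a = n%:R * (n%:R `^ (- a)) ^+ (2 * ecount H).+1.
  rewrite -powR_mulrn ?powR_ge0 // -powRrM -{2}[n%:R]powRr1 ?(ltW n0) //.
  rewrite -powRD; last by apply/implyP => _; rewrite gt_eqF.
  congr (_ `^ _); rewrite /a /sparse_exponent -[(2 * ecount H).+1%:R]natr1 natrM.
  have : 0 <= (ecount H)%:R :> R by [].
  move: (_%:R) => e e0; field; rewrite gt_eqF //.
  by clear -e0; lra.
by rewrite ler_pM2l // lerXn2r ?nnegrE ?powR_ge0 // (le_trans _ hn) ?powR_ge0.
Unshelve. all: by end_near. Qed.

Definition rate_exponent p n : R := n%:R ^+ 2 * p n / 2.

Definition tail_prob (H : sgraph) p r n : R :=
  gnp_prob n (p n) (fun G => hom_density R H G <= (r * p n) ^+ ecount H).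

Lemma lower_tail_rateE H p r n : 0 < tail_prob H p r n ->
  lower_tail_rate H p r n = ((rate_exponent p n)^-1 * ln (tail_prob H p r n))%:E.
Proof.
move=> h; rewrite /lower_tail_rate -/(tail_prob H p r n) lne_EFin // -EFinM.
by rewrite /rate_exponent invf_div.
Qed.

Lemma liminf_rate_ge H p alpha r (b : R) : edge_prob_seq alpha p ->
  (\forall n \near \oo, expR (- (rate_exponent p n * b)) <= tail_prob H p r n)%classic ->
  ((- b)%:E <= limn_einf (lower_tail_rate H p r))%E.
Proof.
move=> hp hb; rewrite limn_einf_lim.
have : (\forall n \near \oo, (- b)%:E <= lower_tail_rate H p r n)%E%classic.
  near=> n.
  have p0 : 0 < p n by near: n; exact: near_p_gt0 hp.
  have n0 : 0 < n%:R :> R by rewrite ltr0n; near: n; exact: nbhs_infty_gt.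
  have hn : expR (- (rate_exponent p n * b)) <= tail_prob H p r n by near: n.
  have P0 := lt_le_trans (expR_gt0 _) hn.
  have r0 : 0 < rate_exponent p n by rewrite divr_gt0 // mulr_gt0 // exprn_gt0.
  rewrite lower_tail_rateE // lee_fin -(ler_pM2l r0) mulrA divff ?gt_eqF // mul1r.
  by rewrite mulrN -ler_expR lnK.
move=> [N _ hN]; apply: lime_ge.
  exact: is_cvg_einfs.
exists N => // n /= Nn; apply/ereal_infP => _ [k /= nk <-].
by apply: hN => /=; apply: leq_trans nk.
Unshelve. all: by end_near. Qed.

Lemma rate_cvg H p alpha r (b : R) : edge_prob_seq alpha p ->
  (forall eta, 0 < eta -> \forall n \near \oo,
     expR (- (rate_exponent p n * (b + eta))) <= tail_prob H p r n)%classic ->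
  (forall eta, 0 < eta -> \forall n \near \oo,
     tail_prob H p r n <= expR (- (rate_exponent p n * (b - eta))))%classic ->
  (lower_tail_rate H p r @ \oo --> (- b)%:E)%classic.
Proof.
move=> hp hl hu.
have pos : (\forall n \near \oo, 0 < tail_prob H p r n)%classic.
  near=> n; have hn : expR (- (rate_exponent p n * (b + 1))) <= tail_prob H p r n.
    by near: n; exact: hl.
  exact: lt_le_trans (expR_gt0 _) hn.
apply/fine_cvgP; split.
  by near=> n; rewrite lower_tail_rateE //; near: n.
apply/cvgrPdist_le => eta e0; near=> n.
have P0 : 0 < tail_prob H p r n by near: n.
rewrite /= lower_tail_rateE //=.
have p0 : 0 < p n by near: n; exact: near_p_gt0 hp.
have n0 : 0 < n%:R :> R by rewrite ltr0n; near: n; exact: nbhs_infty_gt.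
have h1 : expR (- (rate_exponent p n * (b + eta))) <= tail_prob H p r n.
  by near: n; exact: hl.
have h2 : tail_prob H p r n <= expR (- (rate_exponent p n * (b - eta))).
  by near: n; exact: hu.
have r0 : 0 < rate_exponent p n by rewrite divr_gt0 // mulr_gt0 // exprn_gt0.
have e1 : ln (tail_prob H p r n) <= - (rate_exponent p n * (b - eta)).
  by rewrite -ler_expR lnK.
have e2 : - (rate_exponent p n * (b + eta)) <= ln (tail_prob H p r n).
  by rewrite -ler_expR lnK.
rewrite -mulrN -ler_pdivrMl // in e1; rewrite -mulrN -ler_pdivlMl // in e2.
rewrite ler_norml; apply/andP; split.
  by move: e1 e2; move: (_ * ln _) => x; clear; lra.
by move: e1 e2; move: (_ * ln _) => x; clear; lra.
Unshelve. all: by end_near. Qed.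

End Asymptotics.

Section TailBounds.
Variables (R : realType) (H : sgraph).
Hypothesis eH : (0 < ecount H)%N.
Implicit Types (p : nat -> R) (r eta : R).

Lemma sparse_facts p (K : R) : edge_prob_seq (sparse_exponent R H) p -> 0 < K ->
  (\forall n \near \oo, [/\ (0 < n)%N, K <= n%:R, 0 < p n <= K^-1 &
     [/\ K <= n%:R * p n ^+ (2 * ecount H).+1, K <= n%:R * p n ^+ ecount H &
         K <= n%:R * p n]])%classic.
Proof.
move=> hp K0; near=> n.
have n0 : (0 < n)%N by near: n; exact: nbhs_infty_gt.
have nK : K <= n%:R by near: n; exact: near_le_nat.
have p0 : 0 < p n by near: n; exact: near_p_gt0 hp.
have pK : p n <= K^-1 by near: n; apply: near_p_small hp; rewrite invr_gt0.
have hS : K <= n%:R * p n ^+ (2 * ecount H).+1 by near: n; exact: near_sparse.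
have p1 : p n <= 1 by have [h _ _] := hp; have /andP[] := h n.
have nn0 : 0 < n%:R :> R by rewrite ltr0n.
split=> //; first by rewrite p0.
split=> //; apply: (le_trans hS); rewrite ler_pM2l //.
  rewrite (ler_wiXn2l (ltW p0) p1) // mul2n -addnn.
  by rewrite -addnS leq_addr.
by rewrite -[X in _ <= X]expr1 (ler_wiXn2l (ltW p0) p1).
Unshelve. all: by end_near. Qed.

Lemma h_cont_right r eta : 0 < r < 1 -> 0 < eta ->
  exists2 r' : R, r < r' < 1 & h r - eta <= h r'.
Proof.
move=> /andP[r0 r1] e0.
pose L := - ln r; have L0 : 0 < L by rewrite oppr_gt0 ln_lt0 // r0.
pose d := Num.min ((1 - r) / 2) (eta / L).
have d0 : 0 < d by rewrite lt_min !divr_gt0 // subr_gt0.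
have d1 : d <= (1 - r) / 2 by rewrite ge_min lexx.
have d2 : d * L <= eta by rewrite -ler_pdivlMr // ge_min lexx orbT.
exists (r + d); first by move: d0 d1 r1; clear; lra.
have := @h_ge_tangent _ (r + d) r r0 (ltW (addr_gt0 r0 d0)).
by move: d2; rewrite /L; move: (h (r + d)) (h r) (ln r) (d); clear => a b c x; lra.
Qed.

Lemma steps_count (eps : R) : 0 < eps <= 1 ->
  exists k : nat, 1 <= k%:R * eps ^+ 2 <= 2.
Proof.
move=> /andP[e0 e1]; have s0 : 0 < eps ^+ 2 by rewrite exprn_gt0.
have s1 : eps ^+ 2 <= 1 by rewrite expr_le1 // ltW.
exists (Num.truncn (eps ^- 2)).+1.
have i0 : 0 <= eps ^- 2 by rewrite invr_ge0 ltW.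
have /andP[t1 t2] := truncn_itv i0.
apply/andP; split; first by rewrite -ler_pdivrMr // mul1r ltW.
rewrite -ler_pdivlMr // -natr1.
have : 1 <= eps ^- 2 by rewrite invf_ge1.
by move: t1; move: (eps ^- 2) (_%:R) => a b; clear; lra.
Qed.

Lemma ln2_le1 : ln 2 <= 1 :> R.
Proof. by have := @ln_le_sub1 R 2 (ltr0n _ 2); lra. Qed.

(** The slack between [r] and a slightly larger [r'] absorbs the approximation
    error and the clipping of the tilt. *)
Lemma tail_prob_upper p r eta : edge_prob_seq (sparse_exponent R H) p ->
  0 < r < 1 -> (forall r', r < r' < 1 -> replica_symmetric H r') -> 0 < eta ->
  (\forall n \near \oo,
     tail_prob H p r n <= expR (- (rate_exponent p n * (h r - eta))))%classic.
Proof.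
move=> hp hr hRS e0.
have e3 : 0 < eta / 3 by rewrite divr_gt0.
have [r' /andP[rr' r'1] hr'] := h_cont_right hr e3.
have /andP[r0 r1] := hr.
pose e := ecount H; pose E : R := e%:R.
have E0 : 0 < E by rewrite ltr0n.
pose z := r' ^+ e - r ^+ e.
have z0 : 0 < z.
  have r'0 := lt_trans r0 rr'.
  by rewrite subr_gt0 ltr_pXn2r ?nnegrE ?(ltW r0) ?(ltW r'0).
have [c [c0 c1 cz]] : exists c : R, [/\ 0 < c, c <= 1 & E * (2 * c) <= z / 2].
  exists (Num.min 1 (z / (4 * E))); split.
  - by rewrite lt_min ltr01 divr_gt0 // mulr_gt0.
  - by rewrite ge_min lexx.
  have : Num.min 1 (z / (4 * E)) <= z / (4 * E) by rewrite ge_min lexx orbT.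
  by rewrite ler_pdivlMr ?mulr_gt0 //; move: (Num.min _ _) => x; clear; lra.
have [d [d0 d1 dz]] : exists d : R, [/\ 0 < d, d <= 1 & E * d <= z / 2].
  exists (Num.min 1 (z / (2 * E))); split.
  - by rewrite lt_min ltr01 divr_gt0 // mulr_gt0.
  - by rewrite ge_min lexx.
  have : Num.min 1 (z / (2 * E)) <= z / (2 * E) by rewrite ge_min lexx orbT.
  by rewrite ler_pdivlMr ?mulr_gt0 //; move: (Num.min _ _) => x; clear; lra.
(* The number of pieces and the diagonal each cost at most a third of [eta]. *)
pose K := Num.max 1 (Num.max (3 / eta) (36 / (c ^+ 2 * eta))).
have K0 : 0 < K by rewrite lt_max ltr01.
near=> n.
have [n0 nK /andP[p0 pK] [hS _ _]] : [/\ (0 < n)%N, K <= n%:R, 0 < p n <= K^-1 &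
     [/\ K <= n%:R * p n ^+ (2 * ecount H).+1, K <= n%:R * p n ^+ ecount H &
         K <= n%:R * p n]] by near: n; exact: sparse_facts.
have p1 : p n <= 1 by have [hh _ _] := hp; have /andP[] := hh n.
set q := p n in p0 pK hS p1 *.
have pe0 : 0 < q ^+ e by rewrite exprn_gt0.
pose eps := c * q ^+ e.
have eps01 : 0 < eps <= 1.
  rewrite mulr_gt0 //=; apply: mulr_ile1 => //; try exact: ltW.
  by apply: exprn_ile1 => //; exact: ltW.
have [k /andP[k1 k2]] := steps_count eps01.
have /andP[eps0 _] := eps01.
pose m := (n%:R ^+ 2 * h r' - n%:R) / 2.
have := @lower_tail_upper R H n k q eps d ((r * q) ^+ e) m n0 _ eps0 _ k1.
rewrite p0 p1 d0 d1 => /(_ isT isT) hup.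
apply: (le_trans (hup _)).
  move=> u hu hom.
  have hR : n%:R ^+ 2 * h r' <= \sum_x \sum_y h (u [set x; y]).
    apply: hRS => //; first by rewrite rr'.
    apply: (le_trans hom); rewrite ler_pM2l ?exprn_gt0 ?ltr0n //.
    have -> : ((r * q) ^+ ecount H + (ecount H)%:R * (2 * eps)) / q ^+ ecount H
        = r ^+ e + E * (2 * c).
      rewrite /eps -/e -/E exprMn; move: (r ^+ e) (q ^+ e) (E) pe0.
      by clear => a b x b0; field; rewrite gt_eqF.
    by move: cz dz; rewrite /z -/e -/E; move: (r ^+ e) (r' ^+ e) (E * d) (E * (2 * c)) => a b x y; clear; lra.
  have hd : \sum_(x < n) h (u [set x]) <= n%:R.
    rewrite -[X in _ <= X%:R](card_ord n) -sum1_card natr_sum.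
    by apply: ler_sum => x _; apply: h_le1.
  rewrite (@sum_pairs R n (fun s => h (u s))) in hR.
  move: hR hd; rewrite /m; move: (\sum_x _) (\sum_(_ in _) _) (n%:R ^+ 2 * h r') (n%:R).
  by clear => a b x y; lra.
have -> : (2 ^+ (2 * n).+1) ^+ k * expR (- (q * m)) =
    expR (k%:R * (2 * n).+1%:R * ln 2 - q * m).
  rewrite expRD; congr (_ * _).
  by rewrite -exprM -natrM mulnC expRM_natl lnK // posrE.
rewrite ler_expR /rate_exponent -/q.
have ke : k%:R <= 2 / eps ^+ 2 by rewrite ler_pdivlMr ?exprn_gt0.
have nn0 : 0 < n%:R :> R by rewrite ltr0n.
have n1 : 1 <= n%:R :> R by rewrite ler1n.
have hk : k%:R * (2 * n).+1%:R * ln 2 <= n%:R ^+ 2 * q * (eta / 6).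
  apply: (@le_trans _ _ (k%:R * (3 * n%:R))).
    have n3 : (2 * n).+1%:R <= 3 * n%:R :> R.
      by rewrite -natrM ler_nat; clear -n0; lia.
    rewrite -mulrA ler_wpM2l //; apply: (le_trans _ n3).
    by rewrite ler_piMr // ln2_le1.
  apply: (@le_trans _ _ (2 / eps ^+ 2 * (3 * n%:R))).
    by rewrite ler_wpM2r // mulr_ge0.
  have hS2 : 36 / (c ^+ 2 * eta) <= n%:R * q ^+ (2 * e).+1.
    by apply: (le_trans _ hS); rewrite /K !le_max lexx !orbT.
  have c20 : 0 < c ^+ 2 by rewrite exprn_gt0.
  rewrite ler_pdivrMr ?mulr_gt0 // in hS2.
  have q2e : q ^+ (2 * e).+1 = q * (q ^+ e) ^+ 2 by rewrite exprS mulnC exprM.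
  rewrite mulrAC ler_pdivrMr ?exprn_gt0 // /eps exprMn.
  move: hS2; rewrite q2e; move: (q ^+ e) (c ^+ 2) (n%:R) nn0 => x y N N0 hS2.
  have := ler_wpM2l (ltW N0) hS2; clear; lra.
have hn : q * n%:R / 2 <= n%:R ^+ 2 * q * (eta / 6).
  have hn3 : 3 / eta <= n%:R by apply: le_trans nK; rewrite /K !le_max lexx !orbT.
  rewrite ler_pdivrMr // in hn3.
  have := ler_wpM2l (ltW (mulr_gt0 nn0 p0)) hn3; move: (n%:R) (q) => x y; clear; lra.
have hh := ler_wpM2l (ltW (mulr_gt0 (exprn_gt0 2 nn0) p0)) hr'.
move: hk hn hh; rewrite /m; move: (k%:R * _ * _) => x.
by move: (n%:R) (q) (h r) (h r') => a b y w; clear; lra.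
Unshelve. all: by end_near. Qed.

(** A competitor for the variational problem, given as weights bounded away from
    0 uniformly in [n], bounds the tail probability from below.  The error 1 in the
    entropy leaves room for odd [n] in two-block weights. *)
Lemma tail_prob_lower p r (u : forall n, {set 'I_n} -> R) (delta sigma v eta : R) :
  edge_prob_seq (sparse_exponent R H) p -> 0 < r -> 0 < delta ->
  (forall n s, delta <= u n s <= 1) ->
  (forall n, hom_wt H (u n) <= n%:R ^+ vcount H * sigma) ->
  sigma < r ^+ ecount H ->
  (forall n, \sum_x \sum_y h (u n [set x; y]) <= n%:R ^+ 2 * v + 1) -> 0 < eta ->
  (\forall n \near \oo,
     expR (- (rate_exponent p n * (v + eta))) <= tail_prob H p r n)%classic.
Proof.
move=> hp r0 d0 hu hom hs hv e0.
pose e := ecount H; pose gap := r ^+ e - sigma.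
have gap0 : 0 < gap by rewrite subr_gt0.
have re0 : 0 < r ^+ e by rewrite exprn_gt0.
pose theta := gap / (4 * r ^+ e).
have t0 : 0 < theta by rewrite divr_gt0 // mulr_gt0.
have tE : (1 - 2 * theta) * r ^+ e = sigma + gap / 2.
  rewrite /theta /gap; move: re0; move: (r ^+ e) => x; clear => x0.
  by field; rewrite gt_eqF.
pose V : R := (vcount H)%:R ^+ 2.
have V0 : 0 <= V by rewrite sqr_ge0.
pose B := (1 - ln delta) ^+ 2.
have B0 : 0 <= B by apply: sqr_ge0.
(* The entries of [K] make, in turn, the second-order entropy, the collapsed
   maps, the variance and the factor [theta] negligible. *)
pose K := Num.max 2 (Num.max (8 / eta) (Num.max (2 * V / gap)
    (Num.max (64 * B / (theta * eta ^+ 2)) (8 * (- ln theta) / eta)))).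
have K2 : 2 <= K by rewrite le_max lexx.
have K0 : 0 < K by apply: lt_le_trans K2.
near=> n.
have [n0 nK /andP[p0 pK] [hS hSe hS1]] : [/\ (0 < n)%N, K <= n%:R, 0 < p n <= K^-1 &
     [/\ K <= n%:R * p n ^+ (2 * ecount H).+1, K <= n%:R * p n ^+ ecount H &
         K <= n%:R * p n]] by near: n; exact: sparse_facts.
set q := p n in p0 pK hS hSe hS1 *.
have nn0 : 0 < n%:R :> R by rewrite ltr0n.
have n1 : 1 <= n%:R :> R by rewrite ler1n.
have q2 : q <= 1 / 2 by apply: (le_trans pK); rewrite div1r lef_pV2 // posrE.
have qe : q <= eta / 8.
  have h8 : 8 / eta <= K by rewrite /K !le_max lexx !orbT.
  by apply: (le_trans pK); rewrite -[eta / 8]invf_div lef_pV2 // posrE divr_gt0.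
pose s := eta / 8 * (q * n%:R ^+ 2).
have s0 : 0 < s by rewrite !mulr_gt0 // ?exprn_gt0 // invr_gt0.
have nq : K <= q * n%:R ^+ 2.
  apply: (le_trans hS1); rewrite mulrC ler_pM2l // expr2.
  by rewrite ler_peMr // ltW.
apply: le_trans (@lower_tail_lower R H n q (u n) delta theta s _ sigma
   n0 _ d0 (hu n) t0 s0 _ (hom n) _ _); last 4 first.
- by rewrite p0.
- by rewrite exprn_gt0 // mulr_gt0.
- rewrite exprMn mulrA tE -/V -/e.
  have hVK : 2 * V / gap <= n%:R * q ^+ e.
    by apply: le_trans hSe; rewrite /K !le_max lexx !orbT.
  rewrite ler_pdivrMr // in hVK.
  suff : V / n%:R <= q ^+ e * (gap / 2) by move: (q ^+ e) => x; clear; lra.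
  rewrite ler_pdivrMr //; move: hVK; move: (q ^+ e) (n%:R) => x y; clear; lra.
- rewrite -/B /s.
  have hBK : 64 * B / (theta * eta ^+ 2) <= q * n%:R ^+ 2.
    by apply: le_trans nq; rewrite /K !le_max lexx !orbT.
  rewrite ler_pdivrMr ?(mulr_gt0 t0 (exprn_gt0 2 e0)) // in hBK.
  have x0 : 0 < q * n%:R ^+ 2 by apply: lt_le_trans nq.
  have := ler_wpM2l (ltW x0) hBK; move: (q * n%:R ^+ 2) => x; clear; lra.
have -> : theta = expR (ln theta) by rewrite lnK.
rewrite -expRD ler_expR /rate_exponent -/q.
have hE : 2 * \sum_(e in pairs n) h (u n e) <= n%:R ^+ 2 * v + 1.
  apply: le_trans (hv n); rewrite (@sum_pairs R n (fun s => h (u n s))) lerDl.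
  apply: sumr_ge0 => x _; apply: h_ge0; have /andP[h1 _] := hu n [set x].
  by apply: le_trans h1; exact: ltW.
have hE2 := ler_wpM2l (ltW p0) hE.
have hL : - ln theta <= eta / 8 * (q * n%:R ^+ 2).
  have hLK : 8 * (- ln theta) / eta <= q * n%:R ^+ 2.
    by apply: le_trans nq; rewrite /K !le_max lexx !orbT.
  by rewrite ler_pdivrMr // in hLK; move: hLK; move: (q * _) => x; clear; lra.
have hq2 : q / 2 <= eta / 8 * (q * n%:R ^+ 2).
  have h8 : 8 / eta <= n%:R by apply: le_trans nK; rewrite /K !le_max lexx !orbT.
  rewrite ler_pdivrMr // in h8.
  have h9 : 1 <= eta / 4 * n%:R ^+ 2.
    by move: h8 n1 e0; move: (n%:R) => x; clear; nra.
  by have := ler_wpM2l (ltW p0) h9; move: (n%:R ^+ 2) => x; clear; lra.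
have hq3 : q ^+ 2 * n%:R ^+ 2 <= eta / 8 * (q * n%:R ^+ 2).
  by rewrite mulrA ler_pM2r ?exprn_gt0 // expr2 ler_pM2r.
move: hE2 hL hq2 hq3; rewrite /s; move: (\sum_(_ in _) _) (ln theta) (n%:R ^+ 2) => x y w.
by clear; lra.
Unshelve. all: by end_near. Qed.

(** Constant weights slightly below [r] match the upper bound. *)
Lemma tight_above_of_rs (rbar : R) : 0 <= rbar ->
  (forall r, rbar < r < 1 -> replica_symmetric H r) ->
  tight_above H (sparse_exponent R H) rbar.
Proof.
move=> rb0 hRS r /andP[rr r1] p hp; have r0 : 0 < r by apply: le_lt_trans rr.
apply: (rate_cvg hp) => eta e0; last first.
  apply: tail_prob_upper => //; first by rewrite r0.
  by move=> r' /andP[r1' r2]; apply: hRS; rewrite r2 (lt_trans rr).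
have e2 : 0 < eta / 2 by rewrite divr_gt0.
have [t /andP[t0 tr] ht] : exists2 t : R, 0 < t < r & h t <= h r + eta / 2.
  have hr2 : 0 < r / 2 by rewrite divr_gt0.
  pose L := - ln (r / 2).
  have L0 : 0 < L by rewrite oppr_gt0 ln_lt0 // hr2; clear -r1 r0; lra.
  pose d := Num.min (r / 2) (eta / 2 / L).
  have d0 : 0 < d by rewrite lt_min hr2 divr_gt0.
  have d1 : d <= r / 2 by rewrite ge_min lexx.
  have d2 : d * L <= eta / 2 by rewrite -ler_pdivlMr // ge_min lexx orbT.
  have t0 : 0 < r - d by move: d1 r0; clear; lra.
  exists (r - d); first by rewrite t0 /=; move: d0; clear; lra.
  have := @h_ge_tangent _ r (r - d) t0 (ltW r0).
  have : ln (r / 2) <= ln (r - d).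
    by rewrite ler_ln ?posrE //; move: d1; clear; lra.
  move: d2 d0; rewrite /L; move: (h (r - d)) (h r) (ln (r - d)) (ln (r / 2)) (d); clear => a b c x w.
  by move=> ? ? ? ?; nra.
have := @tail_prob_lower p r (fun n _ => t) t (t ^+ ecount H) (h t) (eta / 2) hp r0 t0.
move=> /(_ _ _ _ _ e2) main; near=> n.
apply: (@le_trans _ _ (expR (- (rate_exponent p n * (h t + eta / 2))))).
  have q0 : 0 <= rate_exponent p n.
    by have [h01 _ _] := hp; have /andP[a _] := h01 n; rewrite !mulr_ge0 // invr_ge0.
  rewrite ler_expR lerN2 ler_wpM2l //.
  by move: ht; clear; lra.
near: n; apply: main.
- by move=> n s; rewrite lexx /=; move: tr r1; clear; lra.
- move=> n; rewrite /hom_wt (eq_bigr (fun _ : {ffun H -> 'I_n} => t ^+ ecount H)) => [|f _]; last first.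
    by rewrite prodr_const.
  by rewrite -(card_maps R H n) mulr_suml; apply: ler_sum => f _; rewrite mul1r.
- by rewrite ltr_pXn2r ?nnegrE ?(ltW t0) ?(ltW r0).
- move=> n; under eq_bigr do rewrite sumr_const card_ord.
  rewrite sumr_const card_ord -mulrnA -[X in X <= _]mulr_natl natrM -expr2.
  by rewrite lerDl.
Unshelve. all: by end_near. Qed.

(** Emptying the two parity classes gives the rate [- 1 / 2], up to errors, for
    every [r]; but [h (1 / 16) > 5 / 8]. *)
Lemma not_tight_nonbipartite : ~ bipartite H ->
  not_tight_below H (sparse_exponent R H) (1 / 16).
Proof.
move=> nb r /andP[r0 r16] p hp.
have hr : 5 / 8 < h r.
  have := @h_decr R r (1 / 16) (ltW r0) (ltW r16).
  have h16 : 11 / 16 <= h (1 / 16 : R).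
    have -> : h (1 / 16 : R) = 15 / 16 - 1 / 4 * ln 2.
      have -> : 1 / 16 = 2 ^- 4 :> R by field.
      by rewrite /h lnV ?posrE ?exprn_gt0 // lnXn //; move: (ln 2) => x; field.
    by have := ln2_le1; move: (ln 2); clear => x; lra.
  by move: h16; move: (h _) (h r); clear => a b; lra.
apply: (@lt_le_trans _ _ (- (5 / 8))%:E); first by rewrite lte_fin ltrN2.
apply: (liminf_rate_ge hp); near=> n.
have [n0 nK /andP[p0 pK] _] : [/\ (0 < n)%N, 32 <= n%:R :> R, 0 < p n <= 32^-1 &
     [/\ 32 <= n%:R * p n ^+ (2 * ecount H).+1, 32 <= n%:R * p n ^+ ecount H &
         32 <= n%:R * p n]] by near: n; exact: sparse_facts.
apply: le_trans (nonbipartite_lower _ nb _ _); last 2 first.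
- by rewrite p0; move: pK; clear; lra.
- by rewrite exprn_ge0 // mulr_ge0 // ltW.
rewrite ler_expR lerN2 /rate_exponent; move: nK p0 pK; move: (n%:R) (p n) => x y.
clear => h1 h2 h3.
have a1 : 0 <= x ^+ 2 + 2 by rewrite addr_ge0 // sqr_ge0.
have a2 : 34 <= 3 * x ^+ 2 by nra.
have a3 : (1 + 2 * y) * (x ^+ 2 + 2) <= 17 / 16 * (x ^+ 2 + 2).
  by rewrite ler_wpM2r //; lra.
by have := ler_wpM2l (ltW h2) a3; have := ler_wpM2l (ltW h2) a2; lra.
Unshelve. all: by end_near. Qed.

End TailBounds.

(** * Numerical bounds for logarithms *)

Section LogBounds.
Variable R : realType.
Implicit Types x y z : R.

Let L z : R := ln (1 + z) - ln (1 - z).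

Lemma is_derive_ln1D z : -1 < z -> is_derive z 1 (fun x => ln (1 + x)) (1 + z)^-1.
Proof.
move=> z1; have p1 : 0 < 1 + z by lra.
have dl := is_derive1_ln p1.
have da : is_derive z 1 (fun x => 1 + x) (1 : R).
  by apply: is_derive_eq; rewrite add0r mul1r.
have := @is_derive1_comp R (@ln R) (fun x => 1 + x) z (1 + z)^-1 1 dl da.
by rewrite mulr1.
Qed.

Lemma is_derive_ln1B z : z < 1 -> is_derive z 1 (fun x => ln (1 - x)) (- (1 - z)^-1).
Proof.
move=> z1; have p2 : 0 < 1 - z by lra.
have dl := is_derive1_ln p2.
have da : is_derive z 1 (fun x => 1 - x) (-1 : R).
  by apply: is_derive_eq; rewrite add0r mul1r.
have := @is_derive1_comp R (@ln R) (fun x => 1 - x) z (1 - z)^-1 (-1) dl da.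
by rewrite mulrN1.
Qed.

Lemma is_derive_logratio z : 0 <= z < 1 -> is_derive z 1 L (2 / (1 - z ^+ 2)).
Proof.
move=> /andP[z0 z1].
have p1 : 0 < 1 + z by lra.
have p2 : 0 < 1 - z by lra.
have z1' : -1 < z by lra.
have d1 := is_derive_ln1D z1'; have d2 := is_derive_ln1B z1.
rewrite /L; apply: is_derive_eq; rewrite opprK.
have -> : 1 - z ^+ 2 = (1 + z) * (1 - z) by ring.
have e1 : 1 + z != 0 by rewrite gt_eqF.
have e2 : 1 - z != 0 by rewrite gt_eqF.
by field; rewrite e1 e2.
Qed.

(** The coefficient 2/5 is that of the Taylor polynomial of [2 atanh] and yields a
    lower bound; 9/20 dominates the remainder up to 1/3. *)
Definition atanh_poly c z : R := 2 * z + 2 / 3 * z ^+ 3 + c * z ^+ 5.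

Lemma is_derive_atanh_poly c z : is_derive z 1 (atanh_poly c) (2 + 2 * z ^+ 2 + 5 * c * z ^+ 4).
Proof.
rewrite /atanh_poly; apply: is_derive_eq; rewrite /GRing.scale /=.
by field.
Qed.

Lemma mvt0 (f df : R -> R) z : 0 <= z < 1 -> f 0 = 0 ->
  (forall x, 0 <= x < 1 -> is_derive x 1 f (df x)) ->
  exists2 x, 0 <= x <= z & f z = df x * z.
Proof.
move=> /andP[z0 z1] f0 hf; have [y|y|y] := @MVT_segment R f df 0 z z0.
- rewrite in_itv /= => /andP[y0 yz]; apply: hf.
  by rewrite (ltW y0) (lt_trans yz).
- apply: derivable_within_continuous => x; rewrite in_itv /= => /andP[x0 xz].
  by apply: ex_derive; apply: hf; rewrite x0 (le_lt_trans xz).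
- by rewrite in_itv /= f0 !subr0 => h e; exists y.
Qed.

Lemma logratio_ge z : 0 <= z < 1 -> atanh_poly (2 / 5) z <= L z.
Proof.
move=> hz; have [|x hx|x /andP[x0 xz] h] :=
  @mvt0 (fun z => L z - atanh_poly (2 / 5) z)
    (fun z => 2 / (1 - z ^+ 2) - (2 + 2 * z ^+ 2 + 5 * (2 / 5) * z ^+ 4)) z hz.
- by rewrite /L /atanh_poly addr0 subr0; ring.
- have d1 := is_derive_logratio hx; have d2 := is_derive_atanh_poly (2 / 5) x.
  exact: is_deriveB.
rewrite -subr_ge0 h; have /andP[z0 z1] := hz; rewrite mulr_ge0 // subr_ge0.
have x1 : 0 < 1 - x ^+ 2 by clear -x0 xz z1; nra.
rewrite ler_pdivlMr //; have : 0 <= x ^+ 6 by rewrite exprn_ge0.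
by clear; move=> a; lra.
Qed.

Lemma logratio_le z : 0 <= z <= 1 / 3 -> L z <= atanh_poly (9 / 20) z.
Proof.
move=> hz; have hz1 : 0 <= z < 1 by lra.
have [|x hx|x /andP[x0 xz] h] :=
  @mvt0 (fun z => L z - atanh_poly (9 / 20) z)
    (fun z => 2 / (1 - z ^+ 2) - (2 + 2 * z ^+ 2 + 5 * (9 / 20) * z ^+ 4)) z hz1.
- by rewrite /L /atanh_poly addr0 subr0; ring.
- have d1 := is_derive_logratio hx; have d2 := is_derive_atanh_poly (9 / 20) x.
  exact: is_deriveB.
rewrite -subr_le0 h; have /andP[z0 z1] := hz; rewrite mulr_le0_ge0 // subr_le0.
have x1 : 0 < 1 - x ^+ 2 by clear -x0 xz z1; nra.
rewrite ler_pdivrMr //.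
have x2 : 0 <= 1 - 9 * x ^+ 2 by clear -x0 xz z1; nra.
have := mulr_ge0 (exprn_ge0 4 x0) x2.
by clear; move=> a; lra.
Qed.

(** With [y = a / b], this is [ln y = 2 atanh z] for [z = (y - 1) / (y + 1)]. *)
Lemma ln_bounds (a b : R) : 0 < b -> b <= a <= 2 * b ->
  atanh_poly (2 / 5) ((a - b) / (a + b)) <= ln a - ln b <=
  atanh_poly (9 / 20) ((a - b) / (a + b)).
Proof.
move=> b0 hab; set z := (a - b) / (a + b); have ab0 : 0 < a + b by lra.
have a0 : 0 < a by lra.
have hz : 0 <= z <= 1 / 3.
  apply/andP; split; first by apply: divr_ge0; lra.
  by rewrite ler_pdivrMr //; lra.
have -> : ln a - ln b = L z.
  have e : a + b != 0 by rewrite gt_eqF.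
  have la : ln a = ln (1 + z) + ln ((a + b) / 2).
    rewrite -lnM ?posrE ?divr_gt0 //; last by lra.
    by congr ln; rewrite /z; field.
  have lb : ln b = ln (1 - z) + ln ((a + b) / 2).
    rewrite -lnM ?posrE ?divr_gt0 //; last by lra.
    by congr ln; rewrite /z; field.
  by rewrite la lb /L; ring.
by rewrite logratio_le // logratio_ge //; lra.
Qed.

End LogBounds.

Section LogValues.
Variable R : realType.

Lemma ln_smooth (i j k : nat) :
  ln ((2 ^ i * 3 ^ j * 5 ^ k)%:R) = i%:R * ln 2 + j%:R * ln 3 + k%:R * ln 5 :> R.
Proof.
have p (m l : nat) : 0 < m.+1%:R ^+ l :> R by rewrite exprn_gt0.
rewrite !natrM !natrX lnM ?posrE ?mulr_gt0 ?p // lnM ?posrE ?p //.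
by rewrite !lnXn // -[_ *+ i]mulr_natl -[_ *+ j]mulr_natl -[_ *+ k]mulr_natl.
Qed.

Lemma ln_nat_div (m n : nat) : (0 < m)%N -> (0 < n)%N ->
  ln (m%:R / n%:R) = ln m%:R - ln n%:R :> R.
Proof. by move=> m0 n0; rewrite ln_div // posrE ltr0n. Qed.

(** Three relations between the logarithms of 2, 3 and 5, each from a quotient
    close to 1, determine all of them. *)
Lemma ln_235 : [/\ 69 / 10 ^+ 2 + 31 / 10 ^+ 4 + 47 / 10 ^+ 6 <= ln (2 : R) <=
    69 / 10 ^+ 2 + 31 / 10 ^+ 4 + 48 / 10 ^+ 6,
  1 + 9 / 10 ^+ 2 + 86 / 10 ^+ 4 + 12 / 10 ^+ 6 <= ln (3 : R) <=
    1 + 9 / 10 ^+ 2 + 86 / 10 ^+ 4 + 13 / 10 ^+ 6 &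
  1 + 60 / 10 ^+ 2 + 94 / 10 ^+ 4 + 37 / 10 ^+ 6 <= ln (5 : R) <=
    1 + 60 / 10 ^+ 2 + 94 / 10 ^+ 4 + 38 / 10 ^+ 6].
Proof.
have b1 : @atanh_poly R (2 / 5) (1 / 31) <= 4 * ln 2 - (ln 3 + ln 5) <= @atanh_poly R (9 / 20) (1 / 31).
  have := @ln_bounds R 16 15; rewrite (_ : (16 - 15) / (16 + 15) = 1 / 31); last by field.
  rewrite [ln 16](@ln_smooth 4 0 0) [ln 15](@ln_smooth 0 1 1) !mul0r !mul1r !addr0 add0r.
  by apply; lra.
have b2 : @atanh_poly R (2 / 5) (1 / 49) <= 2 * ln 5 - (3 * ln 2 + ln 3) <= @atanh_poly R (9 / 20) (1 / 49).
  have := @ln_bounds R 25 24; rewrite (_ : (25 - 24) / (25 + 24) = 1 / 49); last by field.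
  rewrite [ln 25](@ln_smooth 0 0 2) [ln 24](@ln_smooth 3 1 0) !mul0r !mul1r !addr0 !add0r.
  by apply; lra.
have b3 : @atanh_poly R (2 / 5) (1 / 161) <= 4 * ln 3 - (4 * ln 2 + ln 5) <= @atanh_poly R (9 / 20) (1 / 161).
  have := @ln_bounds R 81 80; rewrite (_ : (81 - 80) / (81 + 80) = 1 / 161); last by field.
  rewrite [ln 81](@ln_smooth 0 4 0) [ln 80](@ln_smooth 4 0 1) !mul0r !mul1r !addr0 !add0r.
  by apply; lra.
move: b1 b2 b3; rewrite /atanh_poly; move: (ln 2) (ln 3) (ln 5) => a b c.
by clear; move=> *; split; lra.
Qed.

End LogValues.

(** * Triangles: replica symmetry at 0.466 *)

Section TriangleValues.
Variable R : realType.
Implicit Types x y t : R.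

Lemma mul_neg_itv x y (a b c d : R) : - a <= x <= - b -> - c <= y <= - d ->
  0 <= b -> 0 <= d -> b * d <= x * y <= a * c.
Proof.
move=> /andP[ax xb] /andP[cy yd] b0 d0; rewrite -[x * y]mulrNN.
have bx : b <= - x by rewrite lerNr.
have dy : d <= - y by rewrite lerNr.
apply/andP; split; apply: ler_pM => //; try by rewrite lerNl.
  exact: le_trans bx.
exact: le_trans dy.
Qed.

(** The digits of the bounds below come in groups of two, which keeps the
    numerals small in the linear arithmetic. *)
Lemma ln_3_5_itv :
  - (51 / 10 ^+ 2 + 9 / 10 ^+ 4) <= ln (3 / 5 : R) <= - (51 / 10 ^+ 2 + 8 / 10 ^+ 4).
Proof.
rewrite (@ln_nat_div R 3 5) // [ln 3](@ln_smooth R 0 1 0) [ln 5](@ln_smooth R 0 0 1).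
have [l2 l3 l5] := ln_235 R; move: (ln 2) (ln 3) (ln 5) l2 l3 l5.
by clear => x y z *; lra.
Qed.

Lemma ln_4_5_itv :
  - (22 / 10 ^+ 2 + 32 / 10 ^+ 4) <= ln (4 / 5 : R) <= - (22 / 10 ^+ 2 + 31 / 10 ^+ 4).
Proof.
rewrite (@ln_nat_div R 4 5) // [ln 4](@ln_smooth R 2 0 0) [ln 5](@ln_smooth R 0 0 1).
have [l2 l3 l5] := ln_235 R; move: (ln 2) (ln 3) (ln 5) l2 l3 l5.
by clear => x y z *; lra.
Qed.

Lemma ln_9_10_itv :
  - (10 / 10 ^+ 2 + 54 / 10 ^+ 4) <= ln (9 / 10 : R) <= - (10 / 10 ^+ 2 + 53 / 10 ^+ 4).
Proof.
rewrite (@ln_nat_div R 9 10) // [ln 9](@ln_smooth R 0 2 0) [ln 10](@ln_smooth R 1 0 1).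
have [l2 l3 l5] := ln_235 R; move: (ln 2) (ln 3) (ln 5) l2 l3 l5.
by clear => x y z *; lra.
Qed.

Lemma ln_1_4_itv :
  - (1 + 38 / 10 ^+ 2 + 63 / 10 ^+ 4) <= ln (1 / 4 : R) <= - (1 + 38 / 10 ^+ 2 + 62 / 10 ^+ 4).
Proof.
rewrite (@ln_nat_div R 1 4) // [ln 1](@ln_smooth R 0 0 0) [ln 4](@ln_smooth R 2 0 0).
have [l2 l3 l5] := ln_235 R; move: (ln 2) (ln 3) (ln 5) l2 l3 l5.
by clear => x y z *; lra.
Qed.

Lemma ln_3_25_itv :
  - (2 + 12 / 10 ^+ 2 + 3 / 10 ^+ 4) <= ln (3 / 25 : R) <= - (2 + 12 / 10 ^+ 2 + 2 / 10 ^+ 4).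
Proof.
rewrite (@ln_nat_div R 3 25) // [ln 3](@ln_smooth R 0 1 0) [ln 25](@ln_smooth R 0 0 2).
have [l2 l3 l5] := ln_235 R; move: (ln 2) (ln 3) (ln 5) l2 l3 l5.
by clear => x y z *; lra.
Qed.

Lemma ln_9_100_itv :
  - (2 + 40 / 10 ^+ 2 + 80 / 10 ^+ 4) <= ln (9 / 100 : R) <= - (2 + 40 / 10 ^+ 2 + 79 / 10 ^+ 4).
Proof.
rewrite (@ln_nat_div R 9 100) // [ln 9](@ln_smooth R 0 2 0) [ln 100](@ln_smooth R 2 0 2).
have [l2 l3 l5] := ln_235 R; move: (ln 2) (ln 3) (ln 5) l2 l3 l5.
by clear => x y z *; lra.
Qed.

Lemma ln_3_100_itv :
  - (3 + 50 / 10 ^+ 2 + 66 / 10 ^+ 4) <= ln (3 / 100 : R) <= - (3 + 50 / 10 ^+ 2 + 65 / 10 ^+ 4).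
Proof.
rewrite (@ln_nat_div R 3 100) // [ln 3](@ln_smooth R 0 1 0) [ln 100](@ln_smooth R 2 0 2).
have [l2 l3 l5] := ln_235 R; move: (ln 2) (ln 3) (ln 5) l2 l3 l5.
by clear => x y z *; lra.
Qed.

Lemma ln_1_100_itv :
  - (4 + 60 / 10 ^+ 2 + 52 / 10 ^+ 4) <= ln (1 / 100 : R) <= - (4 + 60 / 10 ^+ 2 + 51 / 10 ^+ 4).
Proof.
rewrite (@ln_nat_div R 1 100) // [ln 1](@ln_smooth R 0 0 0) [ln 100](@ln_smooth R 2 0 2).
have [l2 l3 l5] := ln_235 R; move: (ln 2) (ln 3) (ln 5) l2 l3 l5.
by clear => x y z *; lra.
Qed.

Lemma ln_32_625_itv :
  - (2 + 97 / 10 ^+ 2 + 21 / 10 ^+ 4) <= ln (32 / 625 : R) <= - (2 + 97 / 10 ^+ 2 + 20 / 10 ^+ 4).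
Proof.
rewrite (@ln_nat_div R 32 625) // [ln 32](@ln_smooth R 5 0 0) [ln 625](@ln_smooth R 0 0 4).
have [l2 l3 l5] := ln_235 R; move: (ln 2) (ln 3) (ln 5) l2 l3 l5.
by clear => x y z *; lra.
Qed.

Lemma ln_233_500_itv :
  - (76 / 10 ^+ 2 + 36 / 10 ^+ 4) <= ln (233 / 500 : R) <= - (76 / 10 ^+ 2 + 35 / 10 ^+ 4).
Proof.
rewrite (@ln_nat_div R 233 500) // [ln 500](@ln_smooth R 2 0 3).
have := @ln_bounds R 240 233; rewrite (_ : (240 - 233) / (240 + 233) = 7 / 473); last by field.
rewrite [ln 240](@ln_smooth R 4 1 1) => /(_ _ _) hb.
have {hb} : @atanh_poly R (2 / 5) (7 / 473) <=
    4 * ln 2 + 1 * ln 3 + 1 * ln 5 - ln 233 <= @atanh_poly R (9 / 20) (7 / 473).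
  by apply: hb; lra.
have [l2 l3 l5] := ln_235 R; move: l2 l3 l5; rewrite /atanh_poly.
by move: (ln 2) (ln 3) (ln 5) (ln 233); clear => a b c d *; lra.
Qed.

(** For weights above 1/4 the tangent at the density itself suffices. *)
Lemma triangle_case_near (a : R) : 1 / 4 <= a ->
  hl (xlnx (233 / 500)) (233 / 500) <= hl (xlnx (233 / 500)) a.
Proof.
have lr := ln_233_500_itv; have lb := ln_1_4_itv.
move=> ha; apply: (hl_ge _ _ _ ha); try (clear -lr; lra).
have m1 := mul_neg_itv lr lb ltac:(clear; lra) ltac:(clear; lra).
have m2 := mul_neg_itv lr lr ltac:(clear; lra) ltac:(clear; lra).
rewrite /hl /xlnx /h; move: lr lb m1 m2; move: (ln (233 / 500)) (ln (1 / 4)) => x y.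
by clear; lra.
Qed.

(** The three following lemmas collect the numerical hypotheses of
    [triangle_case_tangent] for the points of tangency 3/5, 4/5 and 9/10 of the
    two larger weights; at [P0] the tangent to the logarithm of the
    product is taken. *)
Lemma triangle_values_3_5 (t := 3 / 5 : R) (b1 := 3 / 25 : R)
    (b2 := 1 / 4 : R) (P0 := 9 / 100 : R) (m := - (26 / 10 ^+ 3) : R) (c := xlnx t) :
  [/\ [/\ -1 <= ln t, ln b2 <= -1 &
           0 <= - c <= - ln (233 / 500) * (500 / 233) ^+ 2 * P0],
      hl c t <= hl c b1, m <= hl c b1, m <= hl c b2 &
      89 / 10 ^+ 2 + 5 / 10 ^+ 4 <= 2 * hl c t + m - c * (1 - ln P0)].
Proof.
rewrite /c /hl /xlnx /h /t /b1 /b2 /P0 /m {t b1 b2 P0 m c}.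
have x := ln_3_5_itv; have y := ln_3_25_itv; have z := ln_1_4_itv.
have w := ln_9_100_itv; have v := ln_233_500_itv.
have xy := mul_neg_itv x y ltac:(clear; lra) ltac:(clear; lra).
have xz := mul_neg_itv x z ltac:(clear; lra) ltac:(clear; lra).
have xx := mul_neg_itv x x ltac:(clear; lra) ltac:(clear; lra).
have xw := mul_neg_itv x w ltac:(clear; lra) ltac:(clear; lra).
move: x y z v w xy xz xx xw; move: (ln (3 / 5)) (ln (3 / 25)) (ln (1 / 4)) (ln (9 / 100)) (ln (233 / 500)).
clear => x y z w v *; split; [split|..]; try lra.
Qed.

Lemma triangle_values_4_5 (t := 4 / 5 : R) (b1 := 3 / 100 : R)
    (b2 := 3 / 25 : R) (P0 := 32 / 625 : R) (m := 228 / 10 ^+ 3 : R) (c := xlnx t) :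
  [/\ [/\ -1 <= ln t, ln b2 <= -1 &
           0 <= - c <= - ln (233 / 500) * (500 / 233) ^+ 2 * P0],
      hl c t <= hl c b1, m <= hl c b1, m <= hl c b2 &
      89 / 10 ^+ 2 + 5 / 10 ^+ 4 <= 2 * hl c t + m - c * (1 - ln P0)].
Proof.
rewrite /c /hl /xlnx /h /t /b1 /b2 /P0 /m {t b1 b2 P0 m c}.
have x := ln_4_5_itv; have y := ln_3_100_itv; have z := ln_3_25_itv.
have w := ln_32_625_itv; have v := ln_233_500_itv.
have xy := mul_neg_itv x y ltac:(clear; lra) ltac:(clear; lra).
have xz := mul_neg_itv x z ltac:(clear; lra) ltac:(clear; lra).
have xx := mul_neg_itv x x ltac:(clear; lra) ltac:(clear; lra).
have xw := mul_neg_itv x w ltac:(clear; lra) ltac:(clear; lra).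
move: x y z v w xy xz xx xw; move: (ln (4 / 5)) (ln (3 / 100)) (ln (3 / 25)) (ln (32 / 625)) (ln (233 / 500)).
clear => x y z w v *; split; [split|..]; try lra.
Qed.

Lemma triangle_values_9_10 (t := 9 / 10 : R) (b1 := 1 / 100 : R)
    (b2 := 3 / 100 : R) (P0 := 3 / 100 : R) (m := 49 / 10 ^+ 2 : R) (c := xlnx t) :
  [/\ [/\ -1 <= ln t, ln b2 <= -1 &
           0 <= - c <= - ln (233 / 500) * (500 / 233) ^+ 2 * P0],
      hl c t <= hl c b1, m <= hl c b1, m <= hl c b2 &
      89 / 10 ^+ 2 + 5 / 10 ^+ 4 <= 2 * hl c t + m - c * (1 - ln P0)].
Proof.
rewrite /c /hl /xlnx /h /t /b1 /b2 /P0 /m {t b1 b2 P0 m c}.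
have x := ln_9_10_itv; have y := ln_1_100_itv; have z := ln_3_100_itv.
have v := ln_233_500_itv.
have xy := mul_neg_itv x y ltac:(clear; lra) ltac:(clear; lra).
have xz := mul_neg_itv x z ltac:(clear; lra) ltac:(clear; lra).
have xx := mul_neg_itv x x ltac:(clear; lra) ltac:(clear; lra).
move: x y z v xy xz xx; move: (ln (9 / 10)) (ln (1 / 100)) (ln (3 / 100)) (ln (233 / 500)).
clear => x y z v *; split; [split|..]; try lra.
Qed.

(** A minimal weight in [[b1, b2]]: the tangent at [t] for the others, and
    quasi-concavity of [hl] for the minimal one. *)
Lemma triangle_case_tangent (I : finType) (S : {set I}) (a : I -> R) e0
    (t P0 b1 b2 m kap C : R) :
  #|S| = 3%N -> e0 \in S -> b1 <= a e0 <= b2 -> (forall e, e \in S -> b1 <= a e) ->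
  0 < t -> -1 <= ln t -> 0 < b1 -> b2 <= t -> ln b2 <= -1 -> 0 < P0 ->
  0 <= - xlnx t <= kap * P0 ->
  hl (xlnx t) t <= hl (xlnx t) b1 -> m <= hl (xlnx t) b1 -> m <= hl (xlnx t) b2 ->
  C <= 2 * hl (xlnx t) t + m - xlnx t * (1 - ln P0) ->
  C <= \sum_(e in S) h (a e) + kap * \prod_(e in S) a e.
Proof.
move=> S3 e0S hae ha t0 lt b10 b2t lb2 P00 hk hb1 mb1 mb2 hC.
have /andP[b1a ab2] := hae.
apply: (le_trans hC); apply: (le_trans _ (sum_h_prod_ge _ P00 hk)); last first.
  by move=> e /ha; apply: lt_le_trans.
rewrite opprK mulNr lerD2r (bigD1 e0) //= [_ + m]addrC; apply: lerD.
  by apply: (hl_quasiconcave b10 hae) => //; right.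
apply: (@le_trans _ _ (\sum_(e in S | e != e0) hl (xlnx t) t)).
  rewrite sumr_const (_ : #|_| = 2%N) ?mulr_natl //.
  rewrite -[2%N]/(3%N.-1) -S3 (cardsD1 e0) e0S /= -[RHS]addn0 addn0.
  by apply: eq_card => e; rewrite !inE andbC.
apply: ler_sum => e /andP[eS _]; apply: (hl_ge t0 lt b10) => //; first exact: ha.
exact: le_trans (le_trans b1a ab2) b2t.
Qed.

End TriangleValues.

Section TriangleRS.
Variables (R : realType) (H : sgraph).

(** The pointwise inequality for three weights, by the size of the smallest
    one: below 1/100 its entropy alone suffices, otherwise tangents in
    logarithmic coordinates apply. *)
Lemma replica_symmetric_triangle :
  ecount H = 3%N -> replica_symmetric H (233 / 500 : R).
Proof.
move=> eH; pose r : R := 233 / 500; pose kap : R := - ln r / r ^+ 2.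
have lr := ln_233_500_itv R.
have kapE : kap = - ln (233 / 500) * (500 / 233) ^+ 2.
  by rewrite /kap /r; congr (_ * _); field.
have kap0 : 0 <= kap by rewrite kapE; move: lr; clear; lra.
pose C : R := 3 * h r - r * ln r.
have CE : 3 * h r + kap * r ^+ 3 = C by rewrite kapE /C /r; field.
have C89 : C <= 89 / 10 ^+ 2 + 5 / 10 ^+ 4.
  rewrite /C /h /r; move: lr; move: (ln _) => x; clear; lra.
apply: (@replica_symmetric_pointwise R H (233 / 500) kap); rewrite ?eH // => a ha.
rewrite -[233 / 500]/r CE.
have S3 : #|edges H| = 3%N by rewrite -/(ecount H) eH.
have Pge : 0 <= kap * \prod_(e in edges H) a e.
  by rewrite mulr_ge0 // prodr_ge0 // => e _; have /andP[] := ha e.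
have hge (e : {set H}) : 0 <= h (a e) by apply: h_ge0; have /andP[] := ha e.
have [e1 e1S] : exists e1, e1 \in edges H by apply/set0Pn; rewrite -card_gt0 S3.
have [e0 e0S hmin] := @Order.TotalTheory.arg_minP _ R _ e1 (mem (edges H)) a e1S.
have [c4|c4] := leP (1 / 4) (a e0).
  have hk : 0 <= - xlnx r <= kap * r ^+ 3.
    rewrite /xlnx -mulrN kapE /r; move: lr; move: (ln _) => x; clear => h1.
    by apply/andP; split; lra.
  have r3 : 0 < r ^+ 3 by rewrite exprn_gt0 // /r; clear; lra.
  apply: (@le_trans _ _ _ _ _ _ (sum_h_prod_ge _ r3 hk)); last first.
    by move=> e eS; apply: lt_le_trans (hmin e eS); apply: lt_le_trans c4; clear; lra.
  rewrite opprK; apply: (@le_trans _ _ (\sum_(e in edges H) hl (xlnx r) r +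
      - xlnx r * (1 - ln (r ^+ 3)))); last first.
    rewrite lerD2r; apply: ler_sum => e eS; apply: triangle_case_near.
    exact: le_trans (hmin e eS).
  rewrite sumr_const S3 lnXn; last by rewrite /r; clear; lra.
  by rewrite /C /hl /xlnx; move: (ln r) (h r) (r); clear => x y z; lra.
have [hlo|c12] := leP (3 / 25) (a e0).
  have [[lt lb hk] hb m1 m2 hC] := triangle_values_3_5 R; rewrite -kapE in hk.
  apply: (triangle_case_tangent S3 e0S _ _ _ lt _ _ lb _ hk hb m1 m2 (le_trans C89 hC)).
  - by rewrite hlo ltW.
  - by move=> e eS; apply: le_trans (hmin e eS).
  all: try by clear; lra.
have [hlo|c3] := leP (3 / 100) (a e0).
  have [[lt lb hk] hb m1 m2 hC] := triangle_values_4_5 R; rewrite -kapE in hk.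
  apply: (triangle_case_tangent S3 e0S _ _ _ lt _ _ lb _ hk hb m1 m2 (le_trans C89 hC)).
  - by rewrite hlo ltW.
  - by move=> e eS; apply: le_trans (hmin e eS).
  all: try by clear; lra.
have [hlo|c1] := leP (1 / 100) (a e0).
  have [[lt lb hk] hb m1 m2 hC] := triangle_values_9_10 R; rewrite -kapE in hk.
  apply: (triangle_case_tangent S3 e0S _ _ _ lt _ _ lb _ hk hb m1 m2 (le_trans C89 hC)).
  - by rewrite hlo ltW.
  - by move=> e eS; apply: le_trans (hmin e eS).
  all: try by clear; lra.
have h100 : C <= h (1 / 100).
  apply: (le_trans C89); rewrite /h; have := ln_1_100_itv R.
  by move: (ln (1 / 100)); clear => x; lra.
have := @h_decr R (a e0) (1 / 100); have /andP[a0 _] := ha e0.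
move=> /(_ a0 (ltW c1)) hd; apply: (le_trans h100).
apply: (@le_trans _ _ (h (a e0))); first by apply: hd; clear; lra.
rewrite (bigD1 e0) //= -addrA lerDl addr_ge0 //.
by apply: sumr_ge0 => e _.
Qed.
End TriangleRS.

(** * The two-block competitor for triangles *)

Section MoreLogValues.
Variable R : realType.
Implicit Types x y t : R.

Lemma ln_smooth7 (i j k l : nat) :
  ln ((2 ^ i * 3 ^ j * 5 ^ k * 7 ^ l)%:R) =
  i%:R * ln 2 + j%:R * ln 3 + k%:R * ln 5 + l%:R * ln 7 :> R.
Proof.
have p (m : nat) : 0 < (7 ^ m)%:R :> R by rewrite ltr0n expn_gt0.
have p2 : 0 < (2 ^ i * 3 ^ j * 5 ^ k)%:R :> R.
  by rewrite ltr0n !muln_gt0 !expn_gt0.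
rewrite natrM lnM ?posrE ?p // ln_smooth.
by rewrite natrX lnXn // -[_ *+ l]mulr_natl.
Qed.

Lemma ln_7_itv :
  1 + 94 / 10 ^+ 2 + 59 / 10 ^+ 4 + 8 / 10 ^+ 6 <= ln (7 : R) <=
  1 + 94 / 10 ^+ 2 + 59 / 10 ^+ 4 + 12 / 10 ^+ 6.
Proof.
have := @ln_bounds R 50 49; rewrite (_ : (50 - 49) / (50 + 49) = 1 / 99); last by field.
rewrite [ln 50](@ln_smooth7 1 0 2 0) [ln 49](@ln_smooth7 0 0 0 2) => /(_ _ _) hb.
have {hb} : @atanh_poly R (2 / 5) (1 / 99) <=
    1 * ln 2 + 0 * ln 3 + 2 * ln 5 + 0 * ln 7 - (0 * ln 2 + 0 * ln 3 + 0 * ln 5 + 2 * ln 7)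
    <= @atanh_poly R (9 / 20) (1 / 99).
  by apply: hb; lra.
have [l2 l3 l5] := ln_235 R; move: l2 l3 l5; rewrite /atanh_poly.
by move: (ln 2) (ln 3) (ln 5) (ln 7); clear => a b c d *; lra.
Qed.

Lemma ln_33_2000_itv :
  - (4 + 10 / 10 ^+ 2 + 44 / 10 ^+ 4 + 5 / 10 ^+ 6) <= ln (33 / 2000 : R) <=
  - (4 + 10 / 10 ^+ 2 + 43 / 10 ^+ 4 + 90 / 10 ^+ 6).
Proof.
rewrite (@ln_nat_div _ 33 2000) // [ln 2000](@ln_smooth7 4 0 3 0).
have := @ln_bounds R 33 32; rewrite (_ : (33 - 32) / (33 + 32) = 1 / 65); last by field.
rewrite [ln 32](@ln_smooth7 5 0 0 0) => /(_ _ _) hb.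
have {hb} : @atanh_poly R (2 / 5) (1 / 65) <=
    ln 33 - (5 * ln 2 + 0 * ln 3 + 0 * ln 5 + 0 * ln 7) <= @atanh_poly R (9 / 20) (1 / 65).
  by apply: hb; lra.
have [l2 l3 l5] := ln_235 R; move: l2 l3 l5; rewrite /atanh_poly.
by move: (ln 2) (ln 3) (ln 5) (ln 7) (ln 33); clear => a b c d e *; lra.
Qed.

Lemma ln_209_1000_itv :
  - (1 + 56 / 10 ^+ 2 + 54 / 10 ^+ 4 + 40 / 10 ^+ 6) <= ln (209 / 1000 : R) <=
  - (1 + 56 / 10 ^+ 2 + 54 / 10 ^+ 4 + 10 / 10 ^+ 6).
Proof.
rewrite (@ln_nat_div _ 209 1000) // [ln 1000](@ln_smooth7 3 0 3 0).
have := @ln_bounds R 210 209; rewrite (_ : (210 - 209) / (210 + 209) = 1 / 419); last by field.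
rewrite [ln 210](@ln_smooth7 1 1 1 1) => /(_ _ _) hb.
have {hb} : @atanh_poly R (2 / 5) (1 / 419) <=
    1 * ln 2 + 1 * ln 3 + 1 * ln 5 + 1 * ln 7 - ln 209 <= @atanh_poly R (9 / 20) (1 / 419).
  by apply: hb; lra.
have [l2 l3 l5] := ln_235 R; have l7 := ln_7_itv; move: l2 l3 l5 l7; rewrite /atanh_poly.
by move: (ln 2) (ln 3) (ln 5) (ln 7) (ln 209); clear => a b c d e *; lra.
Qed.

Lemma ln_21_100_itv :
  - (1 + 56 / 10 ^+ 2 + 6 / 10 ^+ 4 + 52 / 10 ^+ 6) <= ln (21 / 100 : R) <=
  - (1 + 56 / 10 ^+ 2 + 6 / 10 ^+ 4 + 43 / 10 ^+ 6).
Proof.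
rewrite (@ln_nat_div _ 21 100) // [ln 21](@ln_smooth7 0 1 0 1) [ln 100](@ln_smooth7 2 0 2 0).
have [l2 l3 l5] := ln_235 R; have l7 := ln_7_itv.
move: (ln 2) (ln 3) (ln 5) (ln 7) l2 l3 l5 l7.
by clear => x y z w *; lra.
Qed.

Lemma ln_1_70_itv :
  - (4 + 24 / 10 ^+ 2 + 84 / 10 ^+ 4 + 98 / 10 ^+ 6) <= ln (1 / 70 : R) <=
  - (4 + 24 / 10 ^+ 2 + 84 / 10 ^+ 4 + 92 / 10 ^+ 6).
Proof.
rewrite (@ln_nat_div _ 1 70) // [ln 1](@ln_smooth7 0 0 0 0) [ln 70](@ln_smooth7 1 0 1 1).
have [l2 l3 l5] := ln_235 R; have l7 := ln_7_itv.
move: (ln 2) (ln 3) (ln 5) (ln 7) l2 l3 l5 l7.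
by clear => x y z w *; lra.
Qed.

Lemma ln_9_500_itv :
  - (4 + 1 / 10 ^+ 2 + 73 / 10 ^+ 4 + 86 / 10 ^+ 6) <= ln (9 / 500 : R) <=
  - (4 + 1 / 10 ^+ 2 + 73 / 10 ^+ 4 + 79 / 10 ^+ 6).
Proof.
rewrite (@ln_nat_div _ 9 500) // [ln 9](@ln_smooth7 0 2 0 0) [ln 500](@ln_smooth7 2 0 3 0).
have [l2 l3 l5] := ln_235 R; have l7 := ln_7_itv.
move: (ln 2) (ln 3) (ln 5) (ln 7) l2 l3 l5 l7.
by clear => x y z w *; lra.
Qed.

Lemma ln_1_40_itv :
  - (3 + 68 / 10 ^+ 2 + 88 / 10 ^+ 4 + 82 / 10 ^+ 6) <= ln (1 / 40 : R) <=
  - (3 + 68 / 10 ^+ 2 + 88 / 10 ^+ 4 + 78 / 10 ^+ 6).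
Proof.
rewrite (@ln_nat_div _ 1 40) // [ln 1](@ln_smooth7 0 0 0 0) [ln 40](@ln_smooth7 3 0 1 0).
have [l2 l3 l5] := ln_235 R; have l7 := ln_7_itv.
move: (ln 2) (ln 3) (ln 5) (ln 7) l2 l3 l5 l7.
by clear => x y z w *; lra.
Qed.

Lemma ln_3_50_itv :
  - (2 + 81 / 10 ^+ 2 + 34 / 10 ^+ 4 + 12 / 10 ^+ 6) <= ln (3 / 50 : R) <=
  - (2 + 81 / 10 ^+ 2 + 34 / 10 ^+ 4 + 8 / 10 ^+ 6).
Proof.
rewrite (@ln_nat_div _ 3 50) // [ln 3](@ln_smooth7 0 1 0 0) [ln 50](@ln_smooth7 1 0 2 0).
have [l2 l3 l5] := ln_235 R; have l7 := ln_7_itv.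
move: (ln 2) (ln 3) (ln 5) (ln 7) l2 l3 l5 l7.
by clear => x y z w *; lra.
Qed.

Lemma ln_6_7_itv :
  - (15 / 10 ^+ 2 + 41 / 10 ^+ 4 + 53 / 10 ^+ 6) <= ln (6 / 7 : R) <=
  - (15 / 10 ^+ 2 + 41 / 10 ^+ 4 + 47 / 10 ^+ 6).
Proof.
rewrite (@ln_nat_div _ 6 7) // [ln 6](@ln_smooth7 1 1 0 0) [ln 7](@ln_smooth7 0 0 0 1).
have [l2 l3 l5] := ln_235 R; have l7 := ln_7_itv.
move: (ln 2) (ln 3) (ln 5) (ln 7) l2 l3 l5 l7.
by clear => x y z w *; lra.
Qed.

Lemma ln_2_3_itv :
  - (40 / 10 ^+ 2 + 54 / 10 ^+ 4 + 66 / 10 ^+ 6) <= ln (2 / 3 : R) <=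
  - (40 / 10 ^+ 2 + 54 / 10 ^+ 4 + 64 / 10 ^+ 6).
Proof.
rewrite (@ln_nat_div _ 2 3) // [ln 2](@ln_smooth7 1 0 0 0) [ln 3](@ln_smooth7 0 1 0 0).
have [l2 l3 l5] := ln_235 R; have l7 := ln_7_itv.
move: (ln 2) (ln 3) (ln 5) (ln 7) l2 l3 l5 l7.
by clear => x y z w *; lra.
Qed.

End MoreLogValues.

Section Shape.
Variable R : realType.
Implicit Types r x y a : R.

(** Two equal blocks with weight [r * a] inside and [r * coweight a] across have
    triangle density [r^3]; call [a] the shape of the pair. *)
Definition coweight a : R := partner 1 a.

Definition shape_mean a := (a + coweight a) / 2.
Definition shape_dev a := (coweight a - a) / 2.
Definition shape_ent a := (xlnx a + xlnx (coweight a)) / 2.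

(** This is [f_tri r (r * a) / r].  It is affine in [ln r] with a positive
    coefficient, so a shape loses to the constant above some density level. *)
Definition shape_gap r a := shape_ent a + (shape_mean a - 1) * (ln r - 1).

Lemma shape_arg a : 0 < a < 1 -> 1 < (4 - a ^+ 3) / (3 * a).
Proof.
move=> /andP[a0 a1]; rewrite ltr_pdivlMr ?mulr_gt0 // mul1r.
have : 0 < (1 - a) * (a ^+ 2 + a + 4).
  by rewrite mulr_gt0 ?subr_gt0 // !addr_gt0 // exprn_gt0.
by clear; lra.
Qed.

Lemma shapeE a : coweight a = Num.sqrt ((4 - a ^+ 3) / (3 * a)).
Proof. by rewrite /coweight /partner expr1n mulr1. Qed.

Lemma shape_sqr a : 0 < a < 1 -> coweight a ^+ 2 = (4 - a ^+ 3) / (3 * a).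
Proof. by move=> ha; rewrite shapeE sqr_sqrtr // ltW // (lt_trans ltr01) ?shape_arg. Qed.

Lemma shape_gt1 a : 0 < a < 1 -> 1 < coweight a.
Proof.
move=> ha; rewrite shapeE -[X in X < _]sqrtr1 ltr_sqrt ?shape_arg //.
exact: lt_trans (shape_arg ha).
Qed.

Lemma shape_eq a : 0 < a < 1 -> a ^+ 3 + 3 * a * coweight a ^+ 2 = 4.
Proof.
move=> ha; rewrite shape_sqr //; have /andP[a0 _] := ha.
by field; rewrite gt_eqF.
Qed.

Lemma partner_scale r a : 0 < r -> partner r (r * a) = r * coweight a.
Proof.
move=> r0; rewrite shapeE /partner.
rewrite -[X in _ = X * _](ger0_norm (ltW r0)) -sqrtr_sqr -sqrtrM ?sqr_ge0 //.
congr Num.sqrt; rewrite exprMn.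
have [->|a0] := eqVneq a 0; first by rewrite !mulr0 invr0 !mulr0.
by field; rewrite a0 gt_eqF.
Qed.

Lemma f_tri_shape r a : 0 < r -> 0 < a < 1 ->
  f_tri r (r * a) = r * shape_gap r a.
Proof.
move=> r0 ha; have /andP[a0 _] := ha; have b0 := lt_trans ltr01 (shape_gt1 ha).
rewrite /f_tri partner_scale // /shape_gap /shape_ent /shape_mean /xlnx /h.
rewrite !lnM ?posrE //; move: (ln r) (ln a) (coweight a) (ln (coweight a)).
by clear => lr la b lb; field.
Qed.

Lemma shape_cube a : 0 < a < 1 -> shape_mean a ^+ 3 = 1 + shape_dev a ^+ 3.
Proof.
move=> ha; have := shape_eq ha; rewrite /shape_mean /shape_dev.
by move: (coweight a) => b; clear; lra.
Qed.

Lemma shape_dev_gt0 a : 0 < a < 1 -> 0 < shape_dev a.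
Proof.
move=> ha; have := shape_gt1 ha; rewrite /shape_dev; have /andP[_ a1] := ha.
by move: (coweight a) a1 => b; clear; lra.
Qed.

Lemma shape_mean_gt1 a : 0 < a < 1 -> 1 < shape_mean a.
Proof.
move=> ha; have := shape_cube ha; have := exprn_gt0 3 (shape_dev_gt0 ha).
have m0 : 0 < shape_mean a.
  have := shape_gt1 ha; have /andP[a0 _] := ha; rewrite /shape_mean.
  by move: (coweight a) a0 => b; clear; lra.
move: (shape_mean a) (shape_dev a ^+ 3) m0 => m d; clear => m0 d0 e.
rewrite ltNge; apply/negP => m1; nra.
Qed.

Lemma f_tri_gap_sg r a : 0 < r -> 0 < a < 1 ->
  [/\ (f_tri r (r * a) = 0) <-> (shape_gap r a = 0),
      (f_tri r (r * a) < 0) = (shape_gap r a < 0) &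
      (0 < f_tri r (r * a)) = (0 < shape_gap r a)].
Proof.
move=> r0 ha; rewrite f_tri_shape // pmulr_rlt0 // pmulr_rgt0 //; split=> //.
split=> [/eqP|->]; last by rewrite mulr0.
by rewrite mulf_eq0 gt_eqF //= => /eqP.
Qed.

Definition shape_level a := expR (1 - shape_ent a / (shape_mean a - 1)).

Lemma shape_gap_lt r a : 0 < r -> 0 < a < 1 ->
  (shape_gap r a < 0) = (r < shape_level a).
Proof.
move=> r0 ha; have m0 : 0 < shape_mean a - 1 by rewrite subr_gt0 shape_mean_gt1.
rewrite -{2}[r]lnK ?posrE // /shape_level ltr_expR ltrBrDl -ltrBrDr.
rewrite ltr_pdivrMr // /shape_gap -[1 - ln r]opprB mulNr -[RHS]subr_gt0.
by rewrite -[LHS]oppr_gt0 opprD addrC mulrC.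
Qed.

Lemma shape_gap0 r a : 0 < r -> 0 < a < 1 ->
  (shape_gap r a = 0) <-> (r = shape_level a).
Proof.
move=> r0 ha; have m0 : 0 < shape_mean a - 1 by rewrite subr_gt0 shape_mean_gt1.
have mn : shape_mean a - 1 != 0 by rewrite gt_eqF.
rewrite /shape_level /shape_gap; split=> [h|->].
  rewrite -{1}[r]lnK ?posrE //; congr expR.
  have : (shape_mean a - 1) * (ln r - 1 + shape_ent a / (shape_mean a - 1)) = 0.
    by rewrite mulrDr mulrCA divff // mulr1 addrC.
  by move/eqP; rewrite mulf_eq0 (negbTE mn) /= => /eqP; move: (_ / _) => z; clear; lra.
by rewrite expRK; move: mn; move: (shape_mean a - 1) (shape_ent a) => z w; clear => z0; field.
Qed.

Lemma xlnx_pair_ge (e : R) : 0 <= e < 1 -> e ^+ 2 <= xlnx (1 + e) + xlnx (1 - e).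
Proof.
move=> he; have [|z hz|z /andP[z0 ze] h] :=
  @mvt0 R (fun z => xlnx (1 + z) + xlnx (1 - z) - z ^+ 2)
    (fun z => ln (1 + z) - ln (1 - z) - 2 * z) e he.
- by rewrite /xlnx addr0 subr0 ln1; ring.
- have /andP[z0 z1] := hz.
  have p1 : 0 < 1 + z by clear -z0; lra.
  have p2 : 0 < 1 - z by clear -z1; lra.
  have z1' : -1 < z by clear -z0; lra.
  have d1 := is_derive_ln1D z1'; have d2 := is_derive_ln1B z1.
  rewrite /xlnx; apply: is_derive_eq; rewrite /GRing.scale /=.
  by field; rewrite !gt_eqF.
rewrite -subr_ge0 h; have /andP[e0 e1] := he; rewrite mulr_ge0 // subr_ge0.
have hz : 0 <= z < 1 by rewrite z0 (le_lt_trans ze).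
apply: le_trans (logratio_ge hz); rewrite /atanh_poly -addrA lerDl addr_ge0 //.
  by rewrite mulr_ge0 ?exprn_ge0 // divr_ge0.
by rewrite mulr_ge0 ?exprn_ge0 // divr_ge0.
Qed.

(** Relative to their mean the two weights are [1 + e] and [1 - e], and the mean
    itself is compared with 1 by a tangent. *)
Lemma shape_ent_ge a : 0 < a < 1 ->
  shape_mean a - 1 + shape_dev a ^+ 2 / (2 * shape_mean a) <= shape_ent a.
Proof.
move=> ha; have /andP[a0 a1] := ha; have m1 := shape_mean_gt1 ha.
have d0 := shape_dev_gt0 ha; set m := shape_mean a in m1 *; set d := shape_dev a in d0 *.
have m0 : 0 < m := lt_trans ltr01 m1.
have am : a = m - d by rewrite /m /d /shape_mean /shape_dev; field.
have bm : coweight a = m + d by rewrite /m /d /shape_mean /shape_dev; field.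
have e01 : 0 <= d / m < 1.
  by rewrite divr_ge0 ?ltW //= ltr_pdivrMr // mul1r -subr_gt0 -am.
have hx c : 0 < 1 + c -> xlnx (m * (1 + c)) = m * (1 + c) * ln m + m * xlnx (1 + c).
  by move=> c0; rewrite /xlnx lnM ?posrE //; ring.
have -> : shape_ent a = xlnx m + m * (xlnx (1 + d / m) + xlnx (1 - d / m)) / 2.
  have /andP[e0 e1] := e01.
  rewrite /shape_ent bm {1}am.
  have -> : m - d = m * (1 + - (d / m)) by field; rewrite gt_eqF.
  have -> : m + d = m * (1 + d / m) by field; rewrite gt_eqF.
  rewrite !hx; [|by rewrite addr_gt0 // divr_gt0 |by rewrite subr_gt0].
  by rewrite /xlnx; move: (d / m) (ln _) (ln _) (ln _); clear => c l1 l2 l3; field.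
have h1 := xlnx_pair_ge e01.
have h2 := xlnx_tangent ltr01 (ltW m0); rewrite /xlnx ln1 in h2.
have -> : d ^+ 2 / (2 * m) = m * (d / m) ^+ 2 / 2 by field; rewrite gt_eqF.
have := ler_wpM2l (ltW m0) h1; rewrite /xlnx.
move: h2; move: ((d / m) ^+ 2) (m * (_ + _)) (m * ln m); clear => x y z; lra.
Qed.

(** Shapes close to 1 have a small deviation, and never beat the constant. *)
Lemma shape_gap_gt0 r a : 0 < a < 1 -> 2 * (- ln r) * shape_dev a < 3 ->
  0 < shape_gap r a.
Proof.
move=> ha hd; have he := shape_ent_ge ha; have m1 := shape_mean_gt1 ha.
have d0 := shape_dev_gt0 ha; have hc := shape_cube ha.
rewrite /shape_gap; move: he hd hc m1 d0.
move: (shape_ent a) (shape_mean a) (shape_dev a) (ln r); clear => A m d l he hd hc m1 d0.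
have m0 : 0 < m by lra.
suff h : (m - 1) * (- l) < d ^+ 2 / (2 * m).
  by move: he h; move: (d ^+ 2 / _) => x he h; lra.
rewrite ltr_pdivlMr ?mulr_gt0 //.
have q0 : 0 < m ^+ 2 + m + 1 by nra.
rewrite -(ltr_pM2l q0).
have -> : (m ^+ 2 + m + 1) * ((m - 1) * - l * (2 * m)) = d ^+ 2 * (2 * - l * d) * m.
  have -> : (m ^+ 2 + m + 1) * ((m - 1) * - l * (2 * m)) =
     (m ^+ 3 - 1) * (2 * - l) * m by ring.
  by rewrite hc; ring.
have d20 : 0 < d ^+ 2 by rewrite exprn_gt0.
apply: (@lt_le_trans _ _ (d ^+ 2 * 3 * m)).
  by rewrite ltr_pM2r // ltr_pM2l.
rewrite -mulrA mulrC ler_pM2r //.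
have := sqr_ge0 (m - 1); lra.
Qed.

End Shape.

Section TwoBlockValues.
Variable R : realType.
Implicit Types r x y a t c m : R.

(** For small [x] little is lost in replacing the density constraint by
    [x * y^2 <= 4 r^3 / 3]; this is the logarithm of that bound at [r = 0.21]. *)
Definition ln_C0 : R := ln (4 / 3) + 3 * ln (21 / 100).

Lemma ln_C0_itv :
  - (4 + 39 / 10 ^+ 2 + 43 / 10 ^+ 4) <= ln_C0 <= - (4 + 39 / 10 ^+ 2 + 42 / 10 ^+ 4).
Proof.
rewrite /ln_C0 (@ln_nat_div _ 4 3) // (@ln_smooth R 2 0 0).
have [l2 l3 l5] := ln_235 R; have v := ln_21_100_itv R; move: l2 l3 v.
by move: (ln 2) (ln 3) (ln 5) (ln (21 / 100)); clear => x y z w *; lra.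
Qed.

(** The three following lemmas collect the numerical hypotheses of
    [two_block_tangent] for the points of tangency 6/7, 4/5 and 2/3 of the
    larger weight. *)
Lemma two_block_values_6_7 (t := 6 / 7 : R) (x1 := 1 / 70 : R)
    (x2 := 9 / 500 : R) (K := hl (xlnx t) t + xlnx t / 2 * ln_C0) :
  2 * h (21 / 100) < hl (xlnx t / 2) x1 + K /\
  2 * h (21 / 100) < hl (xlnx t / 2) x2 + K.
Proof.
rewrite /K /hl /xlnx /h /t /x1 /x2 {t x1 x2 K}.
have x := ln_6_7_itv R; have y := ln_1_70_itv R; have z := ln_9_500_itv R.
have v := ln_21_100_itv R; have w := ln_C0_itv.
have xx := mul_neg_itv x x ltac:(clear; lra) ltac:(clear; lra).
have xy := mul_neg_itv x y ltac:(clear; lra) ltac:(clear; lra).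
have xz := mul_neg_itv x z ltac:(clear; lra) ltac:(clear; lra).
have xw := mul_neg_itv x w ltac:(clear; lra) ltac:(clear; lra).
move: x y z v w xx xy xz xw.
move: (ln (6 / 7)) (ln (1 / 70)) (ln (9 / 500)) (ln (21 / 100)) ln_C0.
by clear => x y z v w *; split; lra.
Qed.

Lemma two_block_values_4_5 (t := 4 / 5 : R) (x1 := 9 / 500 : R)
    (x2 := 1 / 40 : R) (K := hl (xlnx t) t + xlnx t / 2 * ln_C0) :
  2 * h (21 / 100) < hl (xlnx t / 2) x1 + K /\
  2 * h (21 / 100) < hl (xlnx t / 2) x2 + K.
Proof.
rewrite /K /hl /xlnx /h /t /x1 /x2 {t x1 x2 K}.
have x := ln_4_5_itv R; have y := ln_9_500_itv R; have z := ln_1_40_itv R.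
have v := ln_21_100_itv R; have w := ln_C0_itv.
have xx := mul_neg_itv x x ltac:(clear; lra) ltac:(clear; lra).
have xy := mul_neg_itv x y ltac:(clear; lra) ltac:(clear; lra).
have xz := mul_neg_itv x z ltac:(clear; lra) ltac:(clear; lra).
have xw := mul_neg_itv x w ltac:(clear; lra) ltac:(clear; lra).
move: x y z v w xx xy xz xw.
move: (ln (4 / 5)) (ln (9 / 500)) (ln (1 / 40)) (ln (21 / 100)) ln_C0.
by clear => x y z v w *; split; lra.
Qed.

Lemma two_block_values_2_3 (t := 2 / 3 : R) (x1 := 1 / 40 : R)
    (x2 := 3 / 50 : R) (K := hl (xlnx t) t + xlnx t / 2 * ln_C0) :
  2 * h (21 / 100) < hl (xlnx t / 2) x1 + K /\
  2 * h (21 / 100) < hl (xlnx t / 2) x2 + K.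
Proof.
rewrite /K /hl /xlnx /h /t /x1 /x2 {t x1 x2 K}.
have x := ln_2_3_itv R; have y := ln_1_40_itv R; have z := ln_3_50_itv R.
have v := ln_21_100_itv R; have w := ln_C0_itv.
have xx := mul_neg_itv x x ltac:(clear; lra) ltac:(clear; lra).
have xy := mul_neg_itv x y ltac:(clear; lra) ltac:(clear; lra).
have xz := mul_neg_itv x z ltac:(clear; lra) ltac:(clear; lra).
have xw := mul_neg_itv x w ltac:(clear; lra) ltac:(clear; lra).
move: x y z v w xx xy xz xw.
move: (ln (2 / 3)) (ln (1 / 40)) (ln (3 / 50)) (ln (21 / 100)) ln_C0.
by clear => x y z v w *; split; lra.
Qed.

(** The entropy of [y] is bounded by its tangent in [ln y] at [t], the
    constraint trades [ln y] for [ln x], and what remains is quasi-concave in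
    [x]: its minimum over an interval is at an end. *)
Lemma two_block_tangent t x1 x2 x y (K : R) : 0 < t < 1 -> -1 <= ln t ->
  0 < x1 -> x1 <= x <= x2 -> ln x2 <= -1 -> 0 < y -> -1 <= ln y ->
  ln x + 2 * ln y <= ln_C0 ->
  K < hl (xlnx t / 2) x1 + (hl (xlnx t) t + xlnx t / 2 * ln_C0) /\
  K < hl (xlnx t / 2) x2 + (hl (xlnx t) t + xlnx t / 2 * ln_C0) ->
  K < h x + h y.
Proof.
move=> /andP[t0 t1] lt x10 hx lx2 y0 ly hxy [k1 k2].
have c0 : xlnx t <= 0.
  by rewrite /xlnx mulr_ge0_le0 ?(ltW t0) // ln_le0 // ltW.
have q : Num.min (hl (xlnx t / 2) x1) (hl (xlnx t / 2) x2) <= hl (xlnx t / 2) x.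
  by apply: (hl_quasiconcave x10 hx); [right|rewrite ge_min lexx|rewrite ge_min lexx orbT].
have qK : K - (hl (xlnx t) t + xlnx t / 2 * ln_C0) <
    Num.min (hl (xlnx t / 2) x1) (hl (xlnx t / 2) x2).
  by rewrite lt_min !ltrBlDr k1 k2.
have hy := hl_ge_tangent t0 lt y0 ly.
have hm : xlnx t / 2 * ln_C0 <= xlnx t / 2 * (ln x + 2 * ln y).
  by rewrite ler_wnM2l // mulr_le0_ge0 // invr_ge0.
move: (lt_le_trans qK q) hy hm; rewrite /hl.
move: (xlnx t) (ln x) (ln y) (h x) (h y) (h t) ln_C0 (ln t); clear.
by move=> c lx ly hx hy ht C l *; lra.
Qed.

End TwoBlockValues.

Section TwoBlock.
Variable R : realType.
Implicit Types r x y a t c m : R.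

Lemma scaled_shape_eq r a : 0 < a < 1 ->
  (r * a) ^+ 3 + 3 * (r * a) * (r * coweight a) ^+ 2 = 4 * r ^+ 3.
Proof. by move=> ha; rewrite -(shape_eq ha); move: (coweight a); clear => b; ring. Qed.

Lemma shape_dev_le a (c : R) : 0 < c -> c <= a < 1 ->
  shape_dev a <= (Num.sqrt (4 / (3 * c)) - c) / 2.
Proof.
move=> c0 /andP[ca a1]; have a0 := lt_le_trans c0 ca.
rewrite /shape_dev ler_pM2r ?invr_gt0 // lerB // shapeE ler_sqrt ?divr_ge0 ?mulr_ge0 ?(ltW c0) //.
rewrite ler_pM ?invr_ge0 ?mulr_ge0 ?(ltW a0) ?(ltW c0) //.
- by rewrite subr_ge0; have := exprn_ile1 3 (ltW a0) (ltW a1); lra.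
- by rewrite lerBlDr lerDl exprn_ge0 // ltW.
- by rewrite lef_pV2 ?posrE ?mulr_gt0 // ler_pM2l.
Qed.

(** At 0.21 no two-block weight beats the constant: shapes with [x >= 0.06] are
    close enough to 1, for [x <= 1/70] the entropy of [x] alone is too large, and
    the range between is covered by three tangents. *)
Lemma shape_gap_021 a : 0 < a < 1 -> (21 / 100) * coweight a <= 1 ->
  0 < shape_gap (21 / 100) a.
Proof.
move=> ha hy1; have r0 : (0 : R) < 21 / 100 by clear; lra.
have /andP[a0 a1] := ha; have b1 := shape_gt1 ha; have b0 := lt_trans ltr01 b1.
have hx := ln_21_100_itv R.
have [ax|ax] := leP (3 / 50) ((21 / 100) * a).
  apply: shape_gap_gt0 => //.
  have a27 : 2 / 7 <= a by move: ax; clear; lra.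
  have c0 : (0 : R) < 2 / 7 by clear; lra.
  have := @shape_dev_le a (2 / 7) c0; rewrite a27 a1 => /(_ isT).
  have s : Num.sqrt (4 / (3 * (2 / 7))) <= 217 / 100 :> R.
    have -> : 217 / 100 = Num.sqrt ((217 / 100) ^+ 2) :> R.
      by rewrite sqrtr_sqr ger0_norm //; clear; lra.
    by rewrite ler_sqrt ?sqr_ge0 //; clear; lra.
  have d0 := shape_dev_gt0 ha.
  move: s hx d0; move: (Num.sqrt _) (shape_dev a) (ln _); clear => s d l s1 l1 d0 ds.
  by nra.
have [_ _ <-] := f_tri_gap_sg r0 ha.
rewrite /f_tri partner_scale //; have := scaled_shape_eq (21 / 100) ha.
set x := 21 / 100 * a in ax *; set y := 21 / 100 * coweight a in hy1 * => e.
have x0 : 0 < x by rewrite mulr_gt0.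
have y0 : 0 < y by rewrite mulr_gt0 // (lt_trans ltr01).
suff : 2 * h (21 / 100 : R) < h x + h y.
  by move: (h x) (h y) (h _); clear => u v w; lra.
have [x70|x70] := leP x (1 / 70).
  have h1 := h_decr (ltW x0) x70; have h2 := h_ge0 (ltW y0).
  have h3 : 2 * h (21 / 100 : R) < h (1 / 70).
    rewrite /h; have := ln_1_70_itv R; move: hx; move: (ln (21 / 100)) (ln (1 / 70)).
    by clear => u v; lra.
  have : h (1 / 70) <= h x by apply: h1; clear; lra.
  by move: h3 h2; move: (h (1 / 70)) (h (21 / 100)) (h x) (h y); clear => u v w z; lra.
have y25 : 2 / 5 <= y.
  have x3 : x ^+ 3 <= (3 / 50) ^+ 3.
    by rewrite lerXn2r ?nnegrE ?(ltW x0) ?(ltW ax) //; clear; lra.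
  rewrite leNgt; apply/negP => y25.
  have y2 : y ^+ 2 <= (2 / 5) ^+ 2.
    by rewrite lerXn2r ?nnegrE ?(ltW y0) ?(ltW y25) //; clear; lra.
  have xy : x * y ^+ 2 <= (3 / 50) * (2 / 5) ^+ 2.
    by rewrite ler_pM ?sqr_ge0 ?(ltW x0) ?(ltW ax).
  by move: e x3 xy; move: (x ^+ 3) (y ^+ 2); clear => u v; lra.
have ly : -1 <= ln y.
  have := @ln_ge1V R (2 / 5) ltac:(clear; lra).
  have := ln_le_sub1 y0.
  have : ln (2 / 5) <= ln y by rewrite ler_ln ?posrE // ; clear; lra.
  have -> : ln (2 / 5) = ln 2 - ln 5 :> R by rewrite (@ln_nat_div _ 2 5).
  have [l2 _ l5] := ln_235 R; move: l2 l5; move: (ln 2) (ln 5) (ln y).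
  by clear => u v w; lra.
have hxy : ln x + 2 * ln y <= ln_C0 R.
  have -> : ln x + 2 * ln y = ln (x * y ^+ 2).
    by rewrite [in RHS]lnM ?posrE ?exprn_gt0 // lnXn // mulr_natl.
  have -> : ln_C0 R = ln (4 / 3 * (21 / 100) ^+ 3).
    have p1 : (4 / 3 : R) \is Num.pos by rewrite posrE; clear; lra.
    have p2 : (21 / 100 : R) ^+ 3 \is Num.pos by rewrite posrE exprn_gt0.
    by rewrite (lnM p1 p2) (lnXn 3 r0) /ln_C0 [3 * _]mulr_natl.
  rewrite ler_ln ?posrE ?mulr_gt0 ?exprn_gt0 ?divr_gt0 //.
  by have := exprn_gt0 3 x0; move: e; move: (x ^+ 3) (y ^+ 2); clear => u v; lra.
have l45 := ln_4_5_itv R; have l67 := ln_6_7_itv R; have l23 := ln_2_3_itv R.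
have l500 := ln_9_500_itv R; have l40 := ln_1_40_itv R; have l50 := ln_3_50_itv R.
have [xa|xa] := leP x (9 / 500).
  apply: (@two_block_tangent R (6 / 7) (1 / 70) (9 / 500) x y (2 * h (21 / 100))) => //; last exact: two_block_values_6_7.
  - by clear; lra.
  - by move: l67; move: (ln _); clear => u; lra.
  - by rewrite ltW.
  - by move: l500; move: (ln _); clear => u; lra.
have [xb|xb] := leP x (1 / 40).
  apply: (@two_block_tangent R (4 / 5) (9 / 500) (1 / 40) x y (2 * h (21 / 100))) => //; last exact: two_block_values_4_5.
  - by clear; lra.
  - by move: l45; move: (ln _); clear => u; lra.
  - by rewrite ltW.
  - by move: l40; move: (ln _); clear => u; lra.
apply: (@two_block_tangent R (2 / 3) (1 / 40) (3 / 50) x y (2 * h (21 / 100))) => //; last exact: two_block_values_2_3.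
- by clear; lra.
- by move: l23; move: (ln _); clear => u; lra.
- by rewrite !ltW.
- by move: l50; move: (ln _); clear => u; lra.
Qed.

(** At 0.209 the two-block weight with [x = 0.0165], which has shape 3/38, beats
    the constant. *)
Lemma shape_gap_0209 : shape_gap (209 / 1000) (3 / 38 : R) < 0 /\
  (209 / 1000) * coweight (3 / 38) <= 1 :> R.
Proof.
have r0 : (0 : R) < 209 / 1000 by clear; lra.
have ha : 0 < (3 / 38 : R) < 1 by clear; lra.
have := scaled_shape_eq (209 / 1000) ha; have [_ <- _] := f_tri_gap_sg r0 ha.
rewrite /f_tri (partner_scale _ r0).
have b1 := shape_gt1 ha.
have -> : 209 / 1000 * (3 / 38) = 33 / 2000 :> R by field.
set y := 209 / 1000 * coweight _ => e.
have y0 : 0 < y by rewrite mulr_gt0 // (lt_trans ltr01).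
have y1 : y <= 1.
  rewrite leNgt; apply/negP => y1; have : 1 <= y ^+ 2 by rewrite exprn_ege1 // ltW.
  by move: e; move: (y ^+ 2); clear => u; lra.
have y67 : 6 / 7 <= y.
  rewrite leNgt; apply/negP => y67.
  have y2 : y ^+ 2 <= (6 / 7) ^+ 2.
    by rewrite lerXn2r ?nnegrE ?(ltW y0) ?(ltW y67) //; clear; lra.
  by move: e y2; move: (y ^+ 2); clear => u; lra.
split=> //; have h67 : h y <= h (6 / 7) by apply: h_decr => //; clear; lra.
have : h (33 / 2000) + h (6 / 7) < 2 * h (209 / 1000 : R).
  have := ln_33_2000_itv R; have := ln_6_7_itv R; have := ln_209_1000_itv R.
  rewrite /h; move: (ln (33 / 2000)) (ln (6 / 7)) (ln (209 / 1000)).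
  by clear => u v w; lra.
by move: h67; move: (h (33 / 2000)) (h (6 / 7)) (h y) (h _); clear => u v w z; lra.
Qed.

End TwoBlock.

(** * The threshold below which two blocks beat the constant *)

Section LowThreshold.
Variable R : realType.
Implicit Types r x y a : R.

Lemma shape_antitone a b : 0 < a -> a <= b -> b < 1 -> coweight b <= coweight a.
Proof.
move=> a0 ab b1; have b0 := lt_le_trans a0 ab; have a1 := le_lt_trans ab b1.
rewrite !shapeE ler_sqrt; last first.
  by rewrite ltW // (lt_trans ltr01) // shape_arg // a0.
rewrite ler_pM ?invr_ge0 ?mulr_ge0 ?(ltW b0) //.
- by rewrite subr_ge0; have := exprn_ile1 3 (ltW b0) (ltW b1); move: (b ^+ 3); clear => u; lra.
- by rewrite lerD2l lerN2 lerXn2r ?nnegrE ?(ltW a0) ?(ltW b0).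
- by rewrite lef_pV2 ?posrE ?mulr_gt0 // ler_pM2l.
Qed.

Lemma shape_continuous a : 0 < a < 1 -> {for a, continuous (@coweight R)}.
Proof.
move=> /andP[a0 a1].
have -> : @coweight R = Num.sqrt \o (fun x => (4 - x ^+ 3) / (3 * x)).
  by apply/funext => x; rewrite shapeE.
apply: continuous_comp; last exact: sqrt_continuous.
apply: cvgM; first by apply: cvgB; [exact: cvg_cst|exact: exprn_continuous].
apply: cvgV; first by rewrite gt_eqF // mulr_gt0.
by apply: cvgM; [exact: cvg_cst|exact: cvg_id].
Qed.

Lemma xlnx_continuous x : 0 < x -> {for x, continuous (@xlnx R)}.
Proof. by move=> x0; apply: cvgM; [exact: cvg_id|exact: continuous_ln]. Qed.

Lemma shape_ent_continuous a : 0 < a < 1 -> {for a, continuous (@shape_ent R)}.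
Proof.
move=> ha; have /andP[a0 _] := ha; have b1 := shape_gt1 ha.
apply: cvgM; last exact: cvg_cst; apply: cvgD; first exact: xlnx_continuous.
apply: (@continuous_comp _ _ _ (@coweight R) (@xlnx R)); first exact: shape_continuous.
by apply: xlnx_continuous; exact: lt_trans b1.
Qed.

Lemma shape_mean_continuous a : 0 < a < 1 -> {for a, continuous (@shape_mean R)}.
Proof.
move=> ha; apply: cvgM; last exact: cvg_cst.
by apply: cvgD; [exact: cvg_id|exact: shape_continuous].
Qed.

Lemma shape_gap_continuous r a : 0 < a < 1 -> {for a, continuous (shape_gap r)}.
Proof.
move=> ha; apply: cvgD; first exact: shape_ent_continuous.
apply: cvgM; last exact: cvg_cst.
by apply: cvgB; [exact: shape_mean_continuous|exact: cvg_cst].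
Qed.

Lemma shape_level_continuous a : 0 < a < 1 -> {for a, continuous (@shape_level R)}.
Proof.
move=> ha.
apply: (@continuous_comp _ _ _ (fun a => 1 - shape_ent a / (shape_mean a - 1)) expR);
  last exact: continuous_expR.
apply: cvgB; first exact: cvg_cst.
apply: cvgM; first exact: shape_ent_continuous.
apply: cvgV; first by rewrite gt_eqF // subr_gt0 shape_mean_gt1.
by apply: cvgB; [exact: shape_mean_continuous|exact: cvg_cst].
Qed.

(** The largest density at which the shape [a] is both admissible, its larger
    weight being at most 1, and not worse than the constant. *)
Definition block_level a : R := Num.min (shape_level a) (coweight a)^-1.

Lemma block_level_continuous a : 0 < a < 1 -> {for a, continuous block_level}.
Proof.
move=> ha; have b0 := lt_trans ltr01 (shape_gt1 ha).
have -> : block_level = fun a => ((shape_level a + (coweight a)^-1) -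
    `|shape_level a - (coweight a)^-1|) / 2.
  by apply/funext => x; rewrite /block_level minr_absE.
have hL := shape_level_continuous ha.
have hS : ((coweight x)^-1 @[x --> a] --> (coweight a)^-1)%classic.
  by apply: cvgV; [rewrite gt_eqF|exact: shape_continuous].
apply: cvgM; last exact: cvg_cst; apply: cvgB; first exact: cvgD.
by apply: cvg_norm; exact: cvgB.
Qed.

Lemma le_block_level r a : 0 < r -> 0 < a < 1 ->
  (r <= block_level a) = (shape_gap r a <= 0) && (r * coweight a <= 1).
Proof.
move=> r0 ha; have b0 := lt_trans ltr01 (shape_gt1 ha).
rewrite /block_level le_min -[(coweight a)^-1]mul1r ler_pdivlMr //; congr andb.
rewrite !le_eqVlt -shape_gap_lt //; congr orb.
by apply/eqP/eqP => /(shape_gap0 r0 ha).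
Qed.

Lemma lt_block_level r a : 0 < r -> 0 < a < 1 ->
  (r < block_level a) = (shape_gap r a < 0) && (r * coweight a < 1).
Proof.
move=> r0 ha; have b0 := lt_trans ltr01 (shape_gt1 ha).
by rewrite /block_level lt_min -[(coweight a)^-1]mul1r ltr_pdivlMr // -shape_gap_lt.
Qed.

Lemma block_level_argmax : exists2 a, 1 / 20 <= a <= 1 / 2 &
  forall b, 1 / 20 <= b <= 1 / 2 -> block_level b <= block_level a.
Proof.
have h : (1 / 20 : R) <= 1 / 2 by clear; lra.
have [|a] := @EVT_max R block_level _ _ h.
  apply: continuous_subspace_itv => x; rewrite in_itv /= => hx.
  by apply: block_level_continuous; move: hx; clear; lra.
rewrite in_itv /= => ha hmax; by exists a.
Qed.

(** The deviation decreases with the shape, so 1/2 is the worst case. *)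
Lemma shape_gap_half_gt0 r a : 1 / 5 <= r -> r < 1 -> 1 / 2 <= a < 1 -> 0 < shape_gap r a.
Proof.
move=> r5 r1 /andP[a2 a1]; have ha : 0 < a < 1 by move: a2 a1; clear; lra.
have r0 : 0 < r by move: r5; clear; lra.
have lr : - ln r <= 161 / 100.
  have : ln (1 / 5) <= ln r by rewrite ler_ln ?posrE //; clear; lra.
  have -> : ln (1 / 5) = ln 1 - ln 5 :> R by rewrite (@ln_nat_div _ 1 5).
  have [_ _ l5] := ln_235 R; rewrite ln1; move: l5; move: (ln 5) (ln r).
  by clear => u v; lra.
have l0 : 0 <= - ln r by rewrite oppr_ge0 ln_le0 // ltW.
apply: shape_gap_gt0 => //.
have c0 : (0 : R) < 1 / 2 by clear; lra.
have := @shape_dev_le _ a (1 / 2) c0; rewrite a2 a1 => /(_ isT).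
have s : Num.sqrt (4 / (3 * (1 / 2))) <= 17 / 10 :> R.
  have -> : 17 / 10 = Num.sqrt ((17 / 10) ^+ 2) :> R.
    by rewrite sqrtr_sqr ger0_norm //; clear; lra.
  by rewrite ler_sqrt ?sqr_ge0 //; clear; lra.
have d0 := shape_dev_gt0 ha.
move: s d0 lr l0; move: (Num.sqrt _) (shape_dev a) (- ln r); clear => s d l s1 d0 l1 l0 ds.
have d1 : d <= 6 / 10 by lra.
by nra.
Qed.

Lemma f_tri_zero_shape r : 0 < r < 1 -> f_tri_has_zero r <->
  exists a, [/\ 0 < a < 1, shape_gap r a = 0 & r * coweight a <= 1].
Proof.
move=> /andP[r0 r1]; split=> [[x [/andP[x0 xr] [_ hp] hf]]|[a [ha hg hp]]].
  have xE : x = r * (x / r) by rewrite mulrC divfK // gt_eqF.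
  have ha : 0 < x / r < 1 by rewrite divr_gt0 //= ltr_pdivrMr // mul1r.
  exists (x / r); rewrite -partner_scale // -xE; split=> //.
  by have [h _ _] := f_tri_gap_sg r0 ha; apply/h; rewrite -xE.
have /andP[a0 a1] := ha; have [h _ _] := f_tri_gap_sg r0 ha.
exists (r * a); rewrite /f_tri_dom partner_scale //.
have ar : r * a < r by rewrite gtr_pMr.
have ra0 : 0 < r * a by rewrite mulr_gt0.
by split; [rewrite ra0 ar|rewrite ra0 (ltW ar)|apply/h].
Qed.

(** The threshold is the maximum of [block_level]: at densities above 1/5 a shape
    below 1/20 is not admissible and one above 1/2 loses to the constant.  At
    the maximum either the gap vanishes, or the larger weight is 1 and the gap
    is negative; then increasing the shape keeps it admissible and leads to a
    zero of the gap. *)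
Lemma low_threshold : exists rlow,
  [/\ 209 / 1000 <= rlow < 210 / 1000, f_tri_has_zero rlow,
      forall r, 0 < r < 1 -> f_tri_has_zero r -> r <= rlow &
      exists2 a, 0 < a < 1 &
        forall r, 0 < r < rlow -> shape_gap r a < 0 /\ r * coweight a < 1].
Proof.
have [a ia hmax] := block_level_argmax; have ha : 0 < a < 1 by move: ia; clear; lra.
set rlow := block_level a.
have lo : 209 / 1000 <= rlow.
  have i38 : 1 / 20 <= (3 / 38 : R) <= 1 / 2 by clear; lra.
  have h38 : 0 < (3 / 38 : R) < 1 by clear; lra.
  have r0 : (0 : R) < 209 / 1000 by clear; lra.
  apply: le_trans (hmax _ i38); rewrite le_block_level //.
  by have [g s] := @shape_gap_0209 R; rewrite (ltW g).
have hi : rlow < 210 / 1000.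
  have -> : 210 / 1000 = 21 / 100 :> R by field.
  have r0 : (0 : R) < 21 / 100 by clear; lra.
  rewrite ltNge le_block_level //; apply/negP => /andP[g s].
  by have := shape_gap_021 ha s; rewrite ltNge g.
have r0 : 0 < rlow by move: lo; clear; lra.
have r1 : rlow < 1 by move: hi; clear; lra.
have hr : 0 < rlow < 1 by rewrite r0.
exists rlow; split; first by rewrite lo.
- apply/f_tri_zero_shape => //.
  have := lexx rlow; rewrite {2}/rlow le_block_level // => /andP[].
  rewrite le_eqVlt => /orP[/eqP g s|g s]; first by exists a.
  have ah : a <= 1 / 2 by move: ia; clear; lra.
  have g2 : 0 < shape_gap rlow (1 / 2).
    by apply: shape_gap_half_gt0 => //; move: lo; clear; lra.
  have [||c] := @IVT R (shape_gap rlow) _ _ 0 ah.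
  + apply: continuous_subspace_itv => x; rewrite in_itv /= => hx.
    by apply: shape_gap_continuous; move: hx ia; clear; lra.
  + by rewrite ge_min le_max (ltW g) (ltW g2) orbT.
  rewrite in_itv /= => /andP[ac c2] gc.
  have c1 : c < 1 by move: c2; clear; lra.
  have /andP[a0 _] := ha; exists c; split=> //; first by rewrite c1 (lt_le_trans a0).
  by apply: le_trans s; rewrite ler_pM2l // shape_antitone.
- move=> r hr1 /(f_tri_zero_shape hr1)[b [hb g s]]; have /andP[r0' r1'] := hr1.
  rewrite leNgt; apply/negP => lr.
  have r5 : 1 / 5 <= r by move: lo lr; clear; lra.
  have rb : r <= block_level b by rewrite le_block_level // g lexx.
  have [b2|b2] := leP (1 / 2) b.
    have /andP[_ b1] := hb.
    by have := @shape_gap_half_gt0 r b r5 r1'; rewrite b2 b1 g ltxx => /(_ isT).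
  have [b20|b20] := leP (1 / 20) b.
    by have := le_lt_trans (le_trans rb (hmax b _)) lr; rewrite ltxx b20 (ltW b2) => /(_ isT).
  have s0 := lt_trans ltr01 (shape_gt1 hb).
  have s5 : coweight b <= 5.
    have : 1 / 5 * coweight b <= r * coweight b by rewrite ler_pM2r.
    by move: s; move: (r * coweight b) (coweight b); clear => u v; lra.
  have s25 : coweight b ^+ 2 <= 5 ^+ 2 by rewrite lerXn2r ?nnegrE ?(ltW s0).
  have /andP[b0 _] := hb; have e := shape_eq hb.
  have b3 : b ^+ 3 <= (1 / 20) ^+ 3 by rewrite lerXn2r ?nnegrE ?(ltW b0) ?(ltW b20) ?divr_ge0.
  have bs : b * coweight b ^+ 2 <= 1 / 20 * 5 ^+ 2.
    by rewrite ler_pM ?sqr_ge0 ?(ltW b0) ?(ltW b20).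
  by move: e b3 bs; move: (b ^+ 3) (coweight b ^+ 2); clear => u v; lra.
exists a => // r /andP[r0' rl].
by apply/andP; rewrite -lt_block_level.
Qed.

End LowThreshold.

(** * The threshold above which the triangle density is tight *)

Section HighThreshold.
Variable R : realType.
Implicit Types r s : R.

Definition tri_slack r : R := 3 / 2 * r * ln r - r + 1.

Lemma tri_slack_continuous r : 0 < r -> {for r, continuous tri_slack}.
Proof.
move=> r0; apply: cvgD; last exact: cvg_cst; apply: cvgB; last exact: cvg_id.
by apply: cvgM; [apply: cvgM; [exact: cvg_cst|exact: cvg_id]|exact: continuous_ln].
Qed.

Lemma ln_467_1000_lt : ln (467 / 1000 : R) < - (76 / 10 ^+ 2 + 11 / 10 ^+ 4).
Proof.
rewrite (@ln_nat_div _ 467 1000) // [ln 1000](@ln_smooth R 3 0 3).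
have := @ln_bounds R 480 467; rewrite (_ : (480 - 467) / (480 + 467) = 13 / 947); last by field.
rewrite [ln 480](@ln_smooth R 5 1 1) => /(_ _ _) hb.
have {hb} : @atanh_poly R (2 / 5) (13 / 947) <=
    5 * ln 2 + 1 * ln 3 + 1 * ln 5 - ln 467 <= @atanh_poly R (9 / 20) (13 / 947).
  by apply: hb; lra.
have [l2 l3 l5] := ln_235 R; move: l2 l3 l5; rewrite /atanh_poly.
by move: (ln 2) (ln 3) (ln 5) (ln 467); clear => a b c d *; lra.
Qed.

(** [tri_slack] is strictly convex and vanishes at 1, hence it has at most one
    other zero. *)
Lemma tri_slack_zero_unique r s : 0 < r < 1 -> 0 < s < 1 ->
  tri_slack r = 0 -> tri_slack s = 0 -> r = s.
Proof.
wlog sr : r s / s <= r.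
  move=> H hr hs er es; have [|rs] := leP s r; first by move/H; exact.
  by apply/esym/H => //; exact: ltW.
move=> /andP[r0 r1] /andP[s0 s1] er es; apply/eqP; rewrite eq_le sr andbT leNgt.
apply/negP => srn.
have lr : ln r < r - 1.
  have y0 : ln r != 0 by rewrite ln_eq0 // lt_eqF.
  by rewrite ltrBrDl; have := expR_gt1Dx y0; rewrite lnK.
have ht := xlnx_tangent r0 (ltW s0).
move: er es ht lr; rewrite /tri_slack /xlnx; move: (ln r) (ln s).
move: r0 r1 s0 srn; clear => r0 r1 s0 sr x y er es ht lr.
have k0 : 3 / 2 * (1 + x) - 1 < 0 by nra.
by nra.
Qed.

Lemma high_threshold : exists rbar,
  [/\ 0 < rbar < 1, tri_slack rbar = 0 & 466 / 1000 <= rbar < 467 / 1000].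
Proof.
have hlo : 0 < tri_slack (466 / 1000).
  have -> : 466 / 1000 = 233 / 500 :> R by field.
  by rewrite /tri_slack; have := ln_233_500_itv R; move: (ln _); clear => x; lra.
have hhi : tri_slack (467 / 1000) < 0.
  by rewrite /tri_slack; have := ln_467_1000_lt; move: (ln _); clear => x; lra.
have ab : (466 / 1000 : R) <= 467 / 1000 by clear; lra.
have [||c] := @IVT R tri_slack _ _ 0 ab.
- apply: continuous_subspace_itv => x; rewrite in_itv /= => hx.
  by apply: tri_slack_continuous; move: hx; clear; lra.
- by rewrite ge_min le_max (ltW hlo) (ltW hhi) orbT.
rewrite in_itv /= => /andP[c1 c2] hc; exists c; rewrite hc c1; split=> //.
  by move: c1 c2; clear; lra.
rewrite lt_neqAle c2 andbT; apply/negP => /eqP ec.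
by move: hhi; rewrite -ec hc ltxx.
Qed.

End HighThreshold.

(** * The triangle *)

Section Triangle.
Variables (R : realType) (H : sgraph).
Hypothesis triH : isomorphic H (complete_graph 3).

Lemma triangle_vertices : exists a b c : H,
  [/\ a != b, a != c, b != c & edges H = [set [set a; b]; [set a; c]; [set b; c]]].
Proof.
have [f [g fK gK] hf] := triH.
have ginj := can_inj gK.
pose o0 : 'I_3 := ord0; pose oa : 'I_3 := Ordinal (isT : (1 < 3)%N).
pose ob : 'I_3 := Ordinal (isT : (2 < 3)%N).
have ord3 (i : 'I_3) : [|| i == o0, i == oa | i == ob].
  by case: i => [[|[|[|]]]].
have n1 : o0 != oa by []. have n2 : o0 != ob by []. have n3 : oa != ob by [].
clearbody o0 oa ob.
exists (g o0), (g oa), (g ob); rewrite !(inj_eq ginj); split=> //.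
have gE x y : edge (g x) (g y) = (x != y) by rewrite -hf !gK.
have C i j : [set g i; g j] = [set g j; g i] by rewrite setUC.
apply/setP => e; apply/edgesP/idP => [[x [y [xy nxy ->]]]|].
  rewrite -[x]fK -[y]fK gE in xy *.
  case/or3P: (ord3 (f x)) xy => /eqP ->; case/or3P: (ord3 (f y)) => /eqP ->;
    by rewrite ?eqxx // => _; rewrite !inE ?eqxx ?orbT // C ?eqxx ?orbT.
rewrite !inE => /orP[/orP[]|] /eqP ->.
- by exists (g o0), (g oa); rewrite gE (inj_eq ginj).
- by exists (g o0), (g ob); rewrite gE (inj_eq ginj).
- by exists (g oa), (g ob); rewrite gE (inj_eq ginj).
Qed.

Lemma triangle_vcount : vcount H = 3%N.
Proof. by have [f hf _] := triH; rewrite /vcount (bij_eq_card hf) card_ord. Qed.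

Lemma pair_neq (T : finType) (a b c d : T) : a != c -> a != d -> [set a; b] != [set c; d].
Proof.
move=> ac ad; apply/eqP => /setP/(_ a).
by rewrite !inE eqxx (negbTE ac) (negbTE ad).
Qed.

Lemma triangle_prod (F : {set H} -> R) a b c : a != b -> a != c -> b != c ->
  edges H = [set [set a; b]; [set a; c]; [set b; c]] ->
  \prod_(e in edges H) F e = F [set a; b] * F [set a; c] * F [set b; c].
Proof.
move=> ab ac bc ->; have n1 : [set b; c] != [set a; b].
  by rewrite [[set b; c]]setUC; apply: pair_neq; rewrite eq_sym.
have n2 : [set b; c] != [set a; c] by apply: pair_neq => //; rewrite eq_sym.
have n3 : [set a; c] != [set a; b].
  by rewrite [[set a; c]]setUC; apply: pair_neq; rewrite eq_sym.
rewrite setUC big_setU1 /=; last by rewrite !inE negb_or n1 n2.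
by rewrite big_setU1 /= ?inE 1?eq_sym // big_set1; ring.
Qed.

Lemma triangle_ecount : ecount H = 3%N.
Proof.
have [a [b [c [ab ac bc hE]]]] := triangle_vertices; rewrite /ecount hE.
have n1 : [set b; c] != [set a; b].
  by rewrite [[set b; c]]setUC; apply: pair_neq; rewrite eq_sym.
have n2 : [set b; c] != [set a; c] by apply: pair_neq => //; rewrite eq_sym.
have n3 : [set a; c] != [set a; b].
  by rewrite [[set a; c]]setUC; apply: pair_neq; rewrite eq_sym.
by rewrite setUC cardsU1 !inE negb_or n1 n2 /= setUC cardsU1 inE n3 cards1.
Qed.

Lemma triangle_hom_wt n (u : {set 'I_n} -> R) :
  hom_wt H u = \sum_x \sum_y \sum_z u [set x; y] * u [set x; z] * u [set y; z].
Proof.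
have [a [b [c [ab ac bc hE]]]] := triangle_vertices.
case: (posnP n) => [n0|n0].
  rewrite /hom_wt !big1 // => [x _|f _]; last first.
    by have := leq_trans (ltn_ord (f a)) (eq_leq n0).
  by have := leq_trans (ltn_ord x) (eq_leq n0).
have n30 : n%:R ^+ 3 != 0 :> R by rewrite expf_neq0 // pnatr_eq0 -lt0n.
apply: (mulfI n30); set T := \sum_x _.
have <- : \sum_(f : {ffun H -> 'I_n}) T = n%:R ^+ 3 * T.
  by rewrite -triangle_vcount -(card_maps R H n) mulr_suml; apply: eq_bigr => f _; rewrite mul1r.
rewrite exprSr -mulrA -(sum_resample c) -(sum_resample2 a b).
apply: eq_bigr => f _; apply: eq_bigr => x _; apply: eq_bigr => y _; apply: eq_bigr => z _.
rewrite (triangle_prod _ ab ac bc hE).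
by rewrite !imsetU1 !imset_set1 !ffunE !eqxx (negbTE ab) (negbTE ac) (negbTE bc).
Qed.

(** Writing the weights as [m + k e_x e_y] with [m = (A + B) / 2] and
    [k = (A - B) / 2], where [e_x] is a sign, the products over triangles average
    to [m^3 + k^3] up to a defect for odd [n]; it is proportional to
    [m k (m + k)], hence nonpositive. *)
Lemma triangle_hom_wt_parity n A B : 0 <= A <= B ->
  hom_wt H (parity_wt A B : {set 'I_n} -> R) <=
  n%:R ^+ 3 * ((A ^+ 3 + 3 * A * B ^+ 2) / 4).
Proof.
move=> /andP[A0 AB]; rewrite triangle_hom_wt.
pose m := (A + B) / 2; pose k := (A - B) / 2; pose D := m * k * (m + k).
pose C := m ^+ 3 + k ^+ 3; pose e (x : 'I_n) : R := (-1) ^+ x.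
have term x y z : parity_wt A B [set x; y] * parity_wt A B [set x; z] *
    parity_wt A B [set y; z] =
    C + D * (e x * e y) + D * (e x + e y) * e z :> R.
  rewrite !parity_wt2 -/m -/k -/(e x) -/(e y) -/(e z).
  have e2 w : e w ^+ 2 = 1 by rewrite /e sqrr_sign.
  have -> : (m + k * (e x * e y)) * (m + k * (e x * e z)) * (m + k * (e y * e z)) =
    m ^+ 3 + m ^+ 2 * k * (e x * e y + e x * e z + e y * e z) +
    m * k ^+ 2 * (e x ^+ 2 * (e y * e z) + e y ^+ 2 * (e x * e z) + e z ^+ 2 * (e x * e y)) +
    k ^+ 3 * (e x ^+ 2 * e y ^+ 2 * e z ^+ 2) by ring.
  by rewrite !e2 /C /D; ring.
have sz x y : \sum_z parity_wt A B [set x; y] * parity_wt A B [set x; z] *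
    parity_wt A B [set y; z] =
    n%:R * C + D * (odd n)%:R * e x + (n%:R * D * e x + D * (odd n)%:R) * e y :> R.
  under eq_bigr do rewrite term.
  rewrite big_split /= -mulr_sumr sum_signs sumr_const card_ord.
  by rewrite -[X in X + _]mulr_natl; ring.
under eq_bigr do under eq_bigr do rewrite sz.
have sy x : \sum_y (n%:R * C + D * (odd n)%:R * e x +
     (n%:R * D * e x + D * (odd n)%:R) * e y) =
    n%:R ^+ 2 * C + D * (odd n)%:R ^+ 2 + (2 * n%:R * D * (odd n)%:R) * e x :> R.
  rewrite big_split /= -mulr_sumr sum_signs sumr_const card_ord.
  by rewrite -[X in X + _]mulr_natl; ring.
under eq_bigr do rewrite sy.
rewrite big_split /= -mulr_sumr sum_signs sumr_const card_ord -[X in X + _]mulr_natl.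
have CE : C = (A ^+ 3 + 3 * A * B ^+ 2) / 4 by rewrite /C /m /k; field.
have D0 : D <= 0.
  have -> : D = A * ((A + B) * (A - B)) / 4 by rewrite /D /m /k; field.
  rewrite ler_pdivrMr // mul0r mulr_ge0_le0 // mulr_ge0_le0 //; first by rewrite addr_ge0 // (le_trans A0).
  by rewrite subr_le0.
rewrite -CE -subr_ge0.
have -> : n%:R ^+ 3 * C - (n%:R * (n%:R ^+ 2 * C + D * (odd n)%:R ^+ 2) +
  2 * n%:R * D * (odd n)%:R * (odd n)%:R) = 3 * (- D) * (n%:R * (odd n)%:R ^+ 2) by ring.
by rewrite !mulr_ge0 ?oppr_ge0 ?sqr_ge0.
Qed.

(** Shrinking both weights by a factor close to 1 makes the density constraint
    strict at a small entropy cost. *)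
Lemma triangle_two_block r a p : 0 < r < 1 -> 0 < a < 1 -> shape_gap r a < 0 ->
  r * coweight a < 1 -> edge_prob_seq (sparse_exponent R H) p ->
  ((- h r)%:E < limn_einf (lower_tail_rate H p r))%E.
Proof.
move=> /andP[r0 r1] ha hg hb hp; have /andP[a0 a1] := ha.
have hS := scaled_shape_eq r ha; move: hg; have [_ <- _] := f_tri_gap_sg r0 ha; rewrite /f_tri partner_scale // => hg.
set X := r * a in hS hg; set Y := r * coweight a in hb hS hg.
have X0 : 0 < X by rewrite mulr_gt0.
have XY : X <= Y.
  by rewrite ler_pM2l // (le_trans (ltW a1)) // ltW // shape_gt1.
have Y0 : 0 < Y := lt_le_trans X0 XY.
pose g := h r - (h X + h Y) / 2.
have g0 : 0 < g by rewrite /g; move: hg; clear; lra.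
pose d := Num.min (1 / 2) (g / 4).
have d0 : 0 < d by rewrite lt_min !divr_gt0.
have d2 : d <= 1 / 2 by rewrite ge_min lexx.
have dg : d <= g / 4 by rewrite ge_min lexx orbT.
pose c := 1 - d.
have c0 : 0 < c by rewrite /c; move: d2; clear; lra.
have c1 : c < 1 by rewrite /c; move: d0; clear; lra.
have cX0 : 0 < c * X by rewrite mulr_gt0.
have cXY : c * X <= c * Y by rewrite ler_pM2l.
have cY1 : c * Y <= 1 by rewrite mulr_ile1 ?(ltW c0) ?(ltW c1) ?(ltW Y0) ?(ltW hb).
have hle (x : R) : 0 < x -> h (c * x) <= h x + d.
  move=> x0; rewrite h_scale ?(ltW x0) //.
  have l0 : c * ln c * x <= 0.
    by rewrite mulr_le0_ge0 ?(ltW x0) // mulr_ge0_le0 ?(ltW c0) // ln_le0 // ltW.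
  have u0 := mulr_ge0 (ltW d0) (h_ge0 (ltW x0)).
  move: l0 u0; move: (c * ln c * x) => w; rewrite /c; move: (h x) (d) => u z.
  by clear => w0 u0; lra.
pose v := (h (c * X) + h (c * Y)) / 2.
have eta0 : 0 < g / 4 by rewrite divr_gt0.
apply: (@lt_le_trans _ _ (- (v + g / 4))%:E).
  rewrite lte_fin ltrN2 /v; have := hle _ X0; have := hle _ Y0; move: dg g0; rewrite /g.
  by clear; lra.
apply: (liminf_rate_ge hp).
apply: (@tail_prob_lower R H p r (fun n => parity_wt (c * X) (c * Y)) (c * X)
  ((c * r) ^+ 3) v (g / 4)) => //.
- by move=> n s; rewrite /parity_wt; case: ifP => _; rewrite ?lexx ?cXY ?cY1 ?(le_trans cXY).
- move=> n; rewrite triangle_vcount.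
  apply: le_trans (triangle_hom_wt_parity n _) _; first by rewrite (ltW cX0).
  have -> : (c * X) ^+ 3 + 3 * (c * X) * (c * Y) ^+ 2 = c ^+ 3 * (X ^+ 3 + 3 * X * Y ^+ 2).
    by ring.
  rewrite hS exprMn.
  have -> : c ^+ 3 * (4 * r ^+ 3) / 4 = c ^+ 3 * r ^+ 3 :> R by field.
  exact: lexx.
- by rewrite triangle_ecount ltr_pXn2r ?nnegrE ?mulr_ge0 ?(ltW c0) ?(ltW r0) // gtr_pMl.
- move=> n.
  under eq_bigr do under eq_bigr do rewrite (parity_wt_comp (@h R)).
  apply: sum_parity_wt_le; rewrite ler_norml.
  have cX01 : 0 <= c * X <= 1 by rewrite (ltW cX0) (le_trans cXY).
  have cY01 : 0 <= c * Y <= 1 by rewrite cY1 (le_trans (ltW cX0)).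
  have x1 := h_ge0 (ltW cX0); have /andP[yge _] := cY01; have y1 := h_ge0 yge.
  have x2 := h_le1 cX01; have y2 := h_le1 cY01.
  by move: x1 y1 x2 y2; move: (h _) (h _); clear => u w; lra.
Qed.

Lemma triangle_not_tight rlow a : rlow <= 1 -> 0 < a < 1 ->
  (forall r, 0 < r < rlow -> shape_gap r a < 0 /\ r * coweight a < 1) ->
  not_tight_below H (sparse_exponent R H) rlow.
Proof.
move=> rl ha hr r hr0 p hp; have [hg hs] := hr r hr0; have /andP[r0 r1] := hr0.
by apply: (@triangle_two_block r a p) => //; rewrite r0 (lt_le_trans r1).
Qed.

Lemma triangle_tight rbar : 233 / 500 <= rbar ->
  tight_above H (sparse_exponent R H) rbar.
Proof.
move=> hr; have eH : (0 < ecount H)%N by rewrite triangle_ecount.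
have r0 : (0 : R) < 233 / 500 by rewrite divr_gt0 ?ltr0n.
apply: tight_above_of_rs => // [|r /andP[rr r1]]; first exact: le_trans (ltW r0) hr.
apply: (replica_symmetric_mono r0) => //; last first.
- exact: replica_symmetric_triangle triangle_ecount.
- exact: ltW.
- exact: le_trans (ltW rr).
Qed.

End Triangle.

Theorem corollary2p8 (R : realType) (H : sgraph) (hH : (0 < ecount H)%N) :
  exists alpha : R, 0 < alpha /\
  [/\ exists rbar : R, 0 <= rbar < 1 /\ tight_above H alpha rbar,
      ~ bipartite H ->
        exists rlow : R, 0 < rlow <= 1 /\ not_tight_below H alpha rlow
    & isomorphic H (complete_graph 3) ->
        (exists rbar : R,
           [/\ 0 < rbar < 1 /\ 3 / 2 * rbar * ln rbar - rbar + 1 = 0,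
               forall r : R, 0 < r < 1 ->
                 3 / 2 * r * ln r - r + 1 = 0 -> r = rbar,
               466 / 1000 <= rbar < 467 / 1000
             & tight_above H alpha rbar]) /\
        (exists rlow : R,
           [/\ 0 < rlow < 1 /\ f_tri_has_zero rlow,
               forall r : R, 0 < r < 1 -> f_tri_has_zero r -> r <= rlow,
               209 / 1000 <= rlow < 210 / 1000
             & not_tight_below H alpha rlow])].
Proof.
exists (sparse_exponent R H); split.
  by rewrite invr_gt0 ltr_wpDl // mulr_ge0.
split.
- have [r0 /andP[r00 r01] hr0] := replica_symmetric_near1 R hH.
  exists r0; rewrite r01 (ltW r00); split=> //.
  apply: (tight_above_of_rs hH) => [|r /andP[rr r1]]; first exact: ltW.
  by apply: (replica_symmetric_mono r00) => //; exact: ltW.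
- move=> nb; exists (1 / 16); split; first by clear; lra.
  exact: not_tight_nonbipartite.
move=> tri; split.
  have [rbar [h01 h0 hb]] := high_threshold R.
  exists rbar; split=> //; first by move=> r hr er; apply: tri_slack_zero_unique.
  apply: triangle_tight => //; have -> : 233 / 500 = 466 / 1000 :> R by field.
  by have /andP[] := hb.
have [rlow [hb hz hmax [a ha hr]]] := low_threshold R.
have h01 : 0 < rlow < 1 by move: hb; clear; lra.
exists rlow; split=> //; apply: (triangle_not_tight tri _ ha hr).
by have /andP[_ /ltW] := h01.
Qed.
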